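(* Let $r\ge1$ and let $N\subset A$ be a non-zero proper ideal satisfying the level assumption. The open subscheme $\Omega_{A,V^r_N}$ is dense in $Q_{A,V^r_N}$.
   Context: $\mathbb{F}_q$ is a finite field with $q$ elements. $A$ is an admissible coefficient ring containing $\mathbb{F}_q$, i.e. the ring of elements of a global function field $F\supset\mathbb{F}_q$ that are regular outside one fixed place $\infty$; so $F=\mathrm{Quot}(A)$. For $a\in A\setminus\{0\}$ put $\deg_A(a)=\dim_{\mathbb{F}_q}(A/(a))$, and $\deg_A(0)=-\infty$. For a non-zero ideal $N\subset A$ put $\mathrm{Div}(N)=\{a\in A\mid N\subset (a)\}$. Level assumption on a non-zero proper ideal $N\subset A$: there exists a subset $D\subset\mathrm{Div}(N)$ such that (i) for any $a\in A\setminus\{0\}$ there is $b\in A\setminus\{0\}$ which is a product of elements of $D$ with $\deg_A(a-b)<\deg_A(a)$; (ii) for any distinct $a,b\in D$ we have $ab\in\mathrm{Div}(N)$; (iii) any element of $\mathrm{Div}(N)$ is a product of elements of $D$; (iv) $N$ is principal. $V^r_N=(N^{-1}/A)^{\oplus r}$ and $V^r_a=(a^{-1}A/A)^{\oplus r}$ for $a\in A\setminus\{0\}$; for $a\in\mathrm{Div}(N)$ we have $V^r_a\subset V^r_N$. For a finite dimensional $\mathbb{F}_q$-vector space $V$ let $K_V$ be the field of quotients of the symmetric algebra of $V$ over $\mathbb{F}_q$, and $R_V\subset K_V$ the $\mathbb{F}_q$-subalgebra generated by all $\frac1v$, $v\in V\setminus\{0\}$, graded so that each $\frac1v$ has degree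 $1$. $R_{A,V^r_N}$ is the graded factor ring of $R_{V^r_N}\otimes_{\mathbb{F}_q}F$ by the ideal generated by $\frac{1}{av}\otimes a-\sum_{v'\in V^r_a}\frac{1}{v-v'}\otimes 1$ for all $a\in\mathrm{Div}(N)$ and $v\in V^r_N\setminus V^r_a$; $[f]$ denotes the image of $f$. $RS_{A,V^r_N}$ is its localization obtained by inverting $[\frac1v\otimes1]$ for all $v\in V^r_N\setminus\{0\}$. $Q_{A,V^r_N}=\mathrm{Proj}(R_{A,V^r_N})$ and $\Omega_{A,V^r_N}=\mathrm{Proj}(RS_{A,V^r_N})\cong\mathrm{Spec}(RS_{A,V^r_N,0})$, an affine open subscheme of $Q_{A,V^r_N}$ (the locus where all $[\frac1v\otimes1]$ are non-zero). *)

(* Defs.v *)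
From HB Require Import structures.
From mathcomp Require mpoly monalg.
(* The notations of multinomials clash with those of MathComp-Analysis, and some
   of its names shadow those of ssrbool. *)
Import -(notations) mpoly.
Import -(notations) monalg.
From mathcomp Require Import all_boot all_order all_algebra.
From mathcomp Require Import ring.
From mathcomp Require Import mathcomp_extra boolp classical_sets functions.
From mathcomp Require Import cardinality fsbigop constructive_ereal.
From mathcomp Require Import topology_structure.

Set Implicit Arguments.
Unset Strict Implicit.
Unset Printing Implicit Defensive.

Import Order.TTheory GRing.Theory Num.Theory.
Local Open Scope classical_set_scope.
Local Open Scope ring_scope.
Local Open Scope quotient_scope.

Section ModuleQuotient.
Context {k : pzRingType} {M : lmodType k}.

Definition is_submodule (L : set M) : Prop :=
  L 0 /\ forall (a : k) x y, L x -> L y -> L (a *: x + y).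

Definition span_pred (S : set M) : {pred M} :=
  [pred x | `[< smallest is_submodule S x >]].

Lemma span_is_submodule (S : set M) : is_submodule (smallest is_submodule S).
Proof.
split=> [L [[L0 _] _] //|a x y Lx Ly L HL].
by have [[_ L2] _] := HL; apply: L2; [exact: Lx | exact: Ly].
Qed.

Lemma span_pred_closed (S : set M) : submod_closed (span_pred S).
Proof.
have [L0 L2] := span_is_submodule S.
split; first exact/asboolP.
by move=> a x y /asboolP Lx /asboolP Ly; apply/asboolP; exact: L2.
Qed.

HB.instance Definition _ (S : set M) :=
  GRing.isSubmodClosed.Build k M (span_pred S) (span_pred_closed S).

(* M / S for a submodule S; for a mere subset, M / (the submodule it spans). *)
Definition mod_quot (S : set M) : Type := Quotient.quot (span_pred S).

HB.instance Definition _ (S : set M) := GRing.Zmodule.on (mod_quot S).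

Definition mod_proj (S : set M) (x : M) : mod_quot S := \pi x.

Definition mod_quot_scale (S : set M) (a : k) (u : mod_quot S) : mod_quot S :=
  mod_proj S (a *: repr u).

Lemma mod_projP (S : set M) x y :
  mod_proj S x = mod_proj S y <-> x - y \in span_pred S.
Proof.
rewrite /mod_proj; split=> [/eqP|].
  by rewrite -Quotient.idealrBE.
by rewrite Quotient.idealrBE => /eqP.
Qed.

Lemma mod_proj_repr (S : set M) (u : mod_quot S) : mod_proj S (repr u) = u.
Proof. exact: reprK. Qed.

Lemma mod_projD (S : set M) : {morph mod_proj S : x y / x + y}.
Proof. by move=> x y; rewrite /mod_proj !piE. Qed.

Lemma mod_projZ (S : set M) a x :
  mod_proj S (a *: x) = mod_quot_scale a (mod_proj S x).
Proof.
apply/mod_projP; rewrite -scalerBr rpredZ //.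
by apply/mod_projP; rewrite mod_proj_repr.
Qed.

Fact mod_quot_scaleA (S : set M) a b (u : mod_quot S) :
  mod_quot_scale a (mod_quot_scale b u) = mod_quot_scale (a * b) u.
Proof. by rewrite -[u]mod_proj_repr -!mod_projZ scalerA. Qed.

Fact mod_quot_scale1 (S : set M) : left_id 1 (@mod_quot_scale S).
Proof. by move=> u; rewrite -[u]mod_proj_repr -!mod_projZ scale1r. Qed.

Fact mod_quot_scaleDr (S : set M) : right_distributive (@mod_quot_scale S) +%R.
Proof.
move=> a u v; rewrite -[u]mod_proj_repr -[v]mod_proj_repr.
by rewrite -mod_projD -!mod_projZ scalerDr mod_projD.
Qed.

Fact mod_quot_scaleDl (S : set M) (u : mod_quot S) :
  {morph (@mod_quot_scale S)^~ u : a b / a + b}.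
Proof.
by move=> a b; rewrite -[u]mod_proj_repr -!mod_projZ scalerDl mod_projD.
Qed.

HB.instance Definition _ (S : set M) :=
  GRing.Zmodule_isLmodule.Build k (mod_quot S)
    (@mod_quot_scaleA S) (@mod_quot_scale1 S) (@mod_quot_scaleDr S)
    (@mod_quot_scaleDl S).

End ModuleQuotient.

Section RingQuotient.
Context {R : comPzRingType}.

Definition is_ideal (I : set R) : Prop :=
  I 0 /\ forall a x y, I x -> I y -> I (a * x + y).

Definition ideal_pred (S : set R) : {pred R} :=
  [pred x | `[< smallest is_ideal S x >]].

Lemma ideal_pred_mul (S : set R) a x : x \in ideal_pred S -> a * x \in ideal_pred S.
Proof.
move=> /asboolP Ix; apply/asboolP => I HI; have [[I0 I2] _] := HI.
by rewrite -[a * x]addr0; apply: I2 => //; exact: Ix.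
Qed.

Lemma ideal_pred_closed (S : set R) : zmod_closed (ideal_pred S).
Proof.
split; first by apply/asboolP => I [[I0 _] _].
move=> x y /asboolP Ix /asboolP Iy; apply/asboolP => I HI.
have [[I0 I2] _] := HI; rewrite addrC -mulN1r.
by apply: I2; [exact: Iy | exact: Ix].
Qed.

HB.instance Definition _ (S : set R) :=
  GRing.isZmodClosed.Build R (ideal_pred S) (ideal_pred_closed S).

(* The quotient of R by the ideal generated by S. The library's ideal_quot
   requires a proof that this ideal is proper. *)
Definition ring_quot (S : set R) : Type := Quotient.quot (ideal_pred S).

HB.instance Definition _ (S : set R) := GRing.Zmodule.on (ring_quot S).

Definition ring_proj (S : set R) (x : R) : ring_quot S := \pi x.

Definition ring_quot_mul (S : set R) (u v : ring_quot S) : ring_quot S :=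
  ring_proj S (repr u * repr v).

Lemma ring_projP (S : set R) x y :
  ring_proj S x = ring_proj S y <-> x - y \in ideal_pred S.
Proof.
rewrite /ring_proj; split=> [/eqP|].
  by rewrite -Quotient.idealrBE.
by rewrite Quotient.idealrBE => /eqP.
Qed.

Lemma ring_proj_repr (S : set R) (u : ring_quot S) : ring_proj S (repr u) = u.
Proof. exact: reprK. Qed.

Lemma ring_projD (S : set R) : {morph ring_proj S : x y / x + y}.
Proof. by move=> x y; rewrite /ring_proj !piE. Qed.

Lemma ring_projM (S : set R) x y :
  ring_proj S (x * y) = ring_quot_mul (ring_proj S x) (ring_proj S y).
Proof.
apply/ring_projP; set x' := repr _; set y' := repr _.
have -> : x * y - x' * y' = y * (x - x') + x' * (y - y').
  by rewrite !mulrBr [y * x]mulrC [y * x']mulrC addrA subrK.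
by apply: rpredD; apply: ideal_pred_mul; apply/ring_projP; rewrite ring_proj_repr.
Qed.

Fact ring_quot_mulA (S : set R) : associative (@ring_quot_mul S).
Proof.
move=> u v w; rewrite -[u]ring_proj_repr -[v]ring_proj_repr -[w]ring_proj_repr.
by rewrite -!ring_projM mulrA.
Qed.

Fact ring_quot_mulC (S : set R) : commutative (@ring_quot_mul S).
Proof. by move=> u v; rewrite /ring_quot_mul mulrC. Qed.

Fact ring_quot_mul1 (S : set R) : left_id (ring_proj S 1) (@ring_quot_mul S).
Proof. by move=> u; rewrite -[u]ring_proj_repr -ring_projM mul1r. Qed.

Fact ring_quot_mulDl (S : set R) : left_distributive (@ring_quot_mul S) +%R.
Proof.
move=> u v w; rewrite -[u]ring_proj_repr -[v]ring_proj_repr -[w]ring_proj_repr.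
by rewrite -ring_projD -!ring_projM mulrDl ring_projD.
Qed.

HB.instance Definition _ (S : set R) :=
  GRing.Zmodule_isComPzRing.Build (ring_quot S)
    (@ring_quot_mulA S) (@ring_quot_mulC S) (@ring_quot_mul1 S)
    (@ring_quot_mulDl S).

Fact ring_proj_is_zmod_morphism (S : set R) : zmod_morphism (ring_proj S).
Proof. by move=> x y; rewrite /ring_proj !piE. Qed.

Fact ring_proj_is_monoid_morphism (S : set R) : monoid_morphism (ring_proj S).
Proof. by split=> // x y; rewrite ring_projM. Qed.

HB.instance Definition _ (S : set R) :=
  GRing.isZmodMorphism.Build R (ring_quot S) (ring_proj S)
    (ring_proj_is_zmod_morphism S).
HB.instance Definition _ (S : set R) :=
  GRing.isMonoidMorphism.Build R (ring_quot S) (ring_proj S)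
    (ring_proj_is_monoid_morphism S).

End RingQuotient.

Section Localization.
Context {R : comPzRingType}.

Definition is_submonoid (M : set R) : Prop :=
  M 1 /\ forall x y, M x -> M y -> M (x * y).

Variable S : set R.

Definition denom_set : set R := smallest is_submonoid S.

Lemma denom_set1 : denom_set 1.
Proof. by move=> M [[M1 _] _]. Qed.

Lemma denom_setM x y : denom_set x -> denom_set y -> denom_set (x * y).
Proof.
move=> Mx My M HM; have [[_ M2] _] := HM.
by apply: M2; [exact: Mx | exact: My].
Qed.

Definition denom : Type := {s : R | s \in denom_set}.
HB.instance Definition _ := Choice.on denom.

Lemma denomP (s : denom) : denom_set (sval s).
Proof. exact: set_mem (valP s). Qed.

Definition mk_denom (s : R) (Ms : denom_set s) : denom := exist _ s (mem_set Ms).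

Definition denom1 : denom := mk_denom denom_set1.
Definition denomM (s t : denom) : denom := mk_denom (denom_setM (denomP s) (denomP t)).

Definition loc_equiv (x y : R * denom) : bool :=
  `[< exists u : denom, sval u * (x.1 * sval y.2) = sval u * (y.1 * sval x.2) >].

Fact loc_equiv_refl : reflexive loc_equiv.
Proof. by move=> x; apply/asboolP; exists denom1. Qed.

Fact loc_equiv_sym : symmetric loc_equiv.
Proof. by move=> x y; apply/asboolP/asboolP => -[u Hu]; exists u. Qed.

Fact loc_equiv_trans : transitive loc_equiv.
Proof.
move=> [y t] [x s] [z w] /asboolP[u /= Hu] /asboolP[v /= Hv]; apply/asboolP.
exists (denomM (denomM u v) t) => /=.
transitivity (sval v * sval w * (sval u * (x * sval t))); first by ring.
rewrite Hu; transitivity (sval u * sval s * (sval v * (y * sval w))); first by ring.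
by rewrite Hv; ring.
Qed.

Canonical loc_equivalence :=
  EquivRel loc_equiv loc_equiv_refl loc_equiv_sym loc_equiv_trans.

(* The localization of R at the multiplicative subset generated by S. *)
Definition loc : Type := {eq_quot loc_equiv}.
HB.instance Definition _ := Choice.on loc.

Definition loc_frac (x : R) (s : denom) : loc := \pi_({eq_quot loc_equiv}) (x, s).

Lemma loc_fracP x s y t : loc_frac x s = loc_frac y t <->
  exists u : denom, sval u * (x * sval t) = sval u * (y * sval s).
Proof.
rewrite /loc_frac; split=> [/eqmodP/asboolP //|H].
by apply/eqmodP/asboolP.
Qed.

Lemma loc_ind (P : loc -> Prop) : (forall x s, P (loc_frac x s)) -> forall u, P u.
Proof. by move=> HP; elim/quotW => -[x s]; exact: HP. Qed.

Definition loc_add (u v : loc) : loc :=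
  loc_frac ((repr u).1 * sval (repr v).2 + (repr v).1 * sval (repr u).2)
           (denomM (repr u).2 (repr v).2).
Definition loc_opp (u : loc) : loc := loc_frac (- (repr u).1) (repr u).2.
Definition loc_mul (u v : loc) : loc :=
  loc_frac ((repr u).1 * (repr v).1) (denomM (repr u).2 (repr v).2).

Lemma loc_repr x s : exists u : denom,
  sval u * ((repr (loc_frac x s)).1 * sval s) =
  sval u * (x * sval (repr (loc_frac x s)).2).
Proof.
apply/loc_fracP; rewrite -[RHS](reprK (loc_frac x s)) /loc_frac.
by case: (repr (\pi_({eq_quot loc_equiv}) (x, s))).
Qed.

Lemma loc_addE x s y t :
  loc_add (loc_frac x s) (loc_frac y t) =
  loc_frac (x * sval t + y * sval s) (denomM s t).
Proof.
rewrite /loc_add; have [u] := loc_repr x s; have [v] := loc_repr y t.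
case: (repr (loc_frac x s)) (repr (loc_frac y t)) => [x' s'] [y' t'] /= Hv Hu.
apply/loc_fracP; exists (denomM u v) => /=.
transitivity (sval v * sval t * sval t' * (sval u * (x' * sval s))
  + sval u * sval s * sval s' * (sval v * (y' * sval t))); first by ring.
by rewrite Hu Hv; ring.
Qed.

Lemma loc_mulE x s y t :
  loc_mul (loc_frac x s) (loc_frac y t) = loc_frac (x * y) (denomM s t).
Proof.
rewrite /loc_mul; have [u] := loc_repr x s; have [v] := loc_repr y t.
case: (repr (loc_frac x s)) (repr (loc_frac y t)) => [x' s'] [y' t'] /= Hv Hu.
apply/loc_fracP; exists (denomM u v) => /=.
transitivity ((sval u * (x' * sval s)) * (sval v * (y' * sval t))); first by ring.
by rewrite Hu Hv; ring.
Qed.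

Lemma loc_oppE x s : loc_opp (loc_frac x s) = loc_frac (- x) s.
Proof.
rewrite /loc_opp; have [u] := loc_repr x s.
case: (repr (loc_frac x s)) => [x' s'] /= Hu.
by apply/loc_fracP; exists u => /=; rewrite !mulNr !mulrN Hu.
Qed.

Fact loc_addA : associative loc_add.
Proof.
elim/loc_ind=> x s; elim/loc_ind=> y t; elim/loc_ind=> z w.
by rewrite !loc_addE; apply/loc_fracP; exists denom1 => /=; ring.
Qed.

Fact loc_addC : commutative loc_add.
Proof.
elim/loc_ind=> x s; elim/loc_ind=> y t.
by rewrite !loc_addE; apply/loc_fracP; exists denom1 => /=; ring.
Qed.

Fact loc_add0 : left_id (loc_frac 0 denom1) loc_add.
Proof.
elim/loc_ind=> x s.
by rewrite !loc_addE; apply/loc_fracP; exists denom1 => /=; ring.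
Qed.

Fact loc_addN : left_inverse (loc_frac 0 denom1) loc_opp loc_add.
Proof.
elim/loc_ind=> x s.
by rewrite loc_oppE !loc_addE; apply/loc_fracP; exists denom1 => /=; ring.
Qed.

HB.instance Definition _ :=
  GRing.isZmodule.Build loc loc_addA loc_addC loc_add0 loc_addN.

Fact loc_mulA : associative loc_mul.
Proof.
elim/loc_ind=> x s; elim/loc_ind=> y t; elim/loc_ind=> z w.
by rewrite !loc_mulE; apply/loc_fracP; exists denom1 => /=; ring.
Qed.

Fact loc_mulC : commutative loc_mul.
Proof.
elim/loc_ind=> x s; elim/loc_ind=> y t.
by rewrite !loc_mulE; apply/loc_fracP; exists denom1 => /=; ring.
Qed.

Fact loc_mul1 : left_id (loc_frac 1 denom1) loc_mul.
Proof.
elim/loc_ind=> x s.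
by rewrite !loc_mulE; apply/loc_fracP; exists denom1 => /=; ring.
Qed.

Fact loc_mulDl : left_distributive loc_mul +%R.
Proof.
elim/loc_ind=> x s; elim/loc_ind=> y t; elim/loc_ind=> z w.
change (loc_mul (loc_add (loc_frac x s) (loc_frac y t)) (loc_frac z w) =
  loc_add (loc_mul (loc_frac x s) (loc_frac z w))
          (loc_mul (loc_frac y t) (loc_frac z w))).
rewrite !(loc_mulE, loc_addE).
by apply/loc_fracP; exists denom1 => /=; ring.
Qed.

HB.instance Definition _ :=
  GRing.Zmodule_isComPzRing.Build loc loc_mulA loc_mulC loc_mul1 loc_mulDl.

Definition to_loc (x : R) : loc := loc_frac x denom1.

Fact to_loc_is_zmod_morphism : zmod_morphism to_loc.
Proof.
move=> x y; rewrite /to_loc.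
change (loc_frac (x - y) denom1 =
  loc_add (loc_frac x denom1) (loc_opp (loc_frac y denom1))).
rewrite loc_oppE loc_addE.
by apply/loc_fracP; exists denom1 => /=; ring.
Qed.

Fact to_loc_is_monoid_morphism : monoid_morphism to_loc.
Proof.
split=> // x y; rewrite /to_loc.
change (loc_frac (x * y) denom1 = loc_mul (loc_frac x denom1) (loc_frac y denom1)).
rewrite loc_mulE.
by apply/loc_fracP; exists denom1 => /=; ring.
Qed.

HB.instance Definition _ :=
  GRing.isZmodMorphism.Build R loc to_loc to_loc_is_zmod_morphism.
HB.instance Definition _ :=
  GRing.isMonoidMorphism.Build R loc to_loc to_loc_is_monoid_morphism.

End Localization.

Section GradedRings.
Context {R : comPzRingType}.

Definition is_prime_ideal (p : set R) : Prop :=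
  [/\ is_ideal p, ~ p 1 & forall x y, p (x * y) -> p x \/ p y].

(* A grading is given by its homogeneous parts gr d for d in Z; an N-graded ring
   has gr d = 0 for d < 0. *)
Definition is_homogeneous (gr : int -> set R) (p : set R) : Prop :=
  forall x, p x -> exists (n : nat) (d : 'I_n -> int) (f : 'I_n -> R),
    (forall i, gr (d i) (f i) /\ p (f i)) /\ x = \sum_i f i.

(* p does not contain the irrelevant ideal, spanned by the parts of positive
   degree. *)
Definition is_relevant (gr : int -> set R) (p : set R) : Prop :=
  exists (d : int) (f : R), [/\ 0 < d, gr d f & ~ p f].

Record Proj (gr : int -> set R) := ProjPoint {
  point_ideal :> set R;
  point_prime : is_prime_ideal point_ideal;
  point_homogeneous : is_homogeneous gr point_ideal;
  point_relevant : is_relevant gr point_ideal }.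

HB.instance Definition _ gr := gen_eqMixin (Proj gr).
HB.instance Definition _ gr := gen_choiceMixin (Proj gr).

(* The Zariski topology of Proj is the one induced from Spec R. *)
Definition zariski_open (gr : int -> set R) : set (set (Proj gr)) :=
  [set U | exists E : set R, U = [set p : Proj gr | ~ E `<=` p]].

Fact zariski_openT gr : @zariski_open gr setT.
Proof.
exists setT; apply/seteqP; split=> // p _ /= Ep.
by have [_ p1 _] := point_prime p; exact: p1 (Ep _ I).
Qed.

Fact zariski_openI gr : setI_closed (@zariski_open gr).
Proof.
move=> _ _ [E ->] [E' ->].
exists [set x * y | x in E & y in E']; apply/seteqP; split=> p /=.
  have [_ _ pM] := point_prime p.
  move=> [/existsNP[x /not_implyP[Ex px]] /existsNP[y /not_implyP[Ey py]]] EE.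
  by case: (pM x y) => //; apply: EE; exists x => //; exists y.
have [[p0 pD] _ _] := point_prime p.
have pZ a x : point_ideal p x -> point_ideal p (a * x) by move=> px; rewrite -[a * x]addr0; apply: pD.
move=> /existsNP[_ /not_implyP[[x Ex [y Ey <-]] pxy]].
by split=> EE; apply: pxy; [rewrite mulrC|]; apply: pZ; exact: EE.
Qed.

Fact zariski_open_bigU gr (I : Type) (f : I -> set (Proj gr)) :
  (forall i, zariski_open (f i)) -> zariski_open (\bigcup_i f i).
Proof.
move=> /choice[E Ef]; exists (\bigcup_i E i).
apply/seteqP; split=> p /=.
  by move=> [i _]; rewrite Ef /= => Ep EE; apply: Ep => x Ex; apply: EE; exists i.
move=> /existsNP[x /not_implyP[[i _ Ex] px]].
by exists i => //; rewrite Ef /= => Ep; exact: px (Ep _ Ex).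
Qed.

HB.instance Definition _ gr :=
  isOpenTopological.Build (Proj gr)
    (@zariski_openT gr) (@zariski_openI gr) (@zariski_open_bigU gr).

Definition products (S : set R) (n : nat) : set R :=
  [set x | exists s : seq R,
    [/\ size s = n, forall y, y \in s -> S y & x = \prod_(y <- s) y]].

(* The grading induced on the localization at homogeneous elements of degree 1. *)
Definition loc_gr (gr : int -> set R) (S : set R) (d : int) : set (loc S) :=
  [set x | exists (n : int) (m : nat) (f : R) (s : denom S),
    [/\ gr n f, products S m (sval s), d = n - m%:Z & x = loc_frac f s]].

End GradedRings.

Section ProjLocalization.
Context {R : comPzRingType}.

Lemma denom_set_products (S : set R) x :
  denom_set S x -> exists m, products S m x.
Proof.
move=> /(_ [set x | exists m, products S m x]); apply; split=> /=.
  split; first by exists 0%N, [::]; rewrite big_nil.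
  move=> _ _ [m [s [ms Ss ->]]] [n [t [nt St ->]]]; exists (m + n)%N, (s ++ t).
  split; rewrite ?size_cat ?ms ?nt ?big_cat //.
  by move=> y; rewrite mem_cat => /orP[/Ss|/St].
move=> x' Sx; exists 1%N, [:: x']; rewrite big_seq1; split=> // y.
by rewrite inE => /eqP ->.
Qed.

(* Proj of the localization is the locus where no element of S vanishes. *)
Lemma Proj_loc (gr : int -> set R) (S : set R) (q : Proj gr) :
  (exists p : Proj (loc_gr gr (S := S)),
     forall x, point_ideal q x <-> point_ideal p (to_loc S x))
  <-> (forall s, S s -> ~ point_ideal q s).
Proof.
have [[q0 qD] q1 qM] := point_prime q.
have qZ a x : point_ideal q x -> point_ideal q (a * x).
  by move=> qx; rewrite -[a * x]addr0; apply: qD.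
split=> [[p qp] s Ss /qp ps|qS].
  have [[p0 pD] p1 _] := point_prime p; apply: p1.
  have Ms : denom_set S s by move=> M [_]; exact.
  have -> : 1 = loc_frac 1 (mk_denom Ms) * to_loc S s + 0.
    rewrite addr0.
    change (loc_frac 1 (denom1 S) =
      loc_mul (loc_frac 1 (mk_denom Ms)) (loc_frac s (denom1 S))).
    by rewrite loc_mulE; apply/loc_fracP; exists (denom1 S) => /=; ring.
  exact: pD.
have qden (s : denom S) : ~ point_ideal q (sval s).
  have := denomP s; apply: (_ : denom_set S `<=` [set x | ~ point_ideal q x]).
  apply: smallest_sub => //; split=> // x y /= qx qy /qM[].
    exact: qx.
  exact: qy.
pose P : set (loc S) := [set x | exists2 f, point_ideal q f & exists s, x = loc_frac f s].
have PE f s : P (loc_frac f s) -> point_ideal q f.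
  move=> [g qg [t]] /loc_fracP[u] E.
  have : point_ideal q (sval u * (f * sval t)).
    by rewrite E mulrA mulrAC; exact: qZ.
  by move=> /qM[/qden//|/qM[//|/qden]].
have P1 : is_prime_ideal P.
  split.
  - split; first by exists 0 => //; exists (denom1 S).
    elim/(@loc_ind R S)=> a w; elim/(@loc_ind R S)=> x s; elim/(@loc_ind R S)=> y t /PE qx /PE qy.
    change (P (loc_add (loc_mul (loc_frac a w) (loc_frac x s)) (loc_frac y t))).
    rewrite loc_mulE loc_addE; exists (a * x * sval t + y * sval (denomM w s)).
      by rewrite ![_ * sval _]mulrC; apply: (qD); [exact: qZ | exact: qZ].
    by exists (denomM (denomM w s) t).
  - by move/PE.
  - elim/(@loc_ind R S)=> x s; elim/(@loc_ind R S)=> y t.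
    change (P (loc_mul (loc_frac x s) (loc_frac y t)) ->
      P (loc_frac x s) \/ P (loc_frac y t)).
    rewrite loc_mulE => /PE/qM[qx|qy]; [left|right].
      by exists x => //; exists s.
    by exists y => //; exists t.
have P2 : is_homogeneous (loc_gr gr (S := S)) P.
  move=> _ [f qf [s ->]].
  have [n [d [g [gP ->]]]] := point_homogeneous qf.
  have [m ms] := denom_set_products (denomP s).
  exists n, (fun i => d i - m%:Z), (fun i => loc_frac (g i) s); split.
    move=> i; have [gi qi] := gP i; split; last by exists (g i) => //; exists s.
    by exists (d i), m, (g i), s.
  have fracE x : loc_frac x s = to_loc S x * loc_frac 1 s.
    change (loc_frac x s = loc_mul (loc_frac x (denom1 S)) (loc_frac 1 s)).
    by rewrite loc_mulE; apply/loc_fracP; exists (denom1 S) => /=; ring.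
  by rewrite fracE rmorph_sum mulr_suml; apply: eq_bigr => i _; rewrite [RHS]fracE.
have P3 : is_relevant (loc_gr gr (S := S)) P.
  have [d [f [d0 df qf]]] := point_relevant q.
  exists d, (to_loc S f); split=> //; last by move/PE.
  exists d, 0%N, f, (denom1 S); split=> //; last by rewrite subr0.
  by exists [::]; rewrite big_nil.
exists (ProjPoint P1 P2 P3) => x; split=> /= [qx|/PE //].
by exists x => //; exists (denom1 S).
Qed.

End ProjLocalization.

Section TensorProduct.
Context {k B C : comPzRingType}.
Variables (f : {rmorphism k -> B}) (g : {rmorphism k -> C}).

Definition tensor_free : comPzRingType := malg (cmonom (B * C)%type) int.

Definition tensor_gen (b : B) (c : C) : tensor_free := mkmalgU (ucm (b, c)) 1.

Inductive tensor_rel : set tensor_free :=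
| TensorDl b b' c :
    tensor_rel (tensor_gen (b + b') c - (tensor_gen b c + tensor_gen b' c))
| TensorDr b c c' :
    tensor_rel (tensor_gen b (c + c') - (tensor_gen b c + tensor_gen b c'))
| TensorZ a b c :
    tensor_rel (tensor_gen (f a * b) c - tensor_gen b (g a * c))
| TensorM b b' c c' :
    tensor_rel (tensor_gen (b * b') (c * c') - tensor_gen b c * tensor_gen b' c')
| Tensor1 :
    tensor_rel (tensor_gen 1 1 - 1).

(* The tensor product of the commutative k-algebras B and C: the commutative ring
   generated by the symbols b (x) c, modulo the k-balanced biadditivity of
   (b, c) |-> b (x) c and the rule for products of pure tensors. *)
Definition tensor_product : comPzRingType := ring_quot tensor_rel.

Definition pure (b : B) (c : C) : tensor_product :=
  ring_proj tensor_rel (tensor_gen b c).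

End TensorProduct.

Section Bases.
Context {k : fieldType} {W : lmodType k}.

Definition lincomb (e : seq W) (c : 'rV[k]_(size e)) : W :=
  \sum_(i < size e) c 0 i *: e`_i.

Definition is_basis (V : set W) (e : seq W) : Prop :=
  (forall c, V (lincomb (e := e) c)) /\
  (forall v, V v -> exists! c, v = lincomb (e := e) c).

(* A chosen basis of the subspace V; the empty sequence if V is not a finite
   dimensional subspace (which never happens for the spaces A/(a) and (N^-1/A)^r
   of a function field used below). *)
Definition basis (V : set W) : seq W := xget [::] (is_basis V).

Definition vdim (V : set W) : nat := size (basis V).

Definition coords (V : set W) (v : W) : 'rV[k]_(vdim V) :=
  xget 0 [set c | v = lincomb (e := basis V) c].

End Bases.

Section RV.
Context {k : fieldType} {W : lmodType k}.
Variable V : set W.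

(* The symmetric algebra of V, as the polynomial ring on the chosen basis of V;
   to_Sym is the inclusion of V, and KV_inv v is 1/v in its fraction field. *)
Definition Sym : idomainType := mpoly (vdim V) k.

Definition to_Sym (v : W) : Sym :=
  \sum_(i < vdim V) coords V v 0 i *: mpolyX k (mnm1 i).

Definition KV : fieldType := {fraction Sym}.

Definition KV_const (a : k) : KV := FracField.tofrac (mpolyC (vdim V) a : Sym).

Definition KV_inv (v : W) : KV := (FracField.tofrac (to_Sym v))^-1.

Fact KV_const_is_zmod_morphism : zmod_morphism KV_const.
Proof. by move=> a b; rewrite /KV_const !rmorphB. Qed.

Fact KV_const_is_monoid_morphism : monoid_morphism KV_const.
Proof. by split=> [|a b]; rewrite /KV_const ?rmorph1 ?rmorphM. Qed.

HB.instance Definition _ :=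
  GRing.isZmodMorphism.Build k KV KV_const KV_const_is_zmod_morphism.
HB.instance Definition _ :=
  GRing.isMonoidMorphism.Build k KV KV_const KV_const_is_monoid_morphism.

Definition nonzero : set W := [set v | V v /\ v != 0].

Definition is_subalgebra (B : set KV) : Prop :=
  [/\ forall a, B (KV_const a), forall x y, B x -> B y -> B (x - y)
    & forall x y, B x -> B y -> B (x * y)].

Definition RV_pred : {pred KV} :=
  [pred x | `[< smallest is_subalgebra [set KV_inv v | v in nonzero] x >]].

Fact RV_const a : KV_const a \in RV_pred.
Proof. by apply/asboolP => B [[Bc _ _] _]; exact: Bc. Qed.

Fact RV_pred_closed : subring_closed RV_pred.
Proof.
split; first by rewrite -(rmorph1 KV_const) RV_const.
  move=> x y /asboolP Ix /asboolP Iy; apply/asboolP => B HB.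
  by have [[_ BB _] _] := HB; apply: BB; [exact: Ix | exact: Iy].
move=> x y /asboolP Ix /asboolP Iy; apply/asboolP => B HB.
by have [[_ _ BM] _] := HB; apply: BM; [exact: Ix | exact: Iy].
Qed.

HB.instance Definition _ := GRing.isSubringClosed.Build KV RV_pred RV_pred_closed.

Record RV : Type := MkRV { RV_val : KV; _ : RV_val \in RV_pred }.

HB.instance Definition _ := [isSub for RV_val].
HB.instance Definition _ := [Choice of RV by <:].
HB.instance Definition _ := [SubChoice_isSubComNzRing of RV by <:].

Definition RV_scalar (a : k) : RV := MkRV (RV_const a).

Fact RV_scalar_is_zmod_morphism : zmod_morphism RV_scalar.
Proof. by move=> a b; apply: val_inj; rewrite /= rmorphB. Qed.

Fact RV_scalar_is_monoid_morphism : monoid_morphism RV_scalar.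
Proof.
by split=> [|a b]; apply: val_inj; rewrite /= ?rmorph1 ?rmorphM.
Qed.

HB.instance Definition _ :=
  GRing.isZmodMorphism.Build k RV RV_scalar RV_scalar_is_zmod_morphism.
HB.instance Definition _ :=
  GRing.isMonoidMorphism.Build k RV RV_scalar RV_scalar_is_monoid_morphism.

(* 1/v for v in V \ {0}; the value 0 elsewhere is never used. *)
Definition RV_inv (v : W) : RV := insubd 0 (KV_inv v).

Definition is_RV_subspace (G : set RV) : Prop :=
  G 0 /\ forall a x y, G x -> G y -> G (RV_scalar a * x + y).

Definition RV_gr (n : nat) : set RV :=
  smallest is_RV_subspace (products [set RV_inv v | v in nonzero] n).

End RV.

Section FunctionField.
Context {Fq : finFieldType} {F : fieldType}.
Variable iota : {rmorphism Fq -> F}.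

Definition is_transcendental (t : F) : Prop :=
  forall p : {poly Fq}, root (map_poly iota p) t -> p = 0.

Definition ratfun (t : F) : set F :=
  [set x | exists p q : {poly Fq},
    (map_poly iota q).[t] != 0 /\ x = (map_poly iota p).[t] / (map_poly iota q).[t]].

Definition is_global_function_field : Prop :=
  exists t : F, is_transcendental t /\
  exists e : seq F, forall x, exists c : 'I_(size e) -> F,
    (forall i, ratfun t (c i)) /\ x = \sum_i c i * e`_i.

(* A place of F, given by its valuation ring. *)
Definition is_place (O : set F) : Prop :=
  [/\ forall a, O (iota a),
      forall x y, O x -> O y -> O (x - y),
      forall x y, O x -> O y -> O (x * y),
      forall x, O x \/ O x^-1
    & O != setT].

(* F as an Fq-vector space, via iota. *)
Definition res_scalars of {rmorphism Fq -> F} : Type := F.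
HB.instance Definition _ := GRing.Zmodule.on (res_scalars iota).

Definition res_scale (a : Fq) (x : res_scalars iota) : res_scalars iota :=
  (iota a * (x : F)) : F.

Fact res_scaleA a b x : res_scale a (res_scale b x) = res_scale (a * b) x.
Proof. by rewrite /res_scale rmorphM mulrA. Qed.
Fact res_scale1 : left_id 1 res_scale.
Proof. by move=> x; rewrite /res_scale rmorph1 mul1r. Qed.
Fact res_scaleDr : right_distributive res_scale +%R.
Proof. by move=> a x y; rewrite /res_scale mulrDr. Qed.
Fact res_scaleDl x : {morph res_scale^~ x : a b / a + b}.
Proof. by move=> a b; rewrite /res_scale rmorphD mulrDl. Qed.

HB.instance Definition _ :=
  GRing.Zmodule_isLmodule.Build Fq (res_scalars iota)
    res_scaleA res_scale1 res_scaleDr res_scaleDl.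

Variable infty : set F.

(* The ring A of elements regular outside the place infty. *)
Definition Areg : set F :=
  [set x | forall O, is_place O -> O <> infty -> O x].

Definition principal (a : F) : set F := [set a * y | y in Areg].

(* deg_A a = dim_Fq (A / (a)), and deg_A 0 = -oo. *)
Definition degA (a : F) : \bar int :=
  if a == 0 then -oo%E
  else ((vdim [set mod_proj (principal a : set (res_scalars iota)) x | x in Areg])%:Z%:E)%E.

Definition is_A_ideal (N : set F) : Prop :=
  [/\ N `<=` Areg, N 0, forall x y, N x -> N y -> N (x + y)
    & forall a x, Areg a -> N x -> N (a * x)].

Variable N : set F.

Definition Div : set F := [set a | Areg a /\ N `<=` principal a].

Definition is_product_of (D : set F) (b : F) : Prop :=
  exists s : seq F, (forall x, x \in s -> D x) /\ b = \prod_(x <- s) x.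

Definition level_assumption : Prop :=
  exists D : set F,
    [/\ D `<=` Div,
        forall a, Areg a -> a != 0 ->
          exists b, [/\ Areg b, b != 0, is_product_of D b
                      & (degA (a - b) < degA a)%E],
        forall a b, D a -> D b -> a != b -> Div (a * b),
        forall a, Div a -> is_product_of D a
      & exists2 g, Areg g & N = principal g].

Definition ideal_inv : set F := [set x | forall y, N y -> Areg (x * y)].

Variable r : nat.

(* (F/A)^r, in which all the V's below are subspaces. *)
Definition torsion : lmodType Fq :=
  {ffun 'I_r -> mod_quot (Areg : set (res_scalars iota))}.

Definition torsion_mul (a : F) (v : torsion) : torsion :=
  [ffun i => mod_proj (Areg : set (res_scalars iota)) (a * (repr (v i) : F) : F)].

Definition frac_torsion (I : set F) : set torsion :=
  [set v | forall i, exists2 x, I x & v i = mod_proj (Areg : set (res_scalars iota)) x].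

Definition VN : set torsion := frac_torsion ideal_inv.

Definition Va (a : F) : set torsion := frac_torsion [set a^-1 * y | y in Areg].

Definition RV_tensor : comPzRingType := tensor_product (@RV_scalar Fq torsion VN) iota.

Definition RV_pure (x : RV VN) (c : F) : RV_tensor := pure (RV_scalar VN) iota x c.

Definition level_relations : set RV_tensor :=
  [set z | exists (a : F) (v : torsion),
    [/\ Div a, VN v, ~ Va a v &
        z = RV_pure (RV_inv VN (torsion_mul a v)) a
            - \sum_(v' \in Va a) RV_pure (RV_inv VN (v - v')) 1]].

Definition RA : comPzRingType := ring_quot level_relations.

Definition RA_class (z : RV_tensor) : RA := ring_proj level_relations z.

Definition is_additive_subgroup (G : set RA) : Prop :=
  G 0 /\ forall x y, G x -> G y -> G (x - y).

(* The degree n part of RA is the image of RV_n (x) F. *)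
Definition RA_gr (d : int) : set RA :=
  if d is Posz n then
    smallest is_additive_subgroup
      [set RA_class (RV_pure x c) | x in RV_gr (V := VN) n & c in setT]
  else [set 0].

Definition RA_inv (v : torsion) : RA := RA_class (RV_pure (RV_inv VN v) 1).

Definition RS : comPzRingType := loc [set RA_inv v | v in nonzero VN].

Definition RS_gr : int -> set RS := loc_gr RA_gr (S := [set RA_inv v | v in nonzero VN]).

Definition Q : topologicalType := Proj RA_gr.

(* The image of Proj RS under its open immersion into Q = Proj RA, which sends a
   homogeneous prime ideal of RS to its inverse image in RA. *)
Definition Omega : set Q :=
  [set q : Proj RA_gr | exists p : Proj RS_gr,
    forall x : RA, (q : set RA) x <-> (p : set RS) (to_loc _ x)].

Lemma OmegaE :
  Omega = [set q : Proj RA_gr |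
    forall v, VN v -> v != 0 -> ~ point_ideal q (RA_inv v)].
Proof.
apply/seteqP; split=> q /=.
  by move=> /Proj_loc qS v Vv v0; apply: qS; exists v.
by move=> qS; apply/Proj_loc => _ [v [Vv v0] <-]; exact: qS.
Qed.

End FunctionField.

Arguments Omega {Fq F} iota infty N r.

(* Main.v *)
(* A point q of Q is a homogeneous prime ideal of R_A; let L be the residue field
   of R_A at q, rho(v) the image of 1/v in L, and V' the set of the v with
   rho(v) <> 0, together with 0. The relations make w(v) = 1/rho(v) additive on V',
   and by the level assumption w is a partial level structure of a Drinfeld module
   phi over L: phi_a has kernel w(V'_a) for a in Div(N). Choose v_1, ..., v_k in V_N
   such that every element of V_N is v' + sum_i a_i v_i, uniquely up to relations
   in the a_i modulo N, and embed V' + A^k into L[X] by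
     (v', a) |-> w(v') + sum_i phi_(a_i)(X^(q i + 1)).
   Dividing by the A-lattice of the (v', a) that map to 0 in V_N is a Tate
   uniformization near X = oo; truncating the lattice at degree n gives, up to
   errors whose order in 1/X grows with n, a nowhere zero solution of the relations on
   V_N \ {0}, which specializes to rho at X = oo. Completeness is avoided
   by an ultrafilter on n: the elements of R_A whose images vanish to every order
   for almost all n form a homogeneous prime ideal. It lies in Omega, and it omits
   every f that q omits, so it belongs to every open neighbourhood of q. *)
From HB Require Import structures.
From mathcomp Require mpoly monalg.
Import -(notations) mpoly.
Import -(notations) monalg.
From mathcomp Require Import finmap.
From mathcomp Require Import pgroup abelian finfield.
From mathcomp Require Import all_boot all_order all_algebra generic_quotient.
From mathcomp Require Import ring zify.
From mathcomp Require Import mathcomp_extra boolp classical_sets functions filter.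
From mathcomp Require Import cardinality fsbigop constructive_ereal.
From mathcomp Require Import topology_structure.
Require Import Defs.

Set Implicit Arguments.
Unset Strict Implicit.
Unset Printing Implicit Defensive.

Import Order.TTheory GRing.Theory Num.Theory.
Local Open Scope classical_set_scope.
Local Open Scope ring_scope.

(** * Linearized polynomials *)

(** Two obstacles shape the proof. Since [A/N] is not a field, [V'] has no evident complement in
    [V_N]: it might carry too much torsion at one maximal ideal for its size. What forbids this is
    that [w(V')] is the kernel of [phi_g], where [N = (g)]: dimensions over [L] of quotients of the
    skew ring [L{tau}] bound the torsion of [phi] at each maximal ideal by the rank, and a
    comparison of cardinalities then lets the [v_i] be added one by one. The other obstacle is that
    the lattice is infinite and [L(X)] is not complete. A truncation at bounded degree is a finite
    [F_q]-space, so its product polynomial is linearized and yields values that are exactly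
    additive, homogeneous and of the right residue. Only the level relations fail, through the [y]
    below the bound with [a y] above it, whose reciprocals have high order in [1/X]. A second
    variable [T] multiplies every reciprocal, so that the degree in [R_A] becomes the degree in [T]
    and the limit ideal is homogeneous; setting [T = 1] at X = oo recovers [rho]. *)

Lemma linear_dependence (K : fieldType) (a b : nat) (M : 'I_a -> 'rV[K]_b) :
  (b < a)%N -> exists2 c : 'rV[K]_a, c != 0 & \sum_i c 0 i *: M i = 0.
Proof.
move=> ba; pose A := \matrix_i M i.
have : kermx A != 0.
  by rewrite kermx_eq0 /row_free neq_ltn (leq_ltn_trans (rank_leq_col A) ba).
case/rowV0Pn => c /sub_kermxP cA c0; exists c => //.
rewrite -[RHS]cA mulmx_sum_row.
by apply: eq_bigr => i _; rewrite rowK.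
Qed.

Section BasisExists.
Context (k : fieldType) (W : lmodType k) (V : set W).
Hypothesis subV : is_submodule V.

Lemma submod0 : V 0. Proof. by case: subV. Qed.
Lemma submodD x y : V x -> V y -> V (x + y).
Proof. by case: subV => _ VD Vx Vy; rewrite -[x]scale1r; exact: VD. Qed.
Lemma submodZ a x : V x -> V (a *: x).
Proof. by case: subV => V0 VD Vx; rewrite -[_ *: _]addr0; exact: VD. Qed.
Lemma submodN x : V x -> V (- x).
Proof. by move=> Vx; rewrite -scaleN1r; exact: submodZ. Qed.
Lemma submodB x y : V x -> V y -> V (x - y).
Proof. by move=> Vx Vy; apply: submodD => //; exact: submodN. Qed.
Lemma submod_sum (I : Type) (s : seq I) (P : pred I) (f : I -> W) :
  (forall i, P i -> V (f i)) -> V (\sum_(i <- s | P i) f i).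
Proof. by move=> Vf; apply: big_ind => //; [exact: submod0 | exact: submodD]. Qed.

(** The hypothesis bounds the length of independent sequences, so a maximal one exists, and
    maximality makes it span [V]. As [basis] is a choice with a default value, its use rests on this
    existence. *)
Lemma basis_exists n :
  (forall x : 'I_n -> W, (forall i, V (x i)) ->
     exists2 c : 'rV[k]_n, c != 0 & \sum_i c 0 i *: x i = 0) ->
  exists e, is_basis V e.
Proof.
move=> dep.
pose indep (e : seq W) := (forall x, x \in e -> V x) /\
  forall c : 'rV[k]_(size e), lincomb c = 0 -> c = 0.
have notn e : size e = n -> ~ indep e.
  move=> en; subst n; case=> Ve ind.
  have [|c c0 /ind ce] := dep (fun i => e`_i); last by rewrite ce eqxx in c0.
  by move=> i; apply: Ve; exact: mem_nth.
have [e indE maxE] : exists2 e, indep e & forall e', size e' = (size e).+1 -> ~ indep e'.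
  elim: {dep} n notn => [|n IH] notn.
    case: (notn [::]) => //; split => // c _.
    by apply/rowP => -[].
  case: (pselect (exists2 e, size e = n & indep e)) => [[e en ie]|ne].
    by exists e => //; rewrite en.
  by apply: IH => e en ie; apply: ne; exists e.
exists e; have [Ve ind] := indE; split.
  move=> c; apply: submod_sum => i _; apply: submodZ; apply: Ve; exact: mem_nth.
move=> v Vv.
have [c cP] : exists c : 'rV[k]_(size e), v = lincomb c.
  apply: contrapT => nc; apply: (maxE (v :: e)) => //; split.
    by move=> x; rewrite inE => /orP[/eqP->|/Ve].
  move=> c; rewrite /lincomb big_ord_recl /=.
  case: (eqVneq (c 0 ord0) 0) => [c0|c0].
    rewrite c0 scale0r add0r => H.
    have /ind H' : lincomb (e := e) (\row_i c 0 (lift ord0 i)) = 0.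
      by rewrite -[RHS]H; apply: eq_bigr => i _; rewrite mxE.
    apply/rowP => i; rewrite [RHS]mxE; case: (unliftP ord0 i) => [j|] ->; last by [].
    by move/rowP: H' => /(_ j); rewrite !mxE.
  move/eqP; rewrite addr_eq0 => /eqP H; case: nc.
  exists (\row_i (- (c 0 ord0)^-1 * c 0 (lift ord0 i))).
  rewrite -[LHS]scale1r -(mulVf c0) -scalerA H scalerN -scaleNr scaler_sumr.
  by apply: eq_bigr => i _; rewrite mxE scalerA.
exists c; split=> // c'; rewrite cP => cc'.
apply/eqP; rewrite -subr_eq0; apply/eqP/ind.
rewrite /lincomb.
under eq_bigr do rewrite !mxE scalerBl.
by rewrite sumrB; apply/eqP; rewrite subr_eq0; apply/eqP.
Qed.

End BasisExists.

Section Linearized.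
Context (Fq : finFieldType).
Local Notation q := #|Fq|.

Lemma q_gt1 : (1 < q)%N. Proof. exact: finNzRing_gt1. Qed.
Hint Resolve q_gt1 : core.

Lemma q_gt0 : (0 < q)%N. Proof. exact: ltnW. Qed.

Lemma q_pnat p : p \in [pchar Fq] -> p.-nat q.
Proof.
by move=> pF; have := abelem_pgroup (fin_ring_pchar_abelem pF); rewrite /pgroup cardsT.
Qed.

Lemma natr_q : q%:R = 0 :> Fq.
Proof.
have [p pr pF] := finPcharP Fq.
have /p_natP[[|k] qE] := q_pnat pF; first by have := q_gt1; rewrite qE.
by rewrite qE natrX exprS pcharf0 // mul0r.
Qed.

Lemma exprDq (R : comNzRingType) (h : {rmorphism Fq -> R}) (x y : R) i :
  (x + y) ^+ (q ^ i) = x ^+ (q ^ i) + y ^+ (q ^ i).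
Proof.
have [p pr pF] := finPcharP Fq.
have pR : p \in [pchar R] by exact: rmorph_pchar pF.
apply: exprDn_pchar.
rewrite (eq_pnat _ (pcharf_eq pR)).
by rewrite pnatX q_pnat.
Qed.

Lemma expr_sumq (R : comNzRingType) (h : {rmorphism Fq -> R}) (I : Type)
    (s : seq I) (P : pred I) (f : I -> R) i :
  (\sum_(j <- s | P j) f j) ^+ (q ^ i) = \sum_(j <- s | P j) f j ^+ (q ^ i).
Proof.
apply: (big_morph (fun x : R => x ^+ (q ^ i))) => [x y|]; first exact: exprDq.
by rewrite expr0n expn_eq0 -leqn0 leqNgt q_gt0.
Qed.

Lemma expf_cardX (a : Fq) i : a ^+ (q ^ i) = a.
Proof. by elim: i => [|i IH]; rewrite ?expr1 // expnS exprM expf_card. Qed.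

Variables (K : fieldType) (kap : {rmorphism Fq -> K}).
Implicit Types (c d : {poly K}) (f g : {poly K}).

(* The F_q-linearized polynomial \sum_i c_i X^(q^i); c plays the role of an
   element of the skew polynomial ring K{tau}. *)
Definition linp c : {poly K} := \sum_(i < size c) c`_i *: 'X^(q ^ i).

Definition is_linearized f := exists c, f = linp c.

Lemma linpE n c : (size c <= n)%N -> linp c = \sum_(i < n) c`_i *: 'X^(q ^ i).
Proof.
move=> cn; rewrite /linp (big_ord_widen n (fun i => c`_i *: 'X^(q ^ i))) //.
rewrite big_mkcond; apply: eq_bigr => i _; case: ltnP => // h.
by rewrite nth_default // scale0r.
Qed.

Lemma linpD c d : linp (c + d) = linp c + linp d.
Proof.
pose n := maxn (size c) (size d).
rewrite !(@linpE n) ?leq_maxl ?leq_maxr ?size_polyD // -big_split /=.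
by apply: eq_bigr => i _; rewrite coefD scalerDl.
Qed.

Lemma linpZ a c : linp (a *: c) = a *: linp c.
Proof.
rewrite (@linpE (size c)) ?size_scale_leq // scaler_sumr.
by apply: eq_bigr => i _; rewrite coefZ scalerA.
Qed.

Lemma linp0 : linp 0 = 0.
Proof. by have := linpZ 0 0; rewrite !scale0r. Qed.

Lemma linp_sum (I : Type) (s : seq I) (P : pred I) (F : I -> {poly K}) :
  linp (\sum_(i <- s | P i) F i) = \sum_(i <- s | P i) linp (F i).
Proof. by apply: (big_morph linp linpD linp0). Qed.

Lemma linpXn i : linp 'X^i = 'X^(q ^ i).
Proof.
rewrite (@linpE i.+1) ?size_polyXn // (bigD1 ord_max) //= coefXn eqxx scale1r.
rewrite big1 ?addr0 // => j ji; rewrite coefXn.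
by rewrite (_ : (j == i :> nat) = false) ?scale0r //; apply/negbTE.
Qed.

Lemma coef_linp c i : (linp c)`_(q ^ i) = c`_i.
Proof.
pose n := maxn (size c) i.+1.
have ni : (i < n)%N by rewrite leq_maxr.
rewrite (@linpE n) ?leq_maxl // coef_sum (bigD1 (Ordinal ni)) //= coefZ coefXn eqxx.
rewrite mulr1 big1 ?addr0 // => j ji; rewrite coefZ coefXn eqn_exp2l //.
by rewrite eq_sym (_ : (j == i :> nat) = false) ?mulr0 //; apply/negbTE.
Qed.

Lemma linp_eq0 c : linp c = 0 -> c = 0.
Proof. by move=> c0; apply/polyP => i; rewrite -coef_linp c0 !coef0. Qed.

Lemma coef1_linp c : (linp c)`_1 = c`_0.
Proof. by rewrite -(coef_linp c 0) expn0. Qed.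

Lemma coef0_linp c : (linp c)`_0 = 0.
Proof.
rewrite /linp coef_sum big1 // => i _; rewrite coefZ coefXn.
by rewrite eq_sym expn_eq0 -leqn0 leqNgt q_gt0 mulr0.
Qed.

Lemma size_linp c : c != 0 -> size (linp c) = (q ^ (size c).-1).+1.
Proof.
move=> c0; apply/eqP; rewrite eqn_leq; apply/andP; split.
  apply: (leq_trans (size_sum _ _ _)); apply/bigmax_leqP => i _.
  apply: (leq_trans (size_scale_leq _ _)); rewrite size_polyXn ltnS leq_exp2l //.
  by rewrite -ltnS prednK ?lt0n ?size_poly_eq0.
rewrite ltnNge; apply/negP => /leq_sizeP /(_ _ (leqnn _)).
by rewrite coef_linp; apply/eqP; rewrite -lead_coefE lead_coef_eq0.
Qed.

Lemma linp_compD c f g : linp c \Po (f + g) = (linp c \Po f) + (linp c \Po g).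
Proof.
rewrite /linp !linear_sum -big_split /=; apply: eq_bigr => i _.
by rewrite !comp_polyZ !comp_Xn_poly (exprDq (polyC \o kap)) scalerDr.
Qed.

Lemma linp_compZ c a f : linp c \Po (kap a *: f) = kap a *: (linp c \Po f).
Proof.
rewrite /linp !linear_sum /=; apply: eq_bigr => i _.
rewrite !comp_polyZ !comp_Xn_poly exprZn -rmorphXn expf_cardX.
by rewrite !scalerA mulrC.
Qed.

Lemma linp_comp0 c : linp c \Po 0 = 0.
Proof. by have := linp_compZ c 0 0; rewrite rmorph0 !scale0r. Qed.

Lemma linp_compB c f g : linp c \Po (f - g) = (linp c \Po f) - (linp c \Po g).
Proof.
rewrite linp_compD; congr (_ + _).
by have := linp_compZ c (-1) g; rewrite rmorphN1 !scaleN1r.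
Qed.

Lemma linp_comp_sum c (I : Type) (s : seq I) (P : pred I) (F : I -> {poly K}) :
  linp c \Po (\sum_(i <- s | P i) F i) = \sum_(i <- s | P i) (linp c \Po F i).
Proof. by apply: (big_morph _ (linp_compD c) (linp_comp0 c)). Qed.

Lemma horner_linpD c x y : (linp c).[x + y] = (linp c).[x] + (linp c).[y].
Proof.
have := congr1 (fun f : {poly K} => f.[0]) (linp_compD c x%:P y%:P).
by rewrite -polyCD !horner_comp !hornerD !hornerC !horner_comp !hornerC.
Qed.

Lemma horner_linpZ c a x : (linp c).[kap a * x] = kap a * (linp c).[x].
Proof.
have := congr1 (fun f : {poly K} => f.[0]) (linp_compZ c a x%:P).
by rewrite hornerZ !horner_comp hornerZ !hornerC.
Qed.

Lemma horner_linp0 c : (linp c).[0] = 0.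
Proof. by rewrite horner_coef0 coef0_linp. Qed.

Lemma linp_expq c i : is_linearized (linp c ^+ (q ^ i)).
Proof.
exists (\sum_(j < size c) c`_j ^+ (q ^ i) *: 'X^(i + j)).
rewrite linp_sum {1}/linp (expr_sumq (polyC \o kap)); apply: eq_bigr => j _.
by rewrite exprZn linpZ linpXn -exprM -expnD addnC.
Qed.

Lemma is_linearizedD f g : is_linearized f -> is_linearized g -> is_linearized (f + g).
Proof. by move=> [c ->] [d ->]; exists (c + d); rewrite linpD. Qed.

Lemma is_linearizedZ a f : is_linearized f -> is_linearized (a *: f).
Proof. by move=> [c ->]; exists (a *: c); rewrite linpZ. Qed.

Lemma is_linearized0 : is_linearized 0. Proof. by exists 0; rewrite linp0. Qed.

Lemma is_linearizedX : is_linearized 'X.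
Proof. by exists 'X^0; rewrite linpXn expn0 expr1. Qed.

Lemma is_linearized_comp f g :
  is_linearized f -> is_linearized g -> is_linearized (f \Po g).
Proof.
move=> [c ->] [d ->]; rewrite {1}/linp linear_sum /=.
apply: big_ind => [|f' g'|i _]; [exact: is_linearized0 | exact: is_linearizedD |].
by rewrite comp_polyZ comp_Xn_poly; apply: is_linearizedZ; exact: linp_expq.
Qed.

Lemma linp_deriv c : (linp c)^`() = (c`_0)%:P.
Proof.
rewrite (@linpE (size c).+1) // big_ord_recl /= expn0 expr1 derivD derivZ derivX.
rewrite alg_polyC linear_sum big1 ?addr0 // => i _ /=.
rewrite derivZ derivXn /bump leq0n add1n expnS -mulr_natr natrM.
have -> : q%:R = 0 :> {poly K}.
  by rewrite -(rmorph_nat (polyC \o kap)) natr_q rmorph0.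
by rewrite mul0r mulr0 scaler0.
Qed.

(** With [m] the dimension of [s] over [F_q], a linearized polynomial of [q]-degree at most [m] has
    [m + 1] coefficients, and vanishing on a basis imposes [m] conditions. A non-zero solution [C]
    vanishes on all [q^m] elements of [s] by additivity, and its degree leaves no room for other
    roots: it is the product up to a scalar. *)
Lemma subspace_poly_linearized (s : seq K) : uniq s -> 0 \in s ->
  (forall a x y, x \in s -> y \in s -> kap a * x + y \in s) ->
  is_linearized (\prod_(u <- s) ('X - u%:P)).
Proof.
move=> us s0 sD.
pose W : lmodType Fq := res_scalars kap.
pose V : set W := [set x | (x : K) \in s].
have subV : is_submodule V by split=> // a x y; exact: sD.
have [e [Ve He]] : exists e, is_basis V e.
  apply: (@basis_exists _ _ _ subV (size s).+1) => x Vx.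
  have : ~~ injectiveb (fun c : 'rV[Fq]_(size s).+1 => \sum_i c 0 i *: x i : W).
    apply/negP => /injectiveP inj.
    have := @uniq_leq_size K (map (fun c : 'rV[Fq]_(size s).+1 => \sum_i c 0 i *: x i : W)
      (enum [set: 'rV[Fq]_(size s).+1]%SET)) s.
    rewrite map_inj_uniq // enum_uniq size_map -cardE cardsT card_mx mul1n.
    rewrite leqNgt (leq_trans (ltnSn _) (ltnW (ltn_expl _ _))) //.
    move=> H; have : false; last by [].
    apply: H => // y /mapP[c _ ->].
    by apply: (submod_sum subV) => i _; apply: (submodZ subV); exact: Vx.
  move=> /injectivePn[c [d dc E]]; exists (c - d); first by rewrite subr_eq0.
  under eq_bigr do rewrite !mxE scalerBl.
  by rewrite sumrB E subrr.
set m := size e.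
have sE : perm_eq s (map (fun c : 'rV[Fq]_m => lincomb c : K) (enum [set: 'rV[Fq]_m]%SET)).
  apply: uniq_perm => //.
    rewrite map_inj_in_uniq ?enum_uniq // => c d _ _ cd.
    by have [x [_ U]] := He _ (Ve c); rewrite -(U _ erefl) (U d).
  move=> x; apply/idP/mapP => [/He[c [-> _]]|[c _ ->]]; last exact: Ve.
  by exists c; rewrite ?mem_enum ?inE.
have sz : size s = (q ^ m)%N.
  by rewrite (perm_size sE) size_map -cardE cardsT card_mx mul1n.
have [c c0 cE] := @linear_dependence K m.+1 m
  (fun i => \row_j ((e`_j : K) ^+ (q ^ i))) (ltnSn m).
pose C := \poly_(i < m.+1) c 0 (inord i).
have C0 : C != 0.
  apply/eqP => C0; move/eqP: c0; apply; apply/rowP => i; rewrite [RHS]mxE.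
  by have := congr1 (fun p : {poly K} => p`_i) C0; rewrite coef_poly ltn_ord inord_val coef0.
have rootC x : x \in s -> (linp C).[x] = 0.
  move=> /He[b [-> _]]; rewrite /lincomb.
  pose P (u : W) := (linp C).[(u : K)] = 0.
  apply: (@big_ind _ P) => [|u v uC vC|j _]; first exact: horner_linp0.
    by rewrite /P (horner_linpD C (u : K) (v : K)) uC vC addr0.
  rewrite /P.
  rewrite (horner_linpZ C (b 0 j) (e`_j : K)).
  rewrite (@linpE m.+1) ?size_poly // horner_sum.
  have := congr1 (fun M : 'rV_m => M 0 j) cE; rewrite !mxE summxE => E.
  rewrite -[RHS](mulr0 (kap (b 0 j))) -[in RHS]E; congr (_ * _).
  apply: eq_bigr => i _; rewrite !mxE hornerZ hornerXn coef_poly ltn_ord inord_val.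
  by [].
have szC : size (linp C) = (size s).+1.
  apply/eqP; rewrite eqn_leq; apply/andP; split; last first.
    apply: max_poly_roots => //; first by apply: contraNneq C0 => /linp_eq0 ->.
    by apply/allP => x /rootC; rewrite rootE => ->.
  rewrite size_linp // sz ltnS leq_exp2l // -ltnS prednK ?size_poly //.
  by rewrite lt0n size_poly_eq0.
have := @all_roots_prod_XsubC _ (linp C) s szC.
rewrite uniq_rootsE => /(_ _ us) E.
have l0 : lead_coef (linp C) != 0 by rewrite lead_coef_eq0 -size_poly_eq0 szC.
exists ((lead_coef (linp C))^-1 *: C); rewrite linpZ.
rewrite [in X in _ *: X]E; first by rewrite scalerA mulVf // scale1r.
by apply/allP => x /rootC; rewrite rootE => ->.
Qed.

Lemma deriv_prod_XsubC (s : seq K) x : x \notin s ->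
  (\prod_(u <- s) ('X - u%:P))^`().[x] =
  (\prod_(u <- s) ('X - u%:P)).[x] * \sum_(u <- s) (x - u)^-1.
Proof.
elim: s => [|u s IH]; first by rewrite !big_nil derivC !hornerE.
rewrite inE negb_or => /andP[xu xs]; rewrite !big_cons derivM derivXsubC mul1r.
rewrite hornerD !hornerM IH // !hornerXsubC mulrDr -[in RHS]mulrA.
rewrite [_ * (_ * (x - u)^-1)]mulrCA mulfV ?mulr1 ?subr_eq0 //.
by rewrite mulrA.
Qed.

(* The logarithmic derivative of an additive polynomial: its derivative is
   constant. *)
Lemma sum_inv_linearized (s : seq K) a f x : is_linearized f ->
  f = a *: \prod_(u <- s) ('X - u%:P) -> a != 0 -> x \notin s ->
  f.[x] != 0 /\ \sum_(u <- s) (x - u)^-1 = f`_1 / f.[x].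
Proof.
move=> [c fc] fE a0 xs.
have fx0 : f.[x] != 0.
  rewrite fE hornerZ mulf_neq0 // -rootE root_prod_XsubC //.
split=> //; apply: (mulfI fx0); rewrite mulrCA mulfV // mulr1.
have := congr1 (fun p => p^`().[x]) fE; rewrite /= derivZ [in RHS]hornerZ.
rewrite deriv_prod_XsubC // mulrA -hornerZ -fE fc linp_deriv hornerC coef1_linp.
by move=> ->.
Qed.

Lemma coef1_prod_XsubC_neq0 (s : seq K) : uniq s -> 0 \in s ->
  (\prod_(u <- s) ('X - u%:P))`_1 != 0.
Proof.
move=> us s0; rewrite (big_rem 0) //= subr0 coefXM /= -horner_coef0.
by rewrite -[_ == 0]/(root _ _) root_prod_XsubC mem_rem_uniq // inE eqxx.
Qed.

(** Each factor is [1 - x/u]: this is the exponential function of the finite lattice [s], with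
    derivative 1 at 0. The form shows which [u] can produce a pole. *)
Lemma horner_div_coef1 (s : seq K) x : 0 \in s ->
  (\prod_(u <- s) ('X - u%:P)).[x] / (\prod_(u <- s) ('X - u%:P))`_1 =
  x * \prod_(u <- rem 0 s) ((x - u) / (0 - u)).
Proof.
move=> s0; rewrite (big_rem 0) //= subr0 coefXM /= -horner_coef0 hornerM hornerX !horner_prod.
rewrite -mulrA prodf_div; congr (_ * (_ / _)); apply: eq_bigr => u _; by rewrite !hornerE.
Qed.

End Linearized.

(** * Finite sums, finite sets and finite F_q-spaces *)

Lemma big_fibers (R : nmodType) (I J : choiceType) (X : set I) (h : I -> J) (s : seq J)
    (f : I -> R) : finite_set X -> uniq s -> (forall x, X x -> h x \in s) ->
  \sum_(x <- fset_set X) f x = \sum_(i <- s) \sum_(x <- fset_set [set x | X x /\ h x = i]) f x.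
Proof.
move=> fX us Xs.
transitivity (\sum_(i <- s) \sum_(x <- fset_set X | h x == i) f x).
  rewrite (exchange_big_dep xpredT) //= big_seq [RHS]big_seq; apply: eq_bigr => x.
  rewrite in_fset_set // inE => /Xs hs.
  rewrite -big_filter (_ : [seq i <- s | h x == i] = [:: h x]) ?big_seq1 //.
  have -> : [seq i <- s | h x == i] = seq.filter (pred1 (h x)) s.
    by apply: eq_filter => i; rewrite /= eq_sym.
  exact: filter_pred1_uniq.
apply: eq_bigr => i _; rewrite -big_filter; apply: perm_big; apply: uniq_perm.
- by rewrite filter_uniq // fset_uniq.
- exact: fset_uniq.
move=> x; rewrite mem_filter in_fset_set // in_fset_set; last first.
  by apply: sub_finite_set fX => y [].
apply/andP/idP; rewrite !inE; first by move=> [/eqP hx Xx].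
by move=> [Xx /eqP hx].
Qed.

Lemma linear_dependence_fin (K : fieldType) (I T : finType) (M : I -> T -> K) :
  (#|T| < #|I|)%N ->
  exists2 c : I -> K, (exists i, c i != 0) & forall t, \sum_i c i * M i t = 0.
Proof.
move=> TI.
have [c c0 cM] := @linear_dependence K _ _ (fun i => \row_j M (enum_val i) (enum_val j)) TI.
exists (fun i => c 0 (enum_rank i)).
  apply: contrapT => nc; move/eqP: c0; apply; apply/rowP => i; rewrite mxE.
  apply/eqP; rewrite -[_ == _]negbK; apply/negP => ci; apply: nc.
  by exists (enum_val i); rewrite enum_valK.
move=> t; have := congr1 (fun v : 'rV_ _ => v 0 (enum_rank t)) cM.
rewrite mxE summxE => E; rewrite -[RHS]E (reindex (@enum_val I predT)) /=.
  by apply: eq_bigr => i _; rewrite !mxE !enum_rankK enum_valK.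
by apply: onW_bij; exact: enum_val_bij.
Qed.

Section FiniteSets.
Context {T : choiceType}.
Implicit Types X Y : set T.

Definition enumset X : seq T := fset_set X.

Lemma mem_enumset X x : finite_set X -> (x \in enumset X) = (x \in X).
Proof. by move=> fX; rewrite in_fset_set. Qed.

Lemma enumsetP X x : finite_set X -> reflect (X x) (x \in enumset X).
Proof. by move=> fX; rewrite mem_enumset //; apply: (iffP idP); rewrite inE. Qed.

Lemma uniq_enumset X : uniq (enumset X).
Proof. exact: fset_uniq. Qed.

Lemma finite_set_seq X (s : seq T) : (forall x, X x -> x \in s) -> finite_set X.
Proof.
move=> Xs; apply: (@sub_finite_set _ _ [set` s]); last exact: finite_seq.
by move=> x /Xs.
Qed.

End FiniteSets.

Section FiniteSubmodule.
Context (Fq : finFieldType) (W : lmodType Fq) (V : set W).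
Hypothesis subV : is_submodule V.

(** Pigeonhole: [|V|] vectors have [q^|V| > |V|] linear combinations, so two of these coincide. *)
Lemma finite_basis_exists : finite_set V -> exists e, is_basis V e.
Proof.
move=> fV; set s := enumset V.
have [V0 _] := subV.
apply: (@basis_exists _ _ _ subV (size s)) => x Vx.
have : ~~ injectiveb (fun c : 'rV[Fq]_(size s) => \sum_i c 0 i *: x i : W).
  apply/negP => /injectiveP inj.
  have := @uniq_leq_size W (map (fun c : 'rV[Fq]_(size s) => \sum_i c 0 i *: x i : W)
    (enum [set: 'rV[Fq]_(size s)]%SET)) s.
  rewrite map_inj_uniq // enum_uniq size_map -cardE cardsT card_mx mul1n.
  rewrite leqNgt (ltn_expl _ (finNzRing_gt1 _)).
  move=> H; have : false; last by [].
  apply: H => // y /mapP[c _ ->]; apply/enumsetP => //.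
  by apply: (submod_sum subV) => i _; apply: (submodZ subV); exact: Vx.
move=> /injectivePn[c [d dc E]]; exists (c - d); first by rewrite subr_eq0.
under eq_bigr do rewrite !mxE scalerBl.
by rewrite sumrB E subrr.
Qed.

Lemma basis_perm_enumset e : is_basis V e -> finite_set V /\
  perm_eq (enumset V) [seq lincomb c | c <- enum [set: 'rV[Fq]_(size e)]%SET].
Proof.
move=> [Ve He].
have fV : finite_set V.
  apply: (@finite_set_seq _ _ [seq lincomb c | c <- enum [set: 'rV[Fq]_(size e)]%SET]).
  by move=> v /He[c [-> _]]; apply/mapP; exists c; rewrite // mem_enum inE.
split=> //; apply: uniq_perm; first exact: uniq_enumset.
  rewrite map_inj_in_uniq ?enum_uniq // => c d _ _ cd.
  by have [x [_ U]] := He _ (Ve c); rewrite -(U _ erefl) (U d).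
move=> x; apply/enumsetP/mapP => // [/He[c [-> _]]|[c _ ->]]; last exact: Ve.
by exists c; rewrite ?mem_enum ?inE.
Qed.

Lemma size_enumset_basis e : is_basis V e -> size (enumset V) = (#|Fq| ^ size e)%N.
Proof.
move=> /basis_perm_enumset[_ /perm_size ->].
by rewrite size_map -cardE cardsT card_mx mul1n.
Qed.

Lemma basisP : finite_set V -> is_basis V (basis V).
Proof. by move=> /finite_basis_exists[e eV]; apply: (@xgetPex _ [::]); exists e. Qed.

Lemma coordsP v : finite_set V -> V v -> v = lincomb (e := basis V) (coords V v).
Proof.
move=> fV Vv; have [_ /(_ v Vv)[c [cE _]]] := basisP fV.
by apply: (@xgetPex _ 0 [set c | v = lincomb (e := basis V) c]); exists c.
Qed.

Lemma coords_uniq v c : finite_set V -> v = lincomb (e := basis V) c -> coords V v = c.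
Proof.
move=> fV vE; have [Ve He] := basisP fV.
have Vv : V v by rewrite vE.
have [c' [_ U]] := He _ Vv; rewrite -(U _ vE).
by apply/esym/U; exact: coordsP.
Qed.

Lemma size_enumset_submod : finite_set V -> exists n, size (enumset V) = (#|Fq| ^ n)%N.
Proof. by move=> /finite_basis_exists[e /size_enumset_basis eV]; exists (size e). Qed.

End FiniteSubmodule.

(** * Uniform linear dependence in F over F_q[a] *)

Section FiniteQuotients.
Context (Fq : finFieldType) (F : fieldType) (iota : {rmorphism Fq -> F}).
Hypothesis hF : is_global_function_field iota.

(** A count of coefficients over [F_q(t)], over which [F] is spanned by the [m] elements [e]. If [D]
    clears the denominators of multiplication by [a], the coordinates of [a^j x_i], multiplied by a
    power of [D] and a common denominator, are polynomials in [t] whose size grows by at most [d]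
    with each power of [a]. Thus [n] depends on [a] but not on the [x_i]. *)
Lemma poly_dependence (a : F) : exists n, forall x : 'I_n -> F,
  exists2 c : 'I_n -> {poly Fq}, (exists i, c i != 0) &
    \sum_i (map_poly iota (c i)).[a] * x i = 0.
Proof.
have [t [tr [e He]]] := hF; set m := size e.
have [ev evE] : exists ev : {rmorphism {poly Fq} -> F},
    forall p, ev p = (map_poly iota p).[t].
  by exists (horner_eval t \o map_poly iota)%FUN.
have ev0 p : p != 0 -> ev p != 0.
  by apply: contra => /eqP p0; apply/eqP/tr; rewrite /root -evE p0.
have common (k : nat) (x : 'I_k -> F) : exists D : {poly Fq}, D != 0 /\
    exists P : 'I_k -> 'I_m -> {poly Fq},
      forall j, ev D * x j = \sum_l ev (P j l) * e`_l.
  have one y : exists D : {poly Fq}, D != 0 /\ exists P : 'I_m -> {poly Fq},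
      ev D * y = \sum_l ev (P l) * e`_l.
    have [c [cR ->]] := He y.
    have /choice[pq pqP] : forall i, exists pq : {poly Fq} * {poly Fq},
        pq.2 != 0 /\ c i = ev pq.1 / ev pq.2.
      move=> i; have [p [q [q0 cE]]] := cR i; exists (p, q); rewrite !evE; split=> //=.
      by apply: contraNneq q0 => ->; rewrite rmorph0 horner0.
    exists (\prod_i (pq i).2); split.
      by apply/prodf_neq0 => i _; have [] := pqP i.
    exists (fun l => (pq l).1 * \prod_(i | i != l) (pq i).2).
    rewrite mulr_sumr; apply: eq_bigr => l _.
    have [q0 ->] := pqP l; rewrite mulrA; congr (_ * _).
    by rewrite (bigD1 l) //= !rmorphM; field; exact: ev0.
  have /choice[D DP] := fun j => one (x j).
  have D0 j : D j != 0 by have [] := DP j.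
  have /choice[P PP] := fun j => (DP j).2.
  exists (\prod_j D j); split; first by apply/prodf_neq0.
  exists (fun j l => (\prod_(i | i != j) D i) * P j l) => j.
  rewrite (bigD1 j) //= rmorphM mulrAC PP mulr_suml; apply: eq_bigr => l _.
  by rewrite rmorphM mulrC mulrA.
have [D [D0 [P PE]]] := common m (fun j => a * e`_j).
pose d := maxn (size D) (\max_j \max_l size (P j l)).
have Dd : (size D <= d)%N by rewrite leq_maxl.
have Pd j l : (size (P j l) <= d)%N.
  rewrite leq_max; apply/orP; right.
  by apply: leq_trans (leq_bigmax j); exact: (leq_bigmax l).
exists (m * d).+1 => x; set n := (m * d).+1.
have [De [De0 [Q QE]]] := common n x.
pose c := \max_j \max_l size (Q j l).
have Qc j l : (size (Q j l) <= c)%N.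
  by apply: leq_trans (leq_bigmax j); exact: (leq_bigmax l).
have szD k (p : {poly Fq}) b : (size p <= b)%N -> (size (D ^+ k * p)%R <= b + k * d)%N.
  elim: k p b => [|k IH] p b pb; first by rewrite expr0 mul1r mul0n addn0.
  rewrite exprSr -mulrA mulSn addnA; apply: IH.
  apply: (leq_trans (size_polyMleq _ _)).
  by apply: (leq_trans (leq_pred _)); rewrite addnC leq_add.
have /choice[R RP] : forall j, exists R : 'I_n -> 'I_m -> {poly Fq}, forall i,
    ev (D ^+ j * De) * (a ^+ j * x i) = \sum_l ev (R i l) * e`_l /\
    forall l, (size (R i l) <= c + j * d)%N.
  elim=> [|j [R RP]].
    exists Q => i; rewrite !expr0 !mul1r mul0n addn0; split=> //; exact: QE.
  exists (fun i k => \sum_l R i l * P l k) => i; have [RE Rs] := RP i; split.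
    transitivity (ev D * a * (ev (D ^+ j * De) * (a ^+ j * x i))).
      by rewrite !exprS !rmorphM /=; ring.
    rewrite RE mulr_sumr.
    under eq_bigr => l _ do rewrite mulrCA -mulrA PE mulr_sumr.
    rewrite exchange_big /=; apply: eq_bigr => k _.
    rewrite rmorph_sum mulr_suml; apply: eq_bigr => l _.
    by rewrite mulrA rmorphM.
  move=> k; apply: (leq_trans (size_sum _ _ _)); apply/bigmax_leqP => l _.
  apply: (leq_trans (size_polyMleq _ _)); apply: (leq_trans (leq_pred _)).
  by rewrite mulSn [(d + _)%N]addnC addnA leq_add.
(* The [n * J = (m * d + 1) * J] unknowns face [m * (c + J * d)] equations; the surplus is
   [J - m * c], and this is the least [J] that makes it positive. *)
pose J := (m * c).+1.
(* The factor [D^(J - j)] brings all the [a^j x_i] to the same denominator [D^J * De]. *)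
pose S (ij : 'I_n * 'I_J) l := D ^+ (J - ij.2) * R ij.2 ij.1 l.
have Ssz ij l : (size (S ij l) <= c + J * d)%N.
  have [_ /(_ l) h] := RP ij.2 ij.1.
  apply: (leq_trans (szD _ _ _ h)); rewrite -addnA -mulnDl subnKC //.
  exact: ltnW.
have [|al [[i0 j0] al0] alE] := @linear_dependence_fin Fq
    ('I_n * 'I_J)%type ('I_m * 'I_(c + J * d))%type (fun ij lk => (S ij lk.1)`_lk.2).
  rewrite !card_prod !card_ord /n /J.
  by rewrite mulnDr !mulSn mulnDr addnA; nia.
have alS l : \sum_ij al ij *: S ij l = 0.
  apply/polyP => k; rewrite coef0 coef_sum.
  have [kb|kb] := ltnP k (c + J * d).
    rewrite -[RHS](alE (l, Ordinal kb)); apply: eq_bigr => ij _.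
    by rewrite coefZ.
  by apply: big1 => ij _; rewrite coefZ nth_default ?mulr0 // (leq_trans (Ssz _ _)).
exists (fun i => \poly_(j < J) al (i, inord j)).
  exists i0; apply: contraNneq al0 => /polyP /(_ j0).
  by rewrite coef_poly ltn_ord inord_val coef0 => ->.
have E0 : ev (D ^+ J * De) != 0 by rewrite rmorphM rmorphXn mulf_neq0 ?expf_neq0 // ev0.
apply: (mulfI E0); rewrite mulr0.
transitivity (\sum_l ev (\sum_ij al ij *: S ij l) * e`_l); last first.
  by apply: big1 => l _; rewrite alS rmorph0 mul0r.
transitivity (\sum_ij iota (al ij) * (ev (D ^+ J * De) * (a ^+ ij.2 * x ij.1))).
  transitivity (\sum_i \sum_j iota (al (i, j)) * (ev (D ^+ J * De) * (a ^+ j * x i))); last first.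
    by rewrite pair_bigA; apply: eq_bigr => -[].
  rewrite mulr_sumr.
  apply: eq_bigr => i _.
  rewrite (@horner_coef_wide _ J); last first.
    by rewrite (leq_trans (size_poly _ _)) // size_poly.
  rewrite mulr_suml mulr_sumr; apply: eq_bigr => j _.
  by rewrite coef_map coef_poly ltn_ord inord_val /=; ring.
under [RHS]eq_bigr do rewrite rmorph_sum mulr_suml.
rewrite exchange_big /=; apply: eq_bigr => -[i j] _ /=.
have [RE _] := RP j i.
have -> : ev (D ^+ J * De) = ev (D ^+ (J - j)) * ev (D ^+ j * De).
  by rewrite -rmorphM mulrA -exprD subnK // ltnW.
rewrite -mulrA RE !mulr_sumr; apply: eq_bigr => l _.
rewrite /S /= -mul_polyC !rmorphM !mulrA; congr (_ * _ * _ * _).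
by rewrite evE map_polyC hornerC.
Qed.
End FiniteQuotients.

(** * The torsion modules *)

Section PowerSet.
Context {T : choiceType} (r : nat) (X : set T).

Definition ffun_pow : set {ffun 'I_r -> T} := [set v | forall i, X (v i)].

Lemma ffun_pow_perm : finite_set X ->
  perm_eq (enumset ffun_pow)
    [seq [ffun i => val (f i)] | f : {ffun 'I_r -> fset_set X}] /\ finite_set ffun_pow.
Proof.
move=> fX.
set s := [seq _ | f : _].
have sP v : reflect (ffun_pow v) (v \in s).
  apply: (iffP mapP) => [[f _ ->] i|Xv].
    rewrite ffunE; have := valP (f i); rewrite in_fset_set // inE; exact.
  have Xv' i : v i \in fset_set X by rewrite in_fset_set // inE; exact: Xv.
  exists [ffun i => FSetSub (Xv' i)]; first by rewrite mem_enum.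
  by apply/ffunP => i; rewrite !ffunE.
have fin : finite_set ffun_pow by apply: (@finite_set_seq _ _ s) => v /sP.
split=> //; apply: uniq_perm; first exact: uniq_enumset.
  rewrite map_inj_uniq ?enum_uniq // => f h /ffunP fh; apply/ffunP => i.
  by apply: val_inj; have := fh i; rewrite !ffunE.
by move=> v; apply/enumsetP/sP.
Qed.

Lemma finite_ffun_pow : finite_set X -> finite_set ffun_pow.
Proof. by move=> /ffun_pow_perm[]. Qed.

Lemma size_ffun_pow : finite_set X ->
  size (enumset ffun_pow) = (size (enumset X) ^ r)%N.
Proof.
move=> fX; have [/perm_size -> _] := ffun_pow_perm fX.
by rewrite size_map -cardE card_ffun card_ord -cardfE.
Qed.

End PowerSet.

(** * The ring A and its action on (F/A)^r *)

Section Coefficients.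
Context (Fq : finFieldType) (F : fieldType) (iota : {rmorphism Fq -> F}).
Context (infty : set F).
Hypothesis hF : is_global_function_field iota.
Local Notation A := (Areg iota infty).
Local Notation W := (res_scalars iota).
Local Notation FA := (mod_quot (A : set W)).

Lemma Areg_const a : A (iota a). Proof. by move=> O [Oi _ _ _ _] _; exact: Oi. Qed.
Lemma Areg0 : A 0. Proof. by rewrite -(rmorph0 iota); exact: Areg_const. Qed.
Lemma Areg1 : A 1. Proof. by rewrite -(rmorph1 iota); exact: Areg_const. Qed.
Lemma AregB x y : A x -> A y -> A (x - y).
Proof.
by move=> Ax Ay O pO nO; have [_ OB _ _ _] := pO; apply: OB; [exact: Ax | exact: Ay].
Qed.
Lemma AregM x y : A x -> A y -> A (x * y).
Proof.
by move=> Ax Ay O pO nO; have [_ _ OM _ _] := pO; apply: OM; [exact: Ax | exact: Ay].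
Qed.
Lemma AregN x : A x -> A (- x).
Proof. by move=> Ax; rewrite -sub0r; apply: AregB => //; exact: Areg0. Qed.
Lemma AregD x y : A x -> A y -> A (x + y).
Proof. by move=> Ax Ay; rewrite -[y]opprK; apply: AregB => //; exact: AregN. Qed.
Lemma AregX x n : A x -> A (x ^+ n).
Proof.
move=> Ax; elim: n => [|n IH]; first by rewrite expr0; exact: Areg1.
by rewrite exprS; exact: AregM.
Qed.
Lemma Areg_sum (I : Type) (s : seq I) (P : pred I) (f : I -> F) :
  (forall i, P i -> A (f i)) -> A (\sum_(i <- s | P i) f i).
Proof. by move=> Af; apply: big_ind => //; [exact: Areg0 | exact: AregD]. Qed.
Lemma Areg_prod (I : eqType) (s : seq I) (f : I -> F) :
  (forall i, i \in s -> A (f i)) -> A (\prod_(i <- s) f i).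
Proof.
move=> Af; rewrite big_seq; apply: big_ind => //; [exact: Areg1 | exact: AregM].
Qed.

Lemma Areg_horner (p : {poly Fq}) a : A a -> A (map_poly iota p).[a].
Proof.
move=> Aa; rewrite horner_poly; apply: Areg_sum => i _.
by apply: AregM; [exact: Areg_const | exact: AregX].
Qed.

(** Valuation rings are integrally closed: if [1/x] is in [O], dividing the equation by [x^(k-1)]
    writes [x] as a polynomial in [1/x] with coefficients in [O]. *)
Lemma Areg_integral x k (c : 'I_k -> F) : (0 < k)%N -> (forall i, A (c i)) ->
  x ^+ k = \sum_(i < k) c i * x ^+ i -> A x.
Proof.
case: k c => // k c _ Ac xE O pO nO; have [Oi OB OM Ox _] := pO.
have O0 : O 0 by rewrite -(rmorph0 iota).
have O1 : O 1 by rewrite -(rmorph1 iota).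
have ON y : O y -> O (- y) by rewrite -sub0r; exact: OB.
have OD y z : O y -> O z -> O (y + z) by move=> Oy /ON Oz; rewrite -[z]opprK; exact: OB.
have OX y n : O y -> O (y ^+ n).
  by move=> Oy; elim: n => [|n IH]; [rewrite expr0 | rewrite exprS; exact: OM].
have [x0|x0] := eqVneq x 0; first by rewrite x0.
case: (Ox x) => // OV.
have -> : x = \sum_(i < k.+1) c i * x^-1 ^+ (k - i).
  apply: (mulIf (expf_neq0 k x0)); rewrite -exprS xE mulr_suml.
  apply: eq_bigr => i _; rewrite -mulrA; congr (_ * _).
  have ik : (i <= k)%N by rewrite -ltnS.
  have -> : x ^+ k = x ^+ (k - i) * x ^+ i by rewrite -exprD subnK.
  by rewrite mulrA -exprMn mulVf // expr1n mul1r.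
apply: big_ind => // i _; apply: OM; last exact: OX.
exact: (Ac i).
Qed.

(** This is the finiteness of [A/(a)]. The constant terms of a relation over [F_q[a]] give a
    relation modulo [a]; if they all vanish, the relation can be divided by [a], which lowers the
    bound [s] on the sizes of its coefficients. *)
Lemma dependence_mod (a : F) : A a -> a != 0 -> exists n, forall x : 'I_n -> F,
  (forall i, A (x i)) ->
  exists2 al : 'I_n -> Fq, (exists i, al i != 0) &
    exists2 y, A y & \sum_i iota (al i) * x i = a * y.
Proof.
move=> Aa a0; have [n dep] := poly_dependence hF a; exists n => x Ax.
have [c [i0 ci0] cE] := dep x.
have [s cs] : exists s, forall i, (size (c i) <= s)%N.
  by exists (\max_i size (c i)) => i; exact: leq_bigmax.
elim: s c i0 ci0 cE cs => [|s IH] c i0 ci0 cE cs.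
  by have := cs i0; rewrite leqn0 size_poly_eq0 (negbTE ci0).
have cX i : c i = drop_poly 1 (c i) * 'X + ((c i)`_0)%:P.
  rewrite -{1}(poly_take_drop 1 (c i)) addrC; congr (_ + _).
  by apply/polyP => j; rewrite coef_take_poly coefC; case: j.
have cxE : \sum_i (map_poly iota (c i)).[a] * x i =
    a * (\sum_i (map_poly iota (drop_poly 1 (c i))).[a] * x i)
    + \sum_i iota (c i)`_0 * x i.
  rewrite mulr_sumr -big_split /=; apply: eq_bigr => i _.
  rewrite {1}[c i]cX rmorphD rmorphM /= map_polyX map_polyC !hornerE /=.
  by ring.
case: (pselect (exists i, (c i)`_0 != 0)) => [ex|nex].
  exists (fun i => (c i)`_0) => //.
  exists (- \sum_i (map_poly iota (drop_poly 1 (c i))).[a] * x i).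
    apply: AregN; apply: Areg_sum => i _; apply: AregM => //; exact: Areg_horner.
  by apply/eqP; rewrite mulrN -addr_eq0 addrC -cxE cE.
have c0 i : (c i)`_0 = 0.
  by apply/eqP; rewrite -[_ == _]negbK; apply/negP => h; apply: nex; exists i.
apply: (IH (fun i => drop_poly 1 (c i)) i0).
- by apply: contraNneq ci0 => h; rewrite [c i0]cX h c0 mul0r add0r.
- apply: (mulfI a0); rewrite mulr0 -[RHS]cE cxE.
  by rewrite [X in _ = _ + X]big1 ?addr0 // => i _; rewrite c0 rmorph0 mul0r.
- by move=> i; rewrite size_drop_poly leq_subLR add1n.
Qed.

Lemma sub_Areg : is_submodule (A : set W).
Proof.
split; first exact: Areg0.
move=> a x y Ax Ay; apply: AregD => //; apply: AregM => //; exact: Areg_const.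
Qed.

Definition prA (x : F) : FA := mod_proj (A : set W) x.

Lemma prA_eq x y : prA x = prA y <-> A (x - y).
Proof.
rewrite /prA mod_projP inE; split=> [/(_ _ (conj sub_Areg (fun _ h => h)))//|Axy].
by move=> L [_]; apply.
Qed.

Lemma prA_eq0 x : prA x = 0 <-> A x.
Proof.
have -> : (0 : FA) = prA 0 by apply: (addrI (prA 0)); rewrite -mod_projD !addr0.
by rewrite prA_eq subr0.
Qed.

Lemma prAD : {morph prA : x y / x + y}.
Proof. by move=> x y; exact: (@mod_projD _ W (A : set W) (x : W) (y : W)). Qed.
Lemma prAZ a x : prA (iota a * x) = a *: prA x.
Proof. exact: (@mod_projZ _ W (A : set W) a (x : W)). Qed.
Lemma prA0 : prA 0 = 0. Proof. by apply/prA_eq0; exact: Areg0. Qed.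
Lemma prA_repr (u : FA) : prA (repr u : W) = u. Proof. exact: mod_proj_repr. Qed.
Lemma prA_mul a x y : A a -> prA x = prA y -> prA (a * x) = prA (a * y).
Proof. by move=> Aa /prA_eq xy; apply/prA_eq; rewrite -mulrBr; exact: AregM. Qed.

Context (r : nat).
Local Notation tor := (torsion iota infty r).
Local Notation act := (@torsion_mul Fq F iota infty r).

Definition prV (x : 'I_r -> F) : tor := [ffun i => prA (x i)].

Lemma prV_repr (v : tor) : exists x, v = prV x.
Proof. by exists (fun i => repr (v i) : W); apply/ffunP => i; rewrite ffunE prA_repr. Qed.

Lemma act_prV a x : A a -> act a (prV x) = prV (fun i => a * x i).
Proof.
move=> Aa; apply/ffunP => i; rewrite !ffunE; apply: (prA_mul Aa).
by rewrite prA_repr.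
Qed.

Lemma prVD x y : prV x + prV y = prV (fun i => x i + y i).
Proof. by apply/ffunP => i; rewrite !ffunE prAD. Qed.
Lemma prVZ a x : a *: prV x = prV (fun i => iota a * x i).
Proof. by apply/ffunP => i; rewrite !ffunE prAZ. Qed.
Lemma prV_eq x y : (forall i, A (x i - y i)) <-> prV x = prV y.
Proof.
split=> [xy|/ffunP xy i]; first by apply/ffunP => i; rewrite !ffunE; apply/prA_eq.
by apply/prA_eq; have := xy i; rewrite !ffunE.
Qed.
Lemma prV_eq0 x : (forall i, A (x i)) <-> prV x = 0.
Proof.
split=> [x0|/ffunP x0 i]; first by apply/ffunP => i; rewrite !ffunE; apply/prA_eq0.
by apply/prA_eq0; have := x0 i; rewrite !ffunE.
Qed.

Lemma actD a u v : A a -> act a (u + v) = act a u + act a v.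
Proof.
have [x ->] := prV_repr u; have [y ->] := prV_repr v => Aa.
by rewrite prVD !act_prV // prVD; apply/prV_eq => i; rewrite mulrDr subrr; exact: Areg0.
Qed.
Lemma actDl a b v : A a -> A b -> act (a + b) v = act a v + act b v.
Proof.
have [x ->] := prV_repr v => Aa Ab; have Aab := AregD Aa Ab.
by rewrite !act_prV // prVD; apply/prV_eq => i; rewrite mulrDl subrr; exact: Areg0.
Qed.
Lemma actM a b v : A a -> A b -> act (a * b) v = act a (act b v).
Proof.
have [x ->] := prV_repr v => Aa Ab; have Aab := AregM Aa Ab.
by rewrite !act_prV //; apply/prV_eq => i; rewrite mulrA subrr; exact: Areg0.
Qed.
Lemma act_const a v : act (iota a) v = a *: v.
Proof. by have [x ->] := prV_repr v; rewrite act_prV ?prVZ //; exact: Areg_const. Qed.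
Lemma act1 v : act 1 v = v.
Proof. by rewrite -(rmorph1 iota) act_const scale1r. Qed.
Lemma act0l v : act 0 v = 0.
Proof. by rewrite -(rmorph0 iota) act_const scale0r. Qed.
Lemma act0 a : A a -> act a 0 = 0.
Proof. by move=> Aa; apply: (addIr (act a 0)); rewrite -actD // !add0r. Qed.
Lemma actNl a v : A a -> act (- a) v = - act a v.
Proof.
move=> Aa; apply/eqP; rewrite -addr_eq0 -actDl ?addNr ?act0l //; exact: AregN.
Qed.
Lemma actBl a b v : A a -> A b -> act (a - b) v = act a v - act b v.
Proof. by move=> Aa Ab; rewrite actDl ?actNl //; exact: AregN. Qed.
Lemma actN a v : A a -> act a (- v) = - act a v.
Proof. by move=> Aa; apply/eqP; rewrite -addr_eq0 -actD // addNr act0. Qed.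
Lemma actB a u v : A a -> act a (u - v) = act a u - act a v.
Proof. by move=> Aa; rewrite actD // actN. Qed.
Lemma actZ a b v : A a -> act a (b *: v) = b *: act a v.
Proof.
move=> Aa; rewrite -!act_const -!actM //; try exact: Areg_const.
by rewrite mulrC.
Qed.
Lemma act_sum a (I : Type) (s : seq I) (P : pred I) (f : I -> tor) : A a ->
  act a (\sum_(i <- s | P i) f i) = \sum_(i <- s | P i) act a (f i).
Proof.
move=> Aa; apply: (big_morph (act a)); last exact: act0.
by move=> u v; exact: actD.
Qed.

End Coefficients.

Lemma choice2 (T U : Type) (P Q : T -> U -> Prop) :
  (forall x, exists2 y, P x y & Q x y) -> exists f, forall x, P x (f x) /\ Q x (f x).
Proof.
move=> PQ; have /choice[f fP] : forall x, exists y, P x y /\ Q x y.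
  by move=> x; have [y] := PQ x; exists y.
by exists f.
Qed.

(** * Principal ideals of A/(g) and simple classes *)

Section Level.
Context (Fq : finFieldType) (F : fieldType) (iota : {rmorphism Fq -> F}).
Context (infty : set F).
Hypothesis hF : is_global_function_field iota.
Local Notation A := (Areg iota infty).
Local Notation W := (res_scalars iota).
Local Notation FA := (mod_quot (A : set W)).
Local Notation prA := (@prA Fq F iota infty).

Variable g : F.
Hypotheses (Ag : A g) (g0 : g != 0).

(** Division by [g] identifies [A/(g)] with [g^-1 A / A]; [cls c] is the image of the principal
    ideal generated by [c], and [A (x / g)] means throughout that [g] divides [x]. *)
Definition cls (c : F) : set FA := [set prA (a * c / g) | a in A].

Lemma sub_cls c : is_submodule (cls c).
Proof.
split; first by exists 0; [exact: Areg0 | rewrite !mul0r prA0].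
move=> a _ _ [x Ax <-] [y Ay <-]; exists (iota a * x + y).
  by apply: AregD => //; apply: AregM => //; exact: Areg_const.
by rewrite -prAZ -prAD !mulrDl !mulrA.
Qed.

Lemma cls_subset c x : A x -> cls (x * c) `<=` cls c.
Proof. by move=> Ax _ [a Aa <-]; exists (a * x); [exact: AregM | rewrite !mulrA]. Qed.

Lemma finite_cls1 : finite_set (cls 1).
Proof.
have [n dep] := dependence_mod hF Ag g0.
have [|e eb] := @basis_exists _ _ _ (sub_cls 1) n; last by case: (basis_perm_enumset eb).
move=> x /choice2[y yP].
have [|al [i0 al0] [z Az zE]] := dep y; first by move=> i; case: (yP i).
exists (\row_i al i).
  by apply: contraNneq al0 => /rowP /(_ i0); rewrite !mxE => ->.
have /prA_eq0 E : A (\sum_i iota (al i) * (y i * 1 / g)).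
  suff -> : \sum_i iota (al i) * (y i * 1 / g) = z by [].
  apply: (mulfI g0); rewrite -zE mulr_sumr; apply: eq_bigr => i _.
  by field; exact: g0.
rewrite -[RHS]E (big_morph _ (@prAD Fq F iota infty) (@prA0 Fq F iota infty)).
by apply: eq_bigr => i _; rewrite prAZ mxE; case: (yP i) => _ <-.
Qed.

Lemma finite_cls c : A c -> finite_set (cls c).
Proof.
move=> Ac; apply: sub_finite_set finite_cls1.
by rewrite -{1}[c]mulr1; exact: cls_subset.
Qed.

(* A is integrally closed, so c/g cannot preserve its own denominator ideal;
   this makes the annihilator of c in A/g locally principal. *)
Lemma locally_principal c : A c -> ~ A (c / g) ->
  exists p u, [/\ A p, A u, p * c = g * u & ~ A (u * c / g)].
Proof.
move=> Ac nAc; apply: contrapT => no; apply: nAc; set y := c / g.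
(* Without such [p] and [u], multiplication by [y = c/g] preserves [p * y] for every denominator [p]
   of [y]; as [g] is a denominator, all [g * y^n] lie in [A]. *)
have stable p : A p -> A (p * y) -> A (p * y * y).
  move=> Ap Apy; apply: contrapT => h; apply: no; exists p, (p * y); split=> //.
    by rewrite /y; field; exact: g0.
  by rewrite -mulrA.
have pow n : A (g * y ^+ n) /\ A (g * y ^+ n.+1).
  elim: n => [|n [IH1 IH2]].
    split; first by rewrite expr0 mulr1.
    by rewrite expr1 /y mulrCA mulfV // mulr1.
  split=> //; rewrite exprSr mulrA exprSr mulrA.
  by apply: stable => //; rewrite -mulrA -exprSr.
(* A dependence modulo [g] among the [g * y^(i+1)], divided by [g], is an algebraic equation for [y]
   over [F_q] except for its constant term [z] in [A]. Its last non-zero coefficient, at index [k],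
   makes it monic of degree [k + 1]. *)
have [n dep] := dependence_mod hF Ag g0.
have [|al [i0 al0] [z Az zE]] := dep (fun i => g * y ^+ i.+1); first by move=> i; case: (pow i).
have {}zE : \sum_(i < n) iota (al i) * y ^+ i.+1 = z.
  apply: (mulfI g0); rewrite -zE mulr_sumr; apply: eq_bigr => i _.
  by rewrite mulrCA.
have [k alk kmax] := @arg_maxnP _ i0 (fun i => al i != 0) (fun i => i : nat) al0.
pose al' (j : nat) : Fq := if insub j is Some j' then al j' else 0.
have al'E (i : 'I_n) : al' i = al i by rewrite /al' valK.
have al'0 j : (k < j)%N -> al' j = 0.
  rewrite /al'; case: insubP => // i _ <- ki; apply: contraTeq ki => /kmax.
  by rewrite -leqNgt.
have {}zE : \sum_(i < k) iota (al' i) * y ^+ i.+1 + iota (al' k) * y ^+ k.+1 = z.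
  rewrite -(big_ord_recr k (fun i => iota (al' i) * y ^+ i.+1)) /= -zE.
  under [RHS]eq_bigr do rewrite -al'E.
  rewrite (big_ord_widen n (fun i => iota (al' i) * y ^+ i.+1)) // big_mkcond.
  apply: eq_bigr => i _; case: ltnP => // /al'0 ->.
  by rewrite rmorph0 mul0r.
pose cf (i : 'I_k.+1) : F := (iota (al k))^-1 *
  (if (i : nat) is j.+1 then - iota (al' j) else z).
have ialk : iota (al k) != 0 by rewrite fmorph_eq0.
apply: (@Areg_integral _ _ _ _ y k.+1 cf) => //.
  move=> i; rewrite /cf -fmorphV; apply: AregM; first exact: Areg_const.
  by case: (i : nat) => // j; apply: AregN; exact: Areg_const.
apply: (mulfI ialk); rewrite mulr_sumr.
under eq_bigr do rewrite /cf !mulrA mulfV // mul1r.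
rewrite big_ord_recl /= expr0 mulr1 -zE al'E addrAC -big_split /=.
by rewrite big1 ?add0r // => i _; rewrite /bump leq0n add1n mulNr subrr.
Qed.

(** The class of [c] generates a minimal non-zero ideal of [A/(g)]; its annihilator is a maximal
    ideal of [A] containing [g]. *)
Definition simple_mod (c : F) : Prop := [/\ A c, ~ A (c / g) &
  forall x, A x -> ~ A (x * c / g) -> exists2 y, A y & A ((y * x * c - c) / g)].

(** Among the non-zero multiples of [a] in the finite ring [A/(g)], one that generates an ideal of
    least cardinality is simple. *)
Lemma simple_multiple a : A a -> ~ A (a / g) -> exists2 x, A x & simple_mod (x * a).
Proof.
move=> Aa nAa.
pose P n := `[< exists x, [/\ A x, ~ A (x * a / g) & size (enumset (cls (x * a))) = n] >].
have exP : exists n, P n.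
  exists (size (enumset (cls (1 * a)))); apply/asboolP; exists 1.
  by rewrite mul1r; split=> //; exact: Areg1.
case: (ex_minnP exP) => n /asboolP[x [Ax nAx xE]] minn.
exists x => //; split=> //; first exact: AregM.
move=> x' Ax' nAx'; have Axa : A (x * a) by exact: AregM.
have Axxa : A (x' * (x * a)) by exact: AregM.
have sub : {subset enumset (cls (x' * (x * a))) <= enumset (cls (x * a))}.
  move=> u /enumsetP h; apply/enumsetP; first exact: finite_cls.
  by apply: (@cls_subset _ x') => //; apply: h; exact: finite_cls.
have le : (size (enumset (cls (x * a))) <= size (enumset (cls (x' * (x * a)))))%N.
  rewrite xE; apply: minn; apply/asboolP; exists (x' * x); split.
  - exact: AregM.
  - by rewrite -[x' * x * a]mulrA.
  - by rewrite -[x' * x * a]mulrA.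
have [_ eqE] := uniq_min_size (uniq_enumset _) sub le.
have /enumsetP : prA (x * a / g) \in enumset (cls (x' * (x * a))).
  rewrite eqE; apply/enumsetP; first exact: finite_cls.
  by exists 1; [exact: Areg1 | rewrite mul1r].
move=> /(_ (finite_cls Axxa)) [y Ay /prA_eq h].
by exists y => //; rewrite mulrBl -[y * x' * _]mulrA.
Qed.

(** A case of the self-injectivity of [A/(g)]. With [p c' = g u], the element [p] kills [c] as well,
    and [u] has an inverse [y] modulo the annihilator of [c']; hence [c] is congruent to
    [y u c = y (p c / g) c']. *)
Lemma simple_colon c c' : simple_mod c' -> A c ->
  (forall p, A p -> A (p * c' / g) -> A (p * c / g)) ->
  exists2 b, A b & A ((c - b * c') / g).
Proof.
move=> [Ac' nAc' sc'] Ac sub.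
have [p [u [Ap Au pE nAu]]] := locally_principal Ac' nAc'.
have [y Ay yE] := sc' _ Au nAu.
have Ab : A (p * c / g) by apply: sub => //; rewrite pE mulrC mulKf.
exists (y * (p * c / g)); first exact: AregM.
have Ayu : A (y * u - 1) by apply: AregB; [exact: AregM | exact: Areg1].
have := sub _ Ayu; rewrite mulrBl mul1r => /(_ yE) h.
rewrite -opprB mulNr; apply: AregN.
have -> : (y * (p * c / g) * c' - c) / g = (y * u - 1) * c / g.
  have -> : u = p * c' / g by rewrite pE mulrC mulKf.
  by field; exact: g0.
by [].
Qed.

Section Powers.
Variables (r : nat) (N : set F).
Hypothesis NE : N = principal iota infty g.
Local Notation tor := (torsion iota infty r).
Local Notation act := (@torsion_mul Fq F iota infty r).
Local Notation VN := (@VN Fq F iota infty N r).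
Local Notation Va := (@Va Fq F iota infty r).
Local Notation prV := (@prV Fq F iota infty r).

Lemma ideal_invP x : ideal_inv iota infty N x <-> A (x * g).
Proof.
split=> [h|h y]; first by apply: h; rewrite NE; exists 1; [exact: Areg1 | rewrite mulr1].
by rewrite NE => -[z Az <-]; rewrite mulrA; exact: AregM.
Qed.

Lemma VN_pow : VN = ffun_pow (cls 1).
Proof.
apply/seteqP; split=> v vP i.
  have [x /ideal_invP Ax ->] := vP i; exists (x * g) => //.
  by rewrite mulr1 mulfK.
have [a Aa aE] := vP i; exists (a / g); first by apply/ideal_invP; rewrite divfK.
by rewrite -aE mulr1.
Qed.

Lemma VNP v : VN v <-> exists2 x, (forall i, A (x i)) & v = prV (fun i => x i / g).
Proof.
rewrite VN_pow; split=> [/choice2[x xP]|[x Ax ->] i].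
  exists x => [i|]; first by case: (xP i).
  by apply/ffunP => i; rewrite ffunE; case: (xP i) => _ <-; rewrite mulr1.
by rewrite ffunE; exists (x i); rewrite ?mulr1.
Qed.

Lemma VaP a v : Va a v <-> exists2 x, (forall i, A (x i)) & v = prV (fun i => x i / a).
Proof.
split=> [/choice2[x xP]|[x Ax ->] i].
  have /choice[y yP] : forall i, exists y, A y /\ a^-1 * y = x i.
    by move=> i; have [[y Ay yE] _] := xP i; exists y.
  exists y => [i|]; first by case: (yP i).
  apply/ffunP => i; rewrite ffunE; case: (xP i) => _ ->; case: (yP i) => _ <-.
  by rewrite mulrC.
by exists (a^-1 * x i); [exists (x i) | rewrite ffunE mulrC].
Qed.

Lemma sub_VN : is_submodule VN.
Proof.
rewrite VN_pow; split=> [i|a x y Vx Vy i]; have [c0 cD] := sub_cls 1.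
  by rewrite ffunE; exact: c0.
by rewrite !ffunE; exact: cD.
Qed.

Lemma finite_VN : finite_set VN.
Proof. by rewrite VN_pow; apply: finite_ffun_pow; exact: finite_cls1. Qed.

Lemma VN_act a v : A a -> VN v -> VN (act a v).
Proof.
move=> Aa /VNP[x Ax ->]; rewrite act_prV //; apply/VNP.
exists (fun i => a * x i); first by move=> i; exact: AregM.
by apply/prV_eq => i; rewrite mulrA subrr; exact: Areg0.
Qed.

Lemma act_g v : VN v -> act g v = 0.
Proof.
by move=> /VNP[x Ax ->]; rewrite act_prV //; apply/prV_eq0 => i; rewrite mulrCA mulfV // mulr1.
Qed.

Lemma act_gM a v : A a -> VN v -> act (a * g) v = 0.
Proof. by move=> Aa Vv; rewrite actM // act_g // act0. Qed.

Lemma act_mod a b v : A a -> A b -> A ((a - b) / g) -> VN v -> act a v = act b v.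
Proof.
move=> Aa Ab Aab Vv; apply/eqP; rewrite -subr_eq0 -actBl //.
by rewrite -[a - b](divfK g0) act_gM.
Qed.

Lemma VaE a v : A a -> a != 0 -> Va a v <-> act a v = 0.
Proof.
move=> Aa a0; split=> [/VaP[x Ax ->]|].
  by rewrite act_prV //; apply/prV_eq0 => i; rewrite mulrCA mulfV // mulr1.
have [x ->] := prV_repr v; rewrite act_prV // => /prV_eq0 Ax; apply/VaP.
exists (fun i => a * x i) => //; apply/prV_eq => i.
by rewrite mulrC mulKf // subrr; exact: Areg0.
Qed.

Lemma Va_sub a : Div iota infty N a -> Va a `<=` VN.
Proof.
move=> [Aa Na] v /VaP[x Ax ->]; apply/VNP.
have [|b Ab bE] := Na g; first by rewrite NE; exists 1; [exact: Areg1 | rewrite mulr1].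
have a0 : a != 0 by apply: contra_neq g0 => a0; rewrite -bE a0 mul0r.
have b0 : b != 0 by apply: contra_neq g0 => b0; rewrite -bE b0 mulr0.
exists (fun i => x i * b); first by move=> i; exact: AregM.
apply/prV_eq => i; rewrite -bE (_ : _ - _ = 0); first exact: Areg0.
by field; rewrite a0 b0.
Qed.

(** Reduces the cardinality of [c V_N] to the [r]-th power of that of an ideal of [A/(g)]. *)
Lemma act_pow c : A c -> [set act c v | v in VN] = ffun_pow (cls c).
Proof.
move=> Ac; apply/seteqP; split=> [_ [v /VNP[x Ax ->] <-] i|v /choice2[x xP]].
  by rewrite act_prV // ffunE; exists (x i); rewrite // [x i * c]mulrC mulrA.
exists (prV (fun i => x i / g)).
  by apply/VNP; exists x => // i; case: (xP i).
rewrite act_prV //; apply/ffunP => i; rewrite ffunE; case: (xP i) => _ <-.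
by rewrite mulrA [c * _]mulrC.
Qed.

End Powers.
End Level.

(** * The Drinfeld module of a point *)

Lemma size_allpairs_surj (T : choiceType) (X Y Z : set T) (f : T -> T -> T) :
  finite_set X -> finite_set Y -> finite_set Z ->
  (forall z, Z z <-> exists x y, [/\ X x, Y y & z = f x y]) ->
  (forall x x' y y', X x -> X x' -> Y y -> Y y' -> f x y = f x' y' -> x = x' /\ y = y') ->
  size (enumset Z) = (size (enumset X) * size (enumset Y))%N.
Proof.
move=> fX fY fZ ZP inj; rewrite -(size_allpairs f).
apply: perm_size; apply: uniq_perm; first exact: uniq_enumset.
  apply: allpairs_uniq; [exact: uniq_enumset | exact: uniq_enumset |].
  move=> [x y] [x' y'] /allpairsP[[a b] [/= /enumsetP Xx /enumsetP Yy [-> ->]]].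
  move=> /allpairsP[[a' b'] [/= /enumsetP Xx' /enumsetP Yy' [-> ->]]] E.
  by have [||||//|-> ->] := inj _ _ _ _ (Xx _) (Xx' _) (Yy _) (Yy' _).
move=> z; apply/enumsetP/allpairsP => //
  [/ZP[x [y [Xx Yy ->]]]|[[x y] [/= /enumsetP Xx /enumsetP Yy ->]]].
  by exists (x, y); split=> //=; apply/enumsetP.
by apply/ZP; exists x, y; split; [exact: Xx | exact: Yy |].
Qed.

Section Reciprocal.
Context (Fq : finFieldType) (F : fieldType) (iota : {rmorphism Fq -> F}).
Context (infty : set F).
Hypothesis hF : is_global_function_field iota.
Local Notation A := (Areg iota infty).
Variables (g : F) (N : set F) (r : nat).
Hypotheses (Ag : A g) (g0 : g != 0) (NE : N = principal iota infty g).
Local Notation Div := (Div iota infty N).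
Local Notation tor := (torsion iota infty r).
Local Notation act := (@torsion_mul Fq F iota infty r).
Local Notation VN := (@VN Fq F iota infty N r).
Local Notation Va := (@Va Fq F iota infty r).
Let subVN := sub_VN g0 r NE.
Let finVN := finite_VN hF Ag g0 r NE.

Lemma Div_g : Div g.
Proof. by split=> //; rewrite NE. Qed.

Lemma Div_neq0 a : Div a -> a != 0.
Proof.
move=> [_ Na]; have [|b _ bE] := Na g; last first.
  by apply: contra_neq g0 => a0; rewrite -bE a0 mul0r.
by rewrite NE; exists 1; [exact: Areg1 | rewrite mulr1].
Qed.

Lemma DivP a : Div a <-> A a /\ exists2 b, A b & a * b = g.
Proof.
split=> [[Aa Na]|[Aa [b Ab abE]]]; split=> //.
  have [|b Ab bE] := Na g; last by exists b.
  by rewrite NE; exists 1; [exact: Areg1 | rewrite mulr1].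
by rewrite NE => _ [y Ay <-]; exists (b * y); [exact: AregM | rewrite mulrA abE].
Qed.

Lemma DivMl a b : A a -> A b -> Div (a * b) -> Div a.
Proof.
move=> Aa Ab /DivP[_ [c Ac E]]; apply/DivP; split=> //.
by exists (b * c); [exact: AregM | rewrite mulrA].
Qed.

Lemma DivMr a b : A a -> A b -> Div (a * b) -> Div b.
Proof. by move=> Aa Ab; rewrite mulrC; exact: DivMl. Qed.

(* Multiplication by a divisor of N is onto: V_b = a V_(ab). *)
Lemma act_surj a b v : A a -> A b -> Div (a * b) -> act b v = 0 ->
  exists2 y, VN y & act a y = v.
Proof.
move=> Aa Ab Dab bv; have Db := DivMr Aa Ab Dab; have Da := DivMl Aa Ab Dab.
have a0 := Div_neq0 Da; have b0 := Div_neq0 Db; have ab0 := Div_neq0 Dab.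
have [x Ax vE] : exists2 x, (forall i, A (x i)) & v = prV iota infty (fun i => x i / b).
  by apply/VaP; apply/(VaE v Ab b0).
exists (prV iota infty (fun i => x i / (a * b))).
  by apply: (Va_sub g0 NE Dab); apply/VaP; exists x.
rewrite act_prV // vE; apply/prV_eq => i.
rewrite (_ : _ - _ = 0); first exact: Areg0.
by field; rewrite a0 b0.
Qed.

Variables (L : fieldType) (j : {rmorphism F -> L}) (rho : tor -> L).
Hypothesis rho0 : rho 0 = 0.
Hypothesis rhoZ : forall a v, a != 0 -> VN v -> rho (a *: v) = (j (iota a))^-1 * rho v.
Hypothesis rhoM : forall u v, VN u -> VN v -> u != 0 -> v != 0 -> u + v != 0 ->
  rho u * rho v = rho (u + v) * (rho u + rho v).
Hypothesis rho_level : forall a v, Div a -> VN v -> ~ Va a v ->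
  j a * rho (act a v) = \sum_(v' \in Va a) rho (v - v').

Definition rsupp : set tor := [set v | VN v /\ (v = 0 \/ rho v != 0)].
Definition rinv (v : tor) : L := (rho v)^-1.

Let kap : {rmorphism Fq -> L} := (j \o iota)%FUN.

Lemma rinv0 : rinv 0 = 0. Proof. by rewrite /rinv rho0 invr0. Qed.

Lemma rinvZ a v : VN v -> rinv (a *: v) = kap a * rinv v.
Proof.
move=> Vv; have [->|a0] := eqVneq a 0; first by rewrite scale0r rinv0 rmorph0 mul0r.
by rewrite /rinv rhoZ // invfM invrK.
Qed.

(** If [rho u] and [rho v] are non-zero, the identity [rhoM] forces both factors on its right side
    to be non-zero, and dividing by them gives additivity of the reciprocals. *)
Lemma rsuppD_rinv u v : rsupp u -> rsupp v ->
  rsupp (u + v) /\ rinv (u + v) = rinv u + rinv v.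
Proof.
move=> [Vu u'] [Vv v']; have Vuv := submodD subVN Vu Vv.
have [u0|u0] := eqVneq u 0; first by rewrite u0 !add0r rinv0 add0r.
have [v0|v0] := eqVneq v 0; first by rewrite v0 !addr0 rinv0 addr0.
have {u'}ru : rho u != 0 by case: u' => // h; rewrite h eqxx in u0.
have {v'}rv : rho v != 0 by case: v' => // h; rewrite h eqxx in v0.
have [uv0|uv0] := eqVneq (u + v) 0.
  rewrite uv0; split; first by split; [exact: (submod0 subVN) | left].
  have -> : u = (-1) *: v by rewrite scaleN1r; apply/eqP; rewrite -addr_eq0 uv0.
  by rewrite rinv0 rinvZ // rmorphN1 mulN1r addNr.
have E := rhoM Vu Vv u0 v0 uv0.
have ruv : rho (u + v) != 0.
  by apply: contraTneq (mulf_neq0 ru rv) => h; rewrite E h mul0r eqxx.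
have s0 : rho u + rho v != 0.
  by apply: contraTneq (mulf_neq0 ru rv) => h; rewrite E h mulr0 eqxx.
split; first by split=> //; right.
have -> : rinv (u + v) = (rho u + rho v) / (rho u * rho v).
  by rewrite E /rinv invfM mulrCA mulfV // mulr1.
by rewrite /rinv; field; rewrite ru rv.
Qed.

Lemma rsupp_sub : rsupp `<=` VN. Proof. by move=> v []. Qed.

Lemma sub_rsupp : is_submodule rsupp.
Proof.
split; first by split; [exact: (submod0 subVN) | left].
move=> a x y Sx Sy; apply: (rsuppD_rinv _ Sy).1.
have [Vx x'] := Sx; split; first exact: (submodZ subVN).
have [->|a0] := eqVneq a 0; first by left; rewrite scale0r.
case: x' => [->|rx]; first by left; rewrite scaler0.
by right; rewrite rhoZ // mulf_neq0 // invr_eq0 fmorph_eq0 fmorph_eq0.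
Qed.

Lemma rinvD u v : rsupp u -> rsupp v -> rinv (u + v) = rinv u + rinv v.
Proof. by move=> Su Sv; case: (rsuppD_rinv Su Sv). Qed.

Lemma rinvB u v : rsupp u -> rsupp v -> rinv (u - v) = rinv u - rinv v.
Proof.
move=> Su Sv; rewrite rinvD //; last exact: (submodN sub_rsupp).
by rewrite -scaleN1r rinvZ ?rmorphN1 ?mulN1r //; case: Sv.
Qed.

Lemma rinv_eq0 v : rsupp v -> rinv v = 0 -> v = 0.
Proof. by move=> [_ [//|rv]] /eqP; rewrite invr_eq0 (negbTE rv). Qed.

Lemma rinv_inj u v : rsupp u -> rsupp v -> rinv u = rinv v -> u = v.
Proof.
move=> Su Sv uv; apply/eqP; rewrite -subr_eq0; apply/eqP; apply: rinv_eq0.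
  exact: (submodB sub_rsupp).
by rewrite rinvB // uv subrr.
Qed.

Lemma finite_rsupp : finite_set rsupp.
Proof. by apply: sub_finite_set finVN; exact: rsupp_sub. Qed.

Definition rsuppa (a : F) : set tor := [set v | rsupp v /\ act a v = 0].

Lemma finite_rsuppa a : finite_set (rsuppa a).
Proof. by apply: sub_finite_set finite_rsupp => v []. Qed.

Lemma rsuppaP a v : reflect (rsuppa a v) (v \in enumset (rsuppa a)).
Proof. by apply: enumsetP; exact: finite_rsuppa. Qed.

Lemma sub_rsuppa a : A a -> is_submodule (rsuppa a).
Proof.
move=> Aa; split; first by split; [exact: (submod0 sub_rsupp) | rewrite act0].
move=> b x y [Sx xa] [Sy ya]; split; first by case: sub_rsupp => _; apply.
by rewrite actD // actZ // xa ya scaler0 addr0.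
Qed.

Definition kerseq (a : F) : seq L := [seq rinv v | v <- enumset (rsuppa a)].

Lemma kerseqP a x : reflect (exists2 v, rsuppa a v & x = rinv v) (x \in kerseq a).
Proof.
apply: (iffP mapP) => -[v].
  by move=> /rsuppaP h ->; exists v.
by move=> h ->; exists v => //; apply/rsuppaP.
Qed.

Lemma uniq_kerseq a : uniq (kerseq a).
Proof.
rewrite map_inj_in_uniq ?uniq_enumset // => u v.
move=> /rsuppaP[Su _] /rsuppaP[Sv _].
exact: rinv_inj.
Qed.

Lemma kerseq_lin a : A a -> is_linearized Fq (\prod_(u <- kerseq a) ('X - u%:P)).
Proof.
move=> Aa; apply: (subspace_poly_linearized (kap := kap)); first exact: uniq_kerseq.
  apply/kerseqP; exists 0; last by rewrite rinv0.
  exact: (submod0 (sub_rsuppa Aa)).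
move=> b _ _ /kerseqP[u Su ->] /kerseqP[v Sv ->]; apply/kerseqP.
exists (b *: u + v); first by case: (sub_rsuppa Aa) => _; apply.
have [[? _] [? _]] := (Su, Sv).
rewrite rinvD // ?rinvZ //; last exact: (submodZ sub_rsupp).
by apply: rsupp_sub.
Qed.

Lemma kerseq_coef1 a : A a -> (\prod_(u <- kerseq a) ('X - u%:P))`_1 != 0.
Proof.
move=> Aa; have s0 : 0 \in kerseq a.
  apply/kerseqP; exists 0; last by rewrite rinv0.
  exact: (submod0 (sub_rsuppa Aa)).
rewrite (big_rem 0) //= subr0 coefXM /= -horner_coef0 -[_ == 0]/(root _ _).
by rewrite root_prod_XsubC mem_rem_uniq ?uniq_kerseq // inE eqxx.
Qed.

(** The scalar makes the derivative equal to [j a], as for the action of [a] under a Drinfeld module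
    with structure map [j]. *)
Definition psi (a : F) : {poly L} :=
  let P := \prod_(u <- kerseq a) ('X - u%:P) in (j a / P`_1) *: P.

Lemma psi_lin a : A a -> is_linearized Fq (psi a).
Proof. by move=> Aa; apply: is_linearizedZ; exact: kerseq_lin. Qed.

Lemma psi_coef1 a : A a -> (psi a)`_1 = j a.
Proof. by move=> Aa; rewrite /psi coefZ divfK // kerseq_coef1. Qed.

Lemma psi_prod a : Div a -> exists2 k, k != 0 &
  psi a = k *: \prod_(u <- kerseq a) ('X - u%:P).
Proof.
move=> Da; eexists; last reflexivity.
rewrite mulf_neq0 ?invr_eq0 ?kerseq_coef1 //; last by case: Da.
by rewrite fmorph_eq0; exact: Div_neq0.
Qed.

Lemma size_psi a : Div a -> size (psi a) = (size (enumset (rsuppa a))).+1.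
Proof.
by move=> Da; have [k k0 ->] := psi_prod Da; rewrite size_scale // size_prod_XsubC size_map.
Qed.

(** The logarithmic derivative of [psi a] at [rinv v] is the sum of the [rho (v - v')], as the terms
    with [v'] outside the support vanish. By the level relation this sum is [j a * rho (act a v)],
    so [rho (act a v)] is the inverse of the non-zero value of [psi a]. *)
Lemma psi_rinv a v : Div a -> rsupp v ->
  rsupp (act a v) /\ (psi a).[rinv v] = rinv (act a v).
Proof.
move=> Da Sv; have Aa : A a by case: Da.
have [k k0 psiE] := psi_prod Da; have a0 := Div_neq0 Da.
have VE u : Va a u <-> act a u = 0 := VaE u Aa a0.
have [av0|av0] := eqVneq (act a v) 0.
  rewrite av0 rinv0; split; first exact: (submod0 sub_rsupp).
  apply/eqP; rewrite psiE hornerZ mulf_eq0 (negbTE k0) /=.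
  by rewrite -[_ == 0]/(root _ _) root_prod_XsubC; apply/kerseqP; exists v.
have nVa : ~ Va a v by move/VE => h; move/eqP: av0; apply; exact: h.
have vs : rinv v \notin kerseq a.
  apply/negP => /kerseqP[u [Su ua] /rinv_inj uv].
  by move/eqP: av0; apply; rewrite uv.
have [h1 h2] := sum_inv_linearized kap (psi_lin Aa) psiE k0 vs.
rewrite psi_coef1 // in h2.
have E : \sum_(u <- kerseq a) (rinv v - u)^-1 = j a * rho (act a v).
  rewrite rho_level // ?(rsupp_sub Sv) //; last exact: rsupp_sub.
  rewrite -(@fsbig_widen _ _ _ _ (rsuppa a)); first last.
  - move=> u [/VE ua nu] /=; apply: contrapT => /eqP ru; apply: nu.
    have {}ua : act a u = 0 by exact: ua.
    have : rsupp (v - u).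
      split; last by right.
      apply: (submodB subVN); first exact: rsupp_sub.
      by apply: (Va_sub g0 NE Da); apply/VE.
    move=> Svu; split=> //; rewrite -[u](subKr v).
    exact: (submodB sub_rsupp).
  - by move=> u [Su ua]; apply/VE.
  rewrite fsbig_finite ?big_map; last exact: finite_rsuppa.
  rewrite big_seq [RHS]big_seq; apply: eq_bigr => u.
  move=> /rsuppaP[Su _].
  by rewrite -rinvB // /rinv invrK.
have rav : rho (act a v) = (psi a).[rinv v]^-1.
  have ja : j a != 0 by rewrite fmorph_eq0.
  by apply: (mulfI ja); rewrite -E h2.
split; last by rewrite /rinv rav invrK.
split; last by right; rewrite rav invr_eq0.
by apply: (VN_act g0 NE) => //; exact: rsupp_sub.
Qed.

(** By the level relation, [rho (act a v) <> 0] requires a non-zero term [rho (v - v')]; this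
    [v - v'] is the lift. *)
Lemma rsupp_lift a v : Div a -> VN v -> rsupp (act a v) ->
  exists2 u, rsupp u & act a u = act a v.
Proof.
move=> Da Vv [Vav [av0|rav]].
  have Aa : A a by case: Da.
  by exists 0; [exact: (submod0 sub_rsupp) | rewrite av0 act0].
have Aa : A a by case: Da.
have a0 := Div_neq0 Da.
have VE u : Va a u <-> act a u = 0 := VaE u Aa a0.
have nVa : ~ Va a v.
  by move=> /VE h; move/eqP: rav; apply; rewrite h.
have [v' [Vv' rv']] : exists v', Va a v' /\ rho (v - v') != 0.
  apply: contrapT => no; have := rho_level Da Vv nVa.
  rewrite fsbig1 => [|u Vu].
    move/eqP; rewrite mulf_eq0 fmorph_eq0 (negbTE a0) (negbTE rav) //.
  by apply/eqP; rewrite -[_ == _]negbK; apply/negP => h; apply: no; exists u.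
exists (v - v').
  split; last by right.
  apply: (submodB subVN) => //; exact: (Va_sub g0 NE Da).
have /VE h := Vv'.
by rewrite actB // h // subr0.
Qed.

(** The map [b] from the [ab]-torsion of the support to its [a]-torsion is onto, so the degrees
    agree. The elements of [kerseq (a * b)] are roots of both sides, and both linear coefficients
    are [j (a * b)]. *)
Lemma psi_comp a b : A a -> A b -> Div (a * b) -> psi a \Po psi b = psi (a * b).
Proof.
move=> Aa Ab Dab; have Da := DivMl Aa Ab Dab; have Db := DivMr Aa Ab Dab.
have [k k0 psiE] := psi_prod Dab.
have [ka ka0 psia] := psi_prod Da; have [kb kb0 psib] := psi_prod Db.
have sz : size (enumset (rsuppa (a * b))) =
    (size (enumset (rsuppa a)) * size (enumset (rsuppa b)))%N.
  have /choice[y yP] : forall v, exists y, rsuppa a v -> rsupp y /\ act b y = v.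
    move=> v; case: (pselect (rsuppa a v)) => [[Sv av]|]; last by exists 0.
    have [|y Vy yE] := @act_surj b a v Ab Aa _ av; first by rewrite mulrC.
    have [|u Su uE] := rsupp_lift Db Vy; first by rewrite yE.
    by exists u => _; rewrite uE.
  apply: (@size_allpairs_surj _ _ _ _ (fun v u => y v + u)); try exact: finite_rsuppa.
    move=> z; split=> [[Sz abz]|[v [u [av [Su bu] ->]]]].
      rewrite actM // in abz.
      have bz : rsuppa a (act b z) by split=> //; case: (psi_rinv Db Sz).
      have [Sy yE] := yP _ bz.
      exists (act b z), (z - y (act b z)); split=> //; last by rewrite addrC subrK.
      by split; [exact: (submodB sub_rsupp) | rewrite actB // yE subrr].
    have [Sy yE] := yP _ av; split; first exact: (submodD sub_rsupp).
    by rewrite actM // actD // yE bu addr0; case: av.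
  move=> v v' u u' av av' [Su bu] [Su' bu'] E.
  have [Sy yE] := yP _ av; have [Sy' yE'] := yP _ av'.
  have vv : v = v'.
    by have := congr1 (act b) E; rewrite !actD // yE yE' bu bu' !addr0.
  by split=> //; move: E; rewrite vv => /addrI.
have [c cE] : is_linearized Fq (psi a \Po psi b).
  by apply: (is_linearized_comp kap); exact: psi_lin.
have coef1 : (psi a \Po psi b)`_1 = j (a * b).
  have [ca caE] := psi_lin Aa; have [cb cbE] := psi_lin Ab.
  have := congr1 (fun p => p.[0]) (deriv_comp (psi a) (psi b)).
  rewrite cE (linp_deriv kap) hornerC -(coef1_linp Fq) -cE => ->.
  rewrite hornerM horner_comp caE cbE !(linp_deriv kap) !hornerC -!(coef1_linp Fq).
  by rewrite -caE -cbE !psi_coef1 // rmorphM.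
have szab : size (psi a \Po psi b) = (size (kerseq (a * b))).+1.
  rewrite size_map sz; have := size_comp_poly (psi a) (psi b).
  rewrite !size_psi //= => h; rewrite -h prednK // lt0n size_poly_eq0.
  apply: contraTneq isT => h0; move: coef1; rewrite h0 coef0 => /esym/eqP.
  by rewrite fmorph_eq0 (negbTE (Div_neq0 Dab)).
have rts : all (root (psi a \Po psi b)) (kerseq (a * b)).
  apply/allP => _ /kerseqP[v [Sv abv] ->]; rewrite rootE horner_comp.
  have [Sbv ->] := psi_rinv Db Sv; have [_ ->] := psi_rinv Da Sbv.
  by rewrite -actM // abv rinv0.
have := all_roots_prod_XsubC szab rts; rewrite uniq_rootsE => /(_ (uniq_kerseq _)).
set l := lead_coef _ => E.
rewrite E /psi; congr (_ *: _).
have c1 := kerseq_coef1 (AregM Aa Ab).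
by apply: (mulIf c1); rewrite divfK // -coef1 E coefZ.
Qed.

(** * The Drinfeld module determined by the level assumption *)

Variable D : set F.
Hypothesis DDiv : D `<=` Div.
Hypothesis D_approx : forall a, A a -> a != 0 ->
  exists b, [/\ A b, b != 0, is_product_of D b
              & (degA iota infty (a - b) < degA iota infty a)%E].
Hypothesis D_mul : forall a b, D a -> D b -> a != b -> Div (a * b).
Hypothesis D_gen : forall a, Div a -> is_product_of D a.
Hypothesis gnu : ~ A g^-1.

Lemma DA d : D d -> A d. Proof. by move=> /DDiv[]. Qed.

Lemma product_of_A b : is_product_of D b -> A b.
Proof. by move=> [s [sD ->]]; apply: Areg_prod => x /sD/DA. Qed.

(** Subtracting from [a] an approximating product of elements of [D] lowers the degree, so such
    products generate [A] additively. *)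
Lemma Areg_level_ind (P : F -> Prop) : P 0 ->
  (forall b, is_product_of D b -> P b) ->
  (forall x y, A x -> A y -> P x -> P y -> P (x + y)) ->
  forall a, A a -> P a.
Proof.
move=> P0 Pprod PD a.
pose v (a : F) := vdim [set mod_proj (principal iota infty a : set (res_scalars iota)) x
                       | x in (A : set (res_scalars iota))].
have degE x : x != 0 -> degA iota infty x = ((v x)%:Z%:E)%E.
  by rewrite /degA => /negbTE ->.
have [n] := ubnP (v a); elim: n a => // n IH a; rewrite ltnS => an Aa.
have [->//|a0] := eqVneq a 0.
have [b [Ab b0 bD lt]] := D_approx Aa a0.
rewrite -(subrK b a); apply: PD => //; [exact: AregB | | exact: Pprod].
have [->//|ab0] := eqVneq (a - b) 0.
apply: IH; last exact: AregB.
by move: lt; rewrite !degE // lte_fin ltz_nat => /leq_trans; exact.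
Qed.

Lemma frob_iter (x : F) h k : x ^+ (#|Fq| ^ h) = x -> x ^+ (#|Fq| ^ (h * k)) = x.
Proof.
move=> xh; elim: k => [|k IH]; first by rewrite muln0 expr1.
by rewrite mulnS expnD exprM xh.
Qed.

(* Otherwise all of A would be algebraic over F_q, and g a unit. *)
Lemma exists_transcendental : exists2 d, D d & forall k, (1 < k)%N -> d ^+ k != d.
Proof.
apply: contrapT => no.
(* Being fixed by a power of the [q]-Frobenius passes to sums and products, hence from [D] to all of
   [A]. *)
pose P (x : F) := exists2 h, (0 < h)%N & x ^+ (#|Fq| ^ h) = x.
have qg1 := q_gt1 Fq.
have PM x y : P x -> P y -> P (x * y).
  move=> [h h0 xh] [k k0 yk]; exists (h * k)%N; first by rewrite muln_gt0 h0.
  by rewrite exprMn frob_iter // [(h * k)%N]mulnC frob_iter.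
have PD d : D d -> P d.
  move=> Dd; have [k k1 /eqP dk] : exists2 k, (1 < k)%N & d ^+ k == d.
    apply: contrapT => h; apply: no; exists d => // k k1.
    by apply/negP => dk; apply: h; exists k.
  have [->|d0] := eqVneq d 0.
    by exists 1%N => //; rewrite expr0n expn_eq0 -leqn0 leqNgt (ltnW qg1).
  have d1 : d ^+ k.-1 = 1.
    by apply: (mulfI d0); rewrite -exprS prednK ?mulr1 // ltnW.
  have k0 : (0 < k.-1)%N by rewrite -subn1 subn_gt0.
  (* Two powers of [q] coincide modulo [k - 1], a multiple of the order of [d]; as Frobenius is
     injective, the common factor [q^i] of the exponents can be removed. *)
  have : ~~ injectiveb (fun i : 'I_k.-1.+1 => Ordinal (ltn_pmod (#|Fq| ^ i) k0)).
    apply/negP => /injectiveP inj; have := leq_card _ inj.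
    by rewrite !card_ord ltnn.
  move=> /injectivePn[i [i' ii' /(congr1 val) /= E]].
  wlog lt : i i' ii' E / (i < i')%N.
    move=> H; case: (ltngtP i i') => h; [exact: (H i i') | | ].
      by apply: (H i' i); rewrite // eq_sym.
    by case/eqP: ii'; apply: val_inj.
  exists (i' - i)%N; first by rewrite subn_gt0.
  have {}E : d ^+ (#|Fq| ^ i) = d ^+ (#|Fq| ^ i').
    by rewrite -(expr_mod _ d1) E (expr_mod _ d1).
  apply/eqP; rewrite -subr_eq0.
  have : (d ^+ (#|Fq| ^ (i' - i)) - d) ^+ (#|Fq| ^ i) == 0.
    have dN : (- d) ^+ (#|Fq| ^ i) = - d ^+ (#|Fq| ^ i).
      apply/eqP; rewrite -addr_eq0 -(exprDq iota) addNr expr0n expn_eq0.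
      by rewrite -leqn0 leqNgt (ltnW qg1).
    by rewrite (exprDq iota) dN -exprM -expnD subnK 1?ltnW // -E subrr.
  by rewrite expf_eq0 => /andP[].
have PA a : A a -> P a.
  move: a; apply: Areg_level_ind => [|b [s [sD ->]]|x y _ _ [h h0 xh] [k k0 yk]].
  - by exists 1%N => //; rewrite expr0n expn_eq0 -leqn0 leqNgt (ltnW qg1).
  - rewrite big_seq; apply: big_ind => //; first by exists 1%N => //; rewrite expr1n.
    by move=> x /sD/PD.
  - exists (h * k)%N; first by rewrite muln_gt0 h0.
    by rewrite (exprDq iota) frob_iter // [(h * k)%N]mulnC frob_iter.
have [h h0 gh] := PA _ Ag.
(* From [g^(q^h) = g] the inverse of [g] is the power [g^(q^h - 2)], which lies in [A]. *)
have q1 : (1 < #|Fq| ^ h)%N by rewrite -{1}(expn0 #|Fq|) ltn_exp2l.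
apply: gnu; have -> : g^-1 = g ^+ (#|Fq| ^ h).-2; last exact: AregX.
apply: (mulfI g0); rewrite mulfV // -exprS.
apply: (mulfI g0); rewrite mulr1 -exprS -{1}gh; congr (g ^+ _).
by case: (_ ^ _)%N q1 => [|[]].
Qed.

(** The conditions on [f] to serve as [phi_a]. For the base [phi0] chosen below, a linearized
    polynomial commuting with [phi0] is determined by its linear coefficient, so commutation makes
    the choices additive and multiplicative in [a]. *)
Definition Adrinf (phi0 : {poly L}) (a : F) (f : {poly L}) : Prop :=
  [/\ is_linearized Fq f, f \Po phi0 = phi0 \Po f, f`_1 = j a
    & forall v, rsupp v -> rsupp (act a v) /\ f.[rinv v] = rinv (act a v)].

Lemma Adrinf1 phi0 : Adrinf phi0 1 'X.
Proof.
split; rewrite ?comp_polyX ?comp_polyXr ?coefX ?rmorph1 //; first exact: is_linearizedX.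
by move=> v Sv; rewrite act1 hornerX.
Qed.

Lemma AdrinfM phi0 a b f h : A a -> A b -> Adrinf phi0 a f -> Adrinf phi0 b h ->
  Adrinf phi0 (a * b) (f \Po h).
Proof.
move=> Aa Ab [fl fc f1 fw] [hl hc h1 hw]; split.
- exact: (is_linearized_comp kap).
- by rewrite -comp_polyA hc !comp_polyA fc.
- have [c cE] : is_linearized Fq (f \Po h) by exact: (is_linearized_comp kap).
  have [cf cfE] := fl; have [ch chE] := hl.
  have := congr1 (fun p => p.[0]) (deriv_comp f h).
  rewrite cE (linp_deriv kap) hornerC -(coef1_linp Fq) -cE => ->.
  rewrite hornerM horner_comp cfE chE !(linp_deriv kap) !hornerC -!(coef1_linp Fq).
  by rewrite -cfE -chE f1 h1 rmorphM.
- move=> v Sv; have [Sbv hv] := hw _ Sv; have [Sabv fv] := fw _ Sbv.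
  by rewrite actM // horner_comp hv fv.
Qed.

Lemma AdrinfD phi0 a b f h : is_linearized Fq phi0 -> A a -> A b ->
  Adrinf phi0 a f -> Adrinf phi0 b h -> Adrinf phi0 (a + b) (f + h).
Proof.
move=> [c cE] Aa Ab [fl fc f1 fw] [hl hc h1 hw]; split; first exact: is_linearizedD.
- by rewrite comp_polyD fc hc cE (linp_compD kap).
- by rewrite coefD f1 h1 rmorphD.
- move=> v Sv; have [Sxv fv] := fw _ Sv; have [Syv hv] := hw _ Sv.
  rewrite actDl // hornerD fv hv rinvD //; split=> //; exact: (submodD sub_rsupp).
Qed.

(* Comparing lowest coefficients: d^k = d forces k = 1. *)
Lemma centralizer_eq0 (d : L) (f h : {poly L}) : (forall k, (1 < k)%N -> d ^+ k != d) ->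
  is_linearized Fq f -> is_linearized Fq h -> h`_1 = d -> f`_1 = 0 ->
  f \Po h = h \Po f -> f = 0.
Proof.
move=> dk [c fE] [e hE] h1 f1 comm; apply/eqP; apply: contraT => f0.
have [n [f' rf' fE']] := multiplicity_XsubC f 0; rewrite f0 /= polyC0 subr0 in rf' fE'.
have f'0 : f'.[0] != 0 by [].
have hX : exists2 h', h = h' * 'X & h'.[0] = d.
  have /factor_theorem[h' hh] : root h 0 by rewrite rootE horner_coef0 hE coef0_linp.
  exists h'; first by rewrite hh polyC0 subr0.
  by rewrite -h1 hh polyC0 subr0 coefMX /= horner_coef0.
have [h' hh h'0] := hX.
have n1 : (1 < n)%N.
  case: n fE' => [|[|//]] fE'.
    have : f.[0] = 0 by rewrite fE horner_coef0 coef0_linp.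
    by rewrite fE' expr0 mulr1 => /eqP; rewrite (negbTE f'0).
  by move: f1; rewrite fE' expr1 coefMX /= -horner_coef0 => /eqP; rewrite (negbTE f'0).
(* Both composites are divisible by [X^n]; the constant terms of the quotients are [f'(0) d^n] and
   [d f'(0)]. *)
have E : (f' \Po h) * h' ^+ n * 'X^n = (h' \Po f) * f' * 'X^n.
  transitivity (f \Po h).
    by rewrite {1}fE' comp_polyM comp_Xn_poly {3}hh exprMn !mulrA.
  by rewrite comm {1}hh comp_polyM comp_polyX {2}fE' mulrA.
have Xn0 : 'X^n != 0 :> {poly L} by rewrite monic_neq0 // monicXn.
have {}E := mulIf Xn0 E.
have := congr1 (fun p => p.[0]) E; rewrite !hornerM horner_exp !horner_comp.
have f00 : f.[0] = 0 by rewrite fE horner_coef0 coef0_linp.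
have h00 : h.[0] = 0 by rewrite hE horner_coef0 coef0_linp.
rewrite f00 h00 h'0 mulrC => /(mulIf f'0).
by move/eqP; rewrite (negbTE (dk _ n1)).
Qed.
(** [phi0] is [psi d0] for a [d0] in [D] without relation [d0^k = d0], [k > 1], so that
    [centralizer_eq0] applies. For another [d] in [D] the product [d d0] is in [Div], hence [psi d]
    and [psi d0] commute, both composites being [psi (d d0)]; products and sums then reach all of
    [A]. *)
Lemma exists_drinfeld_base : exists2 phi0 : {poly L}, is_linearized Fq phi0 &
  (forall f, is_linearized Fq f -> f`_1 = 0 -> f \Po phi0 = phi0 \Po f -> f = 0) /\
  (forall a, A a -> exists f, Adrinf phi0 a f) /\
  (forall d, D d -> Adrinf phi0 d (psi d)).
Proof.
have [d0 Dd0 d0k] := exists_transcendental.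
have Ad0 := DA Dd0; exists (psi d0); first exact: psi_lin.
have AD d : D d -> Adrinf (psi d0) d (psi d).
  move=> Dd; have Ad := DA Dd; split.
  - exact: psi_lin.
  - have [->//|dd0] := eqVneq d d0; have Ddd := D_mul Dd Dd0 dd0.
    by rewrite psi_comp // psi_comp // mulrC.
  - exact: psi_coef1.
  - by move=> v; apply: psi_rinv; exact: DDiv.
split; last split => //.
- move=> f fl f1 fc; have h1 := psi_coef1 Ad0.
  apply: (@centralizer_eq0 (j d0) f (psi d0)) => //; last exact: psi_lin.
  by move=> k k1; rewrite -rmorphXn fmorph_eq; exact: d0k.
- apply: Areg_level_ind => [|b [s [sD ->]]|x y Ax Ay [f Af] [h Ah]].
  + exists 0; split; [exact: is_linearized0 | | by rewrite coef0 rmorph0 |].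
      have [c ->] := psi_lin Ad0.
      by rewrite comp_poly0 (linp_comp0 kap).
    move=> v Sv; rewrite act0l horner0 rinv0; split=> //; exact: (submod0 sub_rsupp).
  + elim: s sD => [|d s IH] sD; first by rewrite big_nil; exists 'X; exact: Adrinf1.
    have [|f Af] := IH; first by move=> x xs; apply: sD; rewrite inE xs orbT.
    rewrite big_cons; exists (psi d \Po f); apply: AdrinfM => //.
    * by apply: DA; apply: sD; rewrite mem_head.
    * by apply: product_of_A; exists s; split=> // x xs; apply: sD; rewrite inE xs orbT.
    * by apply: AD; apply: sD; rewrite mem_head.
  + by exists (f + h); apply: AdrinfD => //; exact: psi_lin.
Qed.

Lemma exists_drinfeld : exists phi : F -> {poly L},
  [/\ forall a, A a -> is_linearized Fq (phi a) /\ (phi a)`_1 = j a,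
      forall a b, A a -> A b -> phi (a + b) = phi a + phi b,
      forall a b, A a -> A b -> phi (a * b) = phi a \Po phi b,
      forall a v, A a -> rsupp v -> rsupp (act a v) /\ (phi a).[rinv v] = rinv (act a v)
    & forall a, Div a -> phi a = psi a] /\
  forall a, phi (iota a) = kap a *: 'X.
Proof.
have [phi0 lin0 [uniq0 [ex0 D0]]] := exists_drinfeld_base.
have [c0 c0E] := lin0.
have uniqA a f h : Adrinf phi0 a f -> Adrinf phi0 a h -> f = h.
  move=> [fl fc f1 _] [hl hc h1 _]; apply/eqP; rewrite -subr_eq0; apply/eqP.
  apply: uniq0.
  - by rewrite -scaleN1r; apply: is_linearizedD => //; exact: is_linearizedZ.
  - by rewrite coefB f1 h1 subrr.
  - by rewrite comp_polyB fc hc c0E (linp_compB kap).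
have /choice[phi phiP] : forall a, exists f, A a -> Adrinf phi0 a f.
  move=> a; case: (pselect (A a)) => [/ex0[f Af]|nA]; first by exists f.
  by exists 0.
have phiD a b : A a -> A b -> phi (a + b) = phi a + phi b.
  move=> Aa Ab; apply: uniqA; first by apply: phiP; exact: AregD.
  by apply: AdrinfD => //; exact: phiP.
have phiM a b : A a -> A b -> phi (a * b) = phi a \Po phi b.
  move=> Aa Ab; apply: uniqA; first by apply: phiP; exact: AregM.
  by apply: AdrinfM => //; exact: phiP.
have phi1 : phi 1 = 'X.
  apply: (uniqA 1); first by apply: phiP; exact: Areg1.
  exact: Adrinf1.
exists phi; split; first split => //.
- by move=> a /phiP[].
- by move=> a v /phiP[_ _ _]; exact.
(* Every tail of the factorization divides [a], hence is in [Div], and [psi_comp] splits off one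
   factor at a time. The empty product needs [psi 1 = X], true because 1 kills only 0. *)
- move=> a Da; have [s [sD aE]] := D_gen Da.
  elim: s a aE sD Da => [|d s IH] a aE sD Da.
    rewrite aE big_nil phi1.
    have D1 : Div 1 by move: Da; rewrite aE big_nil.
    have [cp cpE] := psi_lin (@Areg1 Fq F iota infty).
    have sz : size (psi 1) = 2.
      rewrite size_psi //; congr _.+1.
      rewrite -[RHS]/(size [:: (0 : tor)]); apply: perm_size.
      apply: uniq_perm => //; first exact: uniq_enumset.
      move=> v; rewrite inE; apply/rsuppaP/eqP => [[_]|->]; first by rewrite act1.
      by split; [exact: (submod0 sub_rsupp) | rewrite act0 //; exact: Areg1].
    apply/polyP => -[|[|k]].
    - by rewrite cpE coef0_linp coefX.
    - by rewrite psi_coef1 ?rmorph1 ?coefX //; exact: Areg1.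
    - by rewrite coefX nth_default ?sz.
  rewrite big_cons in aE.
  have Ad : A d by apply: DA; apply: sD; rewrite mem_head.
  have sD' x : x \in s -> D x by move=> xs; apply: sD; rewrite inE xs orbT.
  have As : A (\prod_(x <- s) x) by apply: product_of_A; exists s.
  have Ds : Div (\prod_(x <- s) x) by apply: (DivMr Ad As); rewrite -aE.
  rewrite aE phiM // -psi_comp -?aE // (IH _ erefl) //.
  congr (_ \Po _); apply: (uniqA d); first exact: phiP.
  by apply: D0; apply: sD; rewrite mem_head.
- move=> a; apply: (uniqA (iota a)); first by apply: phiP; exact: Areg_const.
  split; first exact/is_linearizedZ/is_linearizedX.
  + by rewrite comp_polyZ comp_polyX c0E (linp_compZ kap) comp_polyXr.
  + by rewrite coefZ coefX mulr1.
  + move=> v Sv; rewrite act_const hornerZ hornerX rinvZ; last exact: rsupp_sub.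
    split=> //; exact: (submodZ sub_rsupp).
Qed.

End Reciprocal.

Ltac lia_size := repeat match goal with |- context [seq.size ?x] =>
  let n := fresh "n" in move: (seq.size x) => n end; lia.

(** * Orders at X = oo *)

Lemma frac_repr (R : idomainType) (x : {fraction R}) :
  exists n d : R, d != 0 /\ x = tofrac n / tofrac d.
Proof.
elim/quotW: x => x; have d0 := denom_ratioP x.
exists (frac x).1, (frac x).2; split=> //.
have fd : tofrac (frac x).2 != 0 by rewrite tofrac_eq0.
apply: (mulIf fd); rewrite divfK //; unlock tofrac; rewrite -[LHS]pi_mul.
apply/eqmodP; rewrite /= equivfE /mulf !numden_Ratio ?mulf_neq0 ?oner_neq0 //.
by rewrite !mulr1 mulrC.
Qed.

Section DegreeValuation.
Context (L : fieldType).
Local Notation R2 := {poly {poly L}}.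
Local Notation K := {fraction R2}.
Local Notation fr := (@tofrac R2).

(* K is the fraction field of L[T][X]: X has a pole at the special point, T
   records the grading. *)
Definition frL (p : {poly L}) : K := fr (map_poly polyC p).
Definition frT : K := fr 'X%:P.

Fact frL_is_zmod_morphism : zmod_morphism frL.
Proof. by move=> x y; rewrite /frL !rmorphB. Qed.
Fact frL_is_monoid_morphism : monoid_morphism frL.
Proof. by split=> [|x y]; rewrite /frL ?rmorph1 ?rmorphM. Qed.
HB.instance Definition _ := GRing.isZmodMorphism.Build {poly L} K frL frL_is_zmod_morphism.
HB.instance Definition _ := GRing.isMonoidMorphism.Build {poly L} K frL frL_is_monoid_morphism.

Lemma frLD : {morph frL : p s / p + s}. Proof. exact: rmorphD. Qed.
Lemma frLB : {morph frL : p s / p - s}. Proof. exact: rmorphB. Qed.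
Lemma frLM : {morph frL : p s / p * s}. Proof. exact: rmorphM. Qed.
Lemma frL0 : frL 0 = 0. Proof. exact: rmorph0. Qed.

Lemma frL_eq0 p : (frL p == 0) = (p == 0).
Proof. by rewrite /frL tofrac_eq0 map_poly_eq0. Qed.

Lemma frT_neq0 : frT != 0.
Proof. by rewrite /frT tofrac_eq0 polyC_eq0 polyX_eq0. Qed.

(* The order of vanishing at X = oo is at least M. *)
Definition vge (M : nat) (x : K) : Prop :=
  exists P Q : R2, [/\ Q != 0, x = fr P / fr Q & (size P + M <= size Q)%N].

(** Cross-multiplication shows that the bound does not depend on the fraction. A zero numerator is
    set apart because its [size] is 0, which does not stand for infinite order. *)
Lemma vge_frac M P Q : Q != 0 -> vge M (fr P / fr Q) -> P = 0 \/ (size P + M <= size Q)%N.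
Proof.
move=> Q0 [P' [Q' [Q'0 E le]]].
have [->|P0] := eqVneq P 0; [by left | right].
have {}E : P * Q' = P' * Q.
  move/eqP: E; rewrite eqr_div ?tofrac_eq0 // -!rmorphM tofrac_eq => /eqP; exact.
have P'0 : P' != 0.
  by apply: contraTneq (mulf_neq0 P0 Q'0) => P'0; rewrite E P'0 mul0r eqxx.
have := congr1 (fun p : R2 => size p) E; rewrite !size_mul //.
have : (0 < size P)%N by rewrite lt0n size_poly_eq0.
have : (0 < size P')%N by rewrite lt0n size_poly_eq0.
have : (0 < size Q)%N by rewrite lt0n size_poly_eq0.
have : (0 < size Q')%N by rewrite lt0n size_poly_eq0.
by move: le; lia_size.
Qed.

Lemma vge0 M : vge M 0.
Proof.
exists 0, 'X^M; split; first by rewrite monic_neq0 // monicXn.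
  by rewrite rmorph0 mul0r.
by rewrite size_poly0 size_polyXn leqW.
Qed.

Lemma vgeD M x y : vge M x -> vge M y -> vge M (x + y).
Proof.
move=> [P [Q [Q0 -> s]]] [P' [Q' [Q'0 -> s']]].
exists (P * Q' + P' * Q), (Q * Q'); split; first exact: mulf_neq0.
  by rewrite addf_div ?tofrac_eq0 // -!rmorphM -rmorphD.
rewrite (size_mul Q0 Q'0).
have := size_polyD (P * Q') (P' * Q).
have := size_polyMleq P Q'; have := size_polyMleq P' Q.
have : (0 < size Q)%N by rewrite lt0n size_poly_eq0.
have : (0 < size Q')%N by rewrite lt0n size_poly_eq0.
have [->|P0] := eqVneq P 0; have [->|P'0] := eqVneq P' 0; rewrite ?mul0r ?size_poly0.
- by move: s s'; rewrite add0r size_poly0; lia_size.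
- by rewrite add0r; move: s s'; lia_size.
- by rewrite addr0; move: s s'; lia_size.
- by move: s s'; lia_size.
Qed.

Lemma vgeN M x : vge M x -> vge M (- x).
Proof.
move=> [P [Q [Q0 -> s]]]; exists (- P), Q; split=> //; last by rewrite size_polyN.
by rewrite rmorphN mulNr.
Qed.

Lemma vgeM M M' x y : vge M x -> vge M' y -> vge (M + M') (x * y).
Proof.
move=> [P [Q [Q0 -> s]]] [P' [Q' [Q'0 -> s']]].
have [->|P0] := eqVneq P 0; first by rewrite rmorph0 !mul0r; exact: vge0.
have [->|P'0] := eqVneq P' 0; first by rewrite rmorph0 mul0r mulr0; exact: vge0.
exists (P * P'), (Q * Q'); split; first exact: mulf_neq0.
  by rewrite !rmorphM /= invfM mulrACA.
rewrite (size_mul Q0 Q'0) (size_mul P0 P'0).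
have : (0 < size Q)%N by rewrite lt0n size_poly_eq0.
have : (0 < size Q')%N by rewrite lt0n size_poly_eq0.
have : (0 < size P)%N by rewrite lt0n size_poly_eq0.
have : (0 < size P')%N by rewrite lt0n size_poly_eq0.
by move: s s'; lia_size.
Qed.

Lemma vge_sum M (I : Type) (s : seq I) (P : pred I) (f : I -> K) :
  (forall i, P i -> vge M (f i)) -> vge M (\sum_(i <- s | P i) f i).
Proof. by move=> H; apply: big_ind => //; [exact: vge0 | exact: vgeD]. Qed.

(** If both bounds fail, the orders are at most [M - 1] and [M' - 1], and orders add. This is the
    source of the primality of the limit ideal. *)
Lemma vge_prime M M' x y : vge (M + M') (x * y) -> vge M x \/ vge M' y.
Proof.
have [P [Q [Q0 xE]]] := frac_repr x; have [P' [Q' [Q'0 yE]]] := frac_repr y => h.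
have [le|lt] := leqP (size P + M) (size Q); first by left; exists P, Q.
have [le'|lt'] := leqP (size P' + M') (size Q'); first by right; exists P', Q'.
have QQ : Q * Q' != 0 by exact: mulf_neq0.
have [P0|P0] := eqVneq P 0; first by left; rewrite xE P0 rmorph0 mul0r; exact: vge0.
have [P'0|P'0] := eqVneq P' 0; first by right; rewrite yE P'0 rmorph0 mul0r; exact: vge0.
have : vge (M + M') (fr (P * P') / fr (Q * Q')).
  by rewrite !rmorphM /= invfM mulrACA -xE -yE.
move=> /(vge_frac QQ)[/eqP|]; first by rewrite mulf_eq0 (negbTE P0) (negbTE P'0).
rewrite (size_mul Q0 Q'0) (size_mul P0 P'0).
have : (0 < size P)%N by rewrite lt0n size_poly_eq0.
have : (0 < size P')%N by rewrite lt0n size_poly_eq0.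
have : (0 < size Q)%N by rewrite lt0n size_poly_eq0.
have : (0 < size Q')%N by rewrite lt0n size_poly_eq0.
by move: lt lt'; lia_size.
Qed.

(* x is finite at X = oo, and its value there becomes l when T is set to 1. *)
Definition residue (x : K) (l : L) : Prop :=
  exists P Q : R2, [/\ Q \is monic, x = fr P / fr Q, (size P <= size Q)%N
                     & (P`_(size Q).-1).[1] = l].

Lemma residue_vge0 x l : residue x l -> vge 0 x.
Proof.
move=> [P [Q [mQ -> s _]]]; exists P, Q; split=> //; first exact: monic_neq0.
by rewrite addn0.
Qed.

Lemma residue_nvge x l : residue x l -> l != 0 -> ~ vge 1 x.
Proof.
move=> [P [Q [mQ -> s lE]]] l0 /(vge_frac (monic_neq0 mQ))[P0|le].
  by move: l0; rewrite -lE P0 coef0 horner0 eqxx.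
by move: l0; rewrite -lE nth_default ?horner0 ?eqxx //; move: le; lia_size.
Qed.

Lemma coefM_top (P S : R2) m n : (size P <= m.+1)%N -> (size S <= n.+1)%N ->
  (P * S)`_(m + n) = P`_m * S`_n.
Proof.
move=> Pm Sn; rewrite coefM.
have mlt : (m < (m + n).+1)%N by rewrite ltnS leq_addr.
rewrite (bigD1 (Ordinal mlt)) //= addKn big1 ?addr0 // => i im.
have {}im : (i != m :> nat) by [].
case: (ltnP i m) => h.
  by rewrite [S`__]nth_default ?mulr0 //; move: h Sn; lia_size.
by rewrite nth_default ?mul0r //; move: h Pm im; lia_size.
Qed.

Lemma residueD x y l l' : residue x l -> residue y l' -> residue (x + y) (l + l').
Proof.
move=> [P [Q [mQ -> s lE]]] [P' [Q' [mQ' -> s' lE']]].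
have [Q0 Q'0] := (monic_neq0 mQ, monic_neq0 mQ').
have q0 : (0 < size Q)%N by rewrite lt0n size_poly_eq0.
have q0' : (0 < size Q')%N by rewrite lt0n size_poly_eq0.
exists (P * Q' + P' * Q), (Q * Q'); split; first by rewrite monicMl.
- by rewrite addf_div ?tofrac_eq0 // -!rmorphM -rmorphD.
- rewrite (size_mul Q0 Q'0); have := size_polyD (P * Q') (P' * Q).
  by have := size_polyMleq P Q'; have := size_polyMleq P' Q; move: s s' q0 q0'; lia_size.
- rewrite (size_mul Q0 Q'0).
  have -> : ((size Q + size Q').-1.-1 = (size Q).-1 + (size Q').-1)%N by move: q0 q0'; lia_size.
  rewrite coefD coefM_top ?prednK //.
  rewrite addnC coefM_top ?prednK //.
  rewrite -!lead_coefE (monicP mQ) (monicP mQ') !mulr1 hornerD.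
  by rewrite lE lE'.
Qed.

Lemma residueM x y l l' : residue x l -> residue y l' -> residue (x * y) (l * l').
Proof.
move=> [P [Q [mQ -> s lE]]] [P' [Q' [mQ' -> s' lE']]].
have [Q0 Q'0] := (monic_neq0 mQ, monic_neq0 mQ').
have q0 : (0 < size Q)%N by rewrite lt0n size_poly_eq0.
have q0' : (0 < size Q')%N by rewrite lt0n size_poly_eq0.
exists (P * P'), (Q * Q'); split; first by rewrite monicMl.
- by rewrite !rmorphM /= invfM mulrACA.
- by rewrite (size_mul Q0 Q'0); have := size_polyMleq P P'; move: s s' q0 q0'; lia_size.
- rewrite (size_mul Q0 Q'0).
  have -> : ((size Q + size Q').-1.-1 = (size Q).-1 + (size Q').-1)%N by move: q0 q0'; lia_size.
  by rewrite coefM_top ?prednK // hornerM lE lE'.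
Qed.

Lemma residue_const c : residue (frL c%:P) c.
Proof.
exists (map_poly polyC c%:P), 1; split; rewrite ?monic1 ?rmorph1 ?invr1 ?mulr1 //.
  by rewrite size_map_polyC size_poly1 size_polyC; case: (c == 0).
by rewrite size_poly1 map_polyC coefC /= hornerC.
Qed.

Lemma residueN x l : residue x l -> residue (- x) (- l).
Proof.
have := residue_const (-1).
rewrite polyCN rmorphN polyC1 rmorph1 => h hx.
by have := residueM h hx; rewrite !mulN1r.
Qed.

Lemma residue_pole (p : {poly L}) : (1 < size p)%N -> residue (frT / frL p) 0.
Proof.
move=> p1; have p0 : p != 0 by move: p1; rewrite -size_poly_eq0; lia_size.
have l0 : lead_coef p != 0 by rewrite lead_coef_eq0.
pose c := (lead_coef p)^-1; have c0 : c != 0 by rewrite invr_neq0.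
have szc : size (map_poly polyC (c *: p)) = size p by rewrite size_map_polyC size_scale.
exists (c *: 'X)%:P, (map_poly polyC (c *: p)); split.
- rewrite monicE lead_coef_map_inj ?polyC0 //; last exact: polyC_inj.
  by rewrite lead_coefZ mulVf.
- have fp : frL p != 0 by rewrite frL_eq0.
  have fc : frL c%:P != 0 by rewrite frL_eq0 polyC_eq0.
  have -> : fr (map_poly polyC (c *: p)) = frL c%:P * frL p.
    by rewrite -mul_polyC -rmorphM.
  have -> : fr (c *: 'X)%:P = frL c%:P * frT.
    by rewrite /frL /frT -rmorphM map_polyC -polyCM mul_polyC.
  by rewrite -mulf_div mulfV // mul1r.
- by rewrite szc (leq_trans (size_polyC_leq1 _)) // ltnW.
- by rewrite szc coefC; case: (size p) p1 => [|[|n]] //= _; rewrite horner0.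
Qed.

Lemma residue_unit c : c != 0 -> residue (frT / frL c%:P) c^-1.
Proof.
move=> c0; exists (c^-1 *: 'X)%:P, 1; split; rewrite ?monic1 ?rmorph1 ?invr1 ?mulr1 //.
- have fc : frL c%:P != 0 by rewrite frL_eq0 polyC_eq0.
  apply: (mulIf fc); rewrite divfK //.
  by rewrite /frL /frT -rmorphM map_polyC -polyCM -mul_polyC mulrAC -polyCM mulVf ?mul1r.
- by rewrite size_poly1 size_polyC_leq1.
- by rewrite size_poly1 coefC /= hornerZ hornerX mulr1.
Qed.

Lemma vge_pole M (p : {poly L}) : (M < size p)%N -> vge M (frT / frL p).
Proof.
move=> Mp; exists 'X%:P, (map_poly polyC p); split=> //.
  by move: Mp; rewrite -size_poly_eq0 size_map_polyC; lia_size.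
by rewrite size_map_polyC; apply: leq_trans Mp; rewrite -add1n leq_add2r size_polyC_leq1.
Qed.

(** Order at least [-M] at X = oo, complementing [vge], which expresses only non-negative bounds. *)
Definition pole_le (M : nat) (x : K) : Prop :=
  exists P Q : R2, [/\ Q != 0, x = fr P / fr Q & (size P <= size Q + M)%N].

Lemma pole_leM M M' x y : pole_le M x -> pole_le M' y -> pole_le (M + M') (x * y).
Proof.
move=> [P [Q [Q0 -> s]]] [P' [Q' [Q'0 -> s']]].
exists (P * P'), (Q * Q'); split; first exact: mulf_neq0.
  by rewrite !rmorphM /= invfM mulrACA.
rewrite (size_mul Q0 Q'0); have := size_polyMleq P P'.
have : (0 < size Q)%N by rewrite lt0n size_poly_eq0.
have : (0 < size Q')%N by rewrite lt0n size_poly_eq0.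
by move: s s'; lia_size.
Qed.

Lemma pole_le_frL M (p s : {poly L}) : s != 0 -> (size p <= size s + M)%N ->
  pole_le M (frL p / frL s).
Proof.
move=> s0 le; exists (map_poly polyC p), (map_poly polyC s).
by rewrite !size_map_polyC -size_poly_eq0 size_map_polyC size_poly_eq0.
Qed.

Lemma pole_le_frT_inv : pole_le 0 frT^-1.
Proof.
exists 1, 'X%:P; split; first by rewrite polyC_eq0 polyX_eq0.
  by rewrite rmorph1 mul1r.
by rewrite size_poly1 size_polyC polyX_eq0.
Qed.

Lemma pole_le_prod (I : eqType) (s : seq I) (b : I -> nat) (x : I -> K) :
  (forall i, i \in s -> pole_le (b i) (x i)) ->
  pole_le (\sum_(i <- s) b i) (\prod_(i <- s) x i).
Proof.
elim: s => [|i s IH] h.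
  rewrite !big_nil; exists 1, 1; rewrite oner_neq0 divff ?tofrac_eq0 ?oner_neq0 //.
  by rewrite addn0.
rewrite !big_cons; apply: pole_leM; first by apply: h; exact: mem_head.
by apply: IH => l ls; apply: h; rewrite inE ls orbT.
Qed.

Lemma pole_le_ninv M x : x != 0 -> pole_le M x -> ~ vge M.+1 x^-1.
Proof.
move=> x0 [P [Q [Q0 xE le]]].
have P0 : P != 0 by apply: contraNneq x0 => P0; rewrite xE P0 rmorph0 mul0r.
rewrite xE invf_div => /(vge_frac P0)[/eqP|]; first by rewrite (negbTE Q0).
by move: le; lia_size.
Qed.

Definition homog (d : nat) (x : K) : Prop :=
  exists p q : {poly L}, q != 0 /\ x = frT ^+ d * frL p / frL q.

Lemma homog0 d : homog d 0.
Proof. by exists 0, 1; rewrite oner_neq0 rmorph0 mulr0 mul0r. Qed.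

Lemma homogD d x y : homog d x -> homog d y -> homog d (x + y).
Proof.
move=> [p [s [s0 ->]]] [p' [s' [s'0 ->]]]; exists (p * s' + p' * s), (s * s').
split; first exact: mulf_neq0.
by rewrite addf_div ?frL_eq0 // -!mulrA -mulrDr -!rmorphM -rmorphD mulrA.
Qed.

Lemma homogN d x : homog d x -> homog d (- x).
Proof. by move=> [p [s [s0 ->]]]; exists (- p), s; rewrite rmorphN mulrN mulNr. Qed.

Lemma homogM d d' x y : homog d x -> homog d' y -> homog (d + d') (x * y).
Proof.
move=> [p [s [s0 ->]]] [p' [s' [s'0 ->]]]; exists (p * p'), (s * s').
split; first exact: mulf_neq0.
by rewrite exprD mulf_div mulrACA -!rmorphM.
Qed.

Lemma homog_frL p : homog 0 (frL p).
Proof. by exists p, 1; rewrite oner_neq0 expr0 mul1r rmorph1 divr1. Qed.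

Lemma homog_frT p : homog 1 (frT / frL p).
Proof.
have [->|p0] := eqVneq p 0; first by rewrite rmorph0 invr0 mulr0; exact: homog0.
by exists 1, p; rewrite p0 expr1 rmorph1 mulr1.
Qed.

(** Over a common denominator in [L[X]], terms with different powers of [T] cannot cancel, so the
    order of the sum is the least order of a term. The homogeneity of the limit ideal rests on
    this. *)
Lemma homog_sum_vge M n (x : 'I_n -> K) : (forall i : 'I_n, homog i (x i)) ->
  vge M (\sum_i x i) -> forall i, vge M (x i).
Proof.
move=> hx vx i0.
have /choice[ps psP] : forall i : 'I_n, exists ps : {poly L} * {poly L},
    ps.2 != 0 /\ x i = frT ^+ i * frL ps.1 / frL ps.2.
  by move=> i; have [p [s]] := hx i; exists (p, s).
pose Q := \prod_i (ps i).2.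
have Q0 : Q != 0 by apply/prodf_neq0 => i _; case: (psP i).
pose p i := (ps i).1 * \prod_(l | l != i) (ps l).2.
have xE i : x i = frT ^+ i * frL (p i) / frL Q.
  have [s0 ->] := psP i; rewrite /Q (bigD1 i) //= /p.
  have P0 : \prod_(l < n | l != i) (ps l).2 != 0.
    by apply/prodf_neq0 => l _; case: (psP l).
  by rewrite !rmorphM /= mulrA -mulf_div divff ?mulr1 // frL_eq0.
pose N : R2 := \sum_(i < n) ('X^i)%:P * map_poly polyC (p i).
have TX d : frT ^+ d = fr ('X^d)%:P by rewrite polyC_exp rmorphXn.
have NE : \sum_i x i = fr N / fr (map_poly polyC Q).
  rewrite /N rmorph_sum mulr_suml; apply: eq_bigr => i _.
  by rewrite xE TX /frL -rmorphM.
have mQ0 : map_poly polyC Q != 0 by rewrite -tofrac_eq0 -/(frL Q) frL_eq0.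
have szp i : (size (p i) <= size N)%N.
  apply/leq_sizeP => l lN; have := congr1 (fun h : {poly L} => h`_i) (nth_default 0 lN : N`_l = 0).
  rewrite /N coef_sum coef0 coef_sum (bigD1 i) //= big1 ?addr0 => [E|i' ii'].
    by apply: etrans E; rewrite mul_polyC coefZ coef_map /= coefMC coefXn eqxx mul1r.
  rewrite mul_polyC coefZ coef_map /= coefMC coefXn.
  by rewrite (_ : (i == i' :> nat) = false) ?mul0r // eq_sym; apply/negbTE.
rewrite NE in vx; case: (vge_frac mQ0 vx) => [N0|le].
  have := szp i0; rewrite N0 size_poly0 leqn0 size_poly_eq0 => /eqP pi0.
  by rewrite xE pi0 rmorph0 mulr0 mul0r; exact: vge0.
rewrite xE; exists (('X^i0)%:P * map_poly polyC (p i0)), (map_poly polyC Q); split=> //.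
  by rewrite TX /frL -rmorphM.
apply: leq_trans le; rewrite leq_add2r; apply: leq_trans (szp i0).
by rewrite mul_polyC (leq_trans (size_scale_leq _ _)) // size_map_polyC.
Qed.

End DegreeValuation.

(** * Completion of a partial level structure *)

Section Drinfeld.
Context (Fq : finFieldType) (F : fieldType) (iota : {rmorphism Fq -> F}).
Context (infty : set F).
Hypothesis hF : is_global_function_field iota.
Local Notation q := #|Fq|.
Local Notation A := (Areg iota infty).
Variables (g : F) (N : set F) (r : nat).
Hypotheses (Ag : A g) (g0 : g != 0) (NE : N = principal iota infty g).
Hypothesis gnu : ~ A g^-1.
Local Notation Div := (Div iota infty N).
Local Notation tor := (torsion iota infty r).
Local Notation act := (@torsion_mul Fq F iota infty r).
Local Notation VN := (@VN Fq F iota infty N r).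
Local Notation cls := (@cls Fq F iota infty g).
Local Notation prA := (@prA Fq F iota infty).
Local Notation simple_mod := (@simple_mod Fq F iota infty g).
Let subVN := sub_VN g0 r NE.
Let finVN := finite_VN hF Ag g0 r NE.

Variables (L : fieldType) (j : {rmorphism F -> L}).
Variables (S : set tor) (w : tor -> L) (phi : F -> {poly L}).
Let kap : {rmorphism Fq -> L} := (j \o iota)%FUN.
Hypotheses (subS : is_submodule S) (S_VN : S `<=` VN).
Hypothesis S_act : forall a v, A a -> S v -> S (act a v).
Hypothesis S_neq0 : exists2 v, S v & v != 0.
Hypothesis wD : forall u v, S u -> S v -> w (u + v) = w u + w v.
Hypothesis wZ : forall a v, S v -> w (a *: v) = kap a * w v.
Hypothesis w_eq0 : forall v, S v -> w v = 0 -> v = 0.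
Hypothesis phi_lin : forall a, A a -> is_linearized Fq (phi a).
Hypothesis phi_coef1 : forall a, A a -> (phi a)`_1 = j a.
Hypothesis phiD : forall a b, A a -> A b -> phi (a + b) = phi a + phi b.
Hypothesis phiM : forall a b, A a -> A b -> phi (a * b) = phi a \Po phi b.
Hypothesis phi_const : forall a, phi (iota a) = kap a *: 'X.
Hypothesis phi_w : forall a v, A a -> S v -> (phi a).[w v] = w (act a v).
Hypothesis phi_prod : forall a, Div a -> exists2 k, k != 0 &
  phi a = k *: \prod_(u <- [seq w v | v <- enumset [set v | S v /\ act a v = 0]]) ('X - u%:P).

Lemma w0 : w 0 = 0.
Proof. by rewrite -(scale0r 0) wZ ?rmorph0 ?mul0r //; exact: (submod0 subS). Qed.

Lemma wB u v : S u -> S v -> w (u - v) = w u - w v.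
Proof.
move=> Su Sv; rewrite wD //; last exact: (submodN subS).
by rewrite -scaleN1r wZ // rmorphN1 mulN1r.
Qed.

Lemma w_inj u v : S u -> S v -> w u = w v -> u = v.
Proof.
move=> Su Sv uv; apply/eqP; rewrite -subr_eq0; apply/eqP; apply: w_eq0.
  exact: (submodB subS).
by rewrite wB // uv subrr.
Qed.

Lemma finite_S : finite_set S. Proof. exact: sub_finite_set finVN. Qed.
Lemma SP v : reflect (S v) (v \in enumset S).
Proof. by apply: enumsetP; exact: finite_S. Qed.

Lemma phi0 : phi 0 = 0.
Proof. by rewrite -(rmorph0 iota) phi_const rmorph0 scale0r. Qed.
Lemma phi1 : phi 1 = 'X.
Proof. by rewrite -(rmorph1 iota) phi_const rmorph1 scale1r. Qed.
Lemma phiN a : A a -> phi (- a) = - phi a.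
Proof.
by move=> Aa; apply/eqP; rewrite -addr_eq0 -phiD ?addNr ?phi0 //; exact: AregN.
Qed.

Lemma phi_neq0 a : A a -> a != 0 -> phi a != 0.
Proof.
move=> Aa a0; have := phi_coef1 Aa; apply: contra_eq_neq => ->.
by rewrite coef0 eq_sym fmorph_eq0.
Qed.

Lemma size_phi_gt1 a : A a -> a != 0 -> (1 < size (phi a))%N.
Proof.
move=> Aa a0; rewrite ltnNge; apply/negP => /leq_sizeP /(_ 1 (leqnn _)).
by rewrite phi_coef1 // => /eqP; rewrite fmorph_eq0 (negbTE a0).
Qed.

(** A multiplicative and ultrametric measure of size on [A], positive away from 0; it sees elements
    of [A] through [phi] and not through the place [infty]. *)
Definition dgr a := (size (phi a)).-1.

Lemma dgr0 : dgr 0 = 0%N. Proof. by rewrite /dgr phi0 size_poly0. Qed.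

Lemma dgr_gt0 a : A a -> a != 0 -> (0 < dgr a)%N.
Proof. by move=> Aa a0; rewrite /dgr -ltnS prednK ?size_phi_gt1 // ltnW ?size_phi_gt1. Qed.

Lemma dgrM a b : A a -> A b -> dgr (a * b) = (dgr a * dgr b)%N.
Proof. by move=> Aa Ab; rewrite /dgr phiM // size_comp_poly. Qed.

Lemma dgrX a n : A a -> dgr (a ^+ n) = (dgr a ^ n)%N.
Proof.
move=> Aa; elim: n => [|n IH]; first by rewrite expr0 expn0 /dgr phi1 size_polyX.
by rewrite exprS dgrM ?IH ?expnS //; exact: AregX.
Qed.

Lemma dgrD a b : A a -> A b -> (dgr (a + b) <= maxn (dgr a) (dgr b))%N.
Proof.
by move=> Aa Ab; rewrite /dgr phiD //; have := size_polyD (phi a) (phi b); lia.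
Qed.

Lemma dgrN a : A a -> dgr (- a) = dgr a.
Proof. by move=> Aa; rewrite /dgr phiN // size_polyN. Qed.

Lemma dgr_expq a : A a -> a != 0 -> exists d, dgr a = (q ^ d)%N.
Proof.
move=> Aa a0; have [c cE] := phi_lin Aa.
have c0 : c != 0.
  by apply: contraNneq (phi_neq0 Aa a0) => c0; rewrite cE c0 linp0.
by exists (size c).-1; rewrite /dgr cE size_linp.
Qed.

Lemma dgr_g : dgr g = size (enumset S).
Proof.
have [|k k0 E] := phi_prod (a := g); first exact: Div_g.
rewrite /dgr E size_scale // size_prod_XsubC size_map /=.
congr size; congr enumset; apply/seteqP; split=> [v []//|v Sv]; split=> //.
by apply: (act_g Ag g0 NE); exact: S_VN.
Qed.

Lemma dgr_g_gt1 : (1 < dgr g)%N.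
Proof.
rewrite dgr_g; have [v Sv v0] := S_neq0.
apply: (@uniq_leq_size _ [:: 0; v]) => [|x]; first by rewrite /= inE eq_sym v0.
rewrite !inE => /orP[]/eqP ->; apply/SP => //; exact: (submod0 subS).
Qed.

(** The part of [S] killed by the annihilator of [c] in [A/(g)]; for simple [c], the torsion of [S]
    at a maximal ideal. *)
Definition Sann (c : F) : set tor :=
  [set v | S v /\ forall x, A x -> A (x * c / g) -> act x v = 0].

Lemma sub_Sann c : is_submodule (Sann c).
Proof.
split; first by split=> [|x Ax _]; [exact: (submod0 subS) | exact: act0].
move=> a x y [Sx x0] [Sy y0]; split; first by case: subS => _; apply.
by move=> z Az zc; rewrite actD // actZ // x0 // y0 // scaler0 addr0.
Qed.

Lemma finite_Sann c : finite_set (Sann c).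
Proof. by apply: sub_finite_set finite_S => v []. Qed.

Lemma SannP c v : reflect (Sann c v) (v \in enumset (Sann c)).
Proof. by apply: enumsetP; exact: finite_Sann. Qed.

Lemma Sann_act c a v : A a -> Sann c v -> Sann c (act a v).
Proof.
move=> Aa [Sv v0]; split; first exact: S_act.
by move=> x Ax xc; rewrite -actM // mulrC actM // v0 // act0.
Qed.

(** * Torsion at a maximal ideal, by linear algebra over L{tau} *)

Section TorsionBound.
Variables (c p u : F) (e : nat).
Hypothesis sc : simple_mod c.
Hypotheses (Ap : A p) (Au : A u) (pcE : p * c = g * u) (nu : ~ A (u * c / g)).
Hypothesis eE : size (enumset (Sann c)) = (q ^ e)%N.

Lemma p_neq0 : p != 0.
Proof.
apply/eqP => p0; apply: nu; move: pcE; rewrite p0 mul0r => /esym/eqP.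
by rewrite mulf_eq0 (negbTE g0) /= => /eqP ->; rewrite !mul0r; exact: Areg0.
Qed.

Lemma Sann_p v : Sann c v -> act p v = 0.
Proof. by move=> [_]; apply=> //; rewrite pcE mulrC mulKf. Qed.

Lemma Sann_pX n v : (0 < n)%N -> Sann c v -> act (p ^+ n) v = 0.
Proof.
case: n => // n _ Sv; rewrite exprSr actM ?Sann_p ?act0 //; exact: AregX.
Qed.

(** [u] has an inverse [y] modulo the annihilator of [c], and that annihilator kills [Sann c]. *)
Lemma Sann_uX k v : Sann c v -> exists2 v', Sann c v' & act (u ^+ k) v' = v.
Proof.
have [Ac _ /(_ u Au nu)[y Ay yE]] := sc.
elim: k v => [|k IH] v Sv; first by exists v => //; rewrite expr0 act1.
have [v' Sv' <-] := IH v Sv; exists (act y v'); first exact: Sann_act.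
rewrite exprSr actM //; last exact: AregX.
congr (act _ _); rewrite -actM // mulrC.
have Ayu := AregM Ay Au.
apply/eqP; rewrite -subr_eq0 -{2}(act1 v') -actBl //; last exact: Areg1.
apply/eqP; have [_] := Sv'; apply.
  by apply: AregB => //; exact: Areg1.
by rewrite mulrBl mul1r.
Qed.

(** Membership in the left ideal of [phi (p ^+ n)] after inverting [u]. In the localization of [A]
    at the annihilator of [c], [u] is a unit and [p] generates the maximal ideal, so this is
    divisibility by the [n]-th power of that ideal. *)
Definition deep n (x : {poly L}) : Prop :=
  exists k y, is_linearized Fq y /\ x \Po phi (u ^+ k) = y \Po phi (p ^+ n).

Lemma deep_vanish n x v : deep n.+1 x -> Sann c v -> x.[w v] = 0.
Proof.
move=> [k [y [[cy yE] E]]] Sv; have [v' Sv' <-] := Sann_uX k Sv.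
have Sv'' : S v' by case: Sv'.
rewrite -phi_w //; last exact: AregX.
rewrite -horner_comp E horner_comp phi_w //; last exact: AregX.
by rewrite Sann_pX // w0 yE horner_linp0.
Qed.

(** The points [w v] with [v] in [Sann c] are roots of the whole sum and of its terms with [i > 0];
    so [P 0], of [q]-degree below [e], would give a polynomial with [q^e] roots. Once it vanishes,
    [phi p] cancels on the right and the indices shift down. *)
Lemma deep_indep n (P : nat -> {poly L}) :
  (forall i, size (P i) <= e)%N ->
  deep n (\sum_(i < n) (linp Fq (P i) \Po phi (p ^+ i))) -> forall i, (i < n)%N -> P i = 0.
Proof.
elim: n P => // n IH P Ps dp.
have Ap' i : A (p ^+ i) by exact: AregX.
have P0 : P 0%N = 0.
  apply/eqP; apply: contraT => P0.
  have l0 : linp Fq (P 0%N) != 0 by apply: contraNneq P0 => /linp_eq0 ->.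
  have rts : all (root (linp Fq (P 0%N))) [seq w v | v <- enumset (Sann c)].
    apply/allP => _ /mapP[v /SannP Sv ->]; rewrite rootE.
    have := deep_vanish dp Sv; rewrite big_ord_recl hornerD expr0 phi1 comp_polyXr.
    rewrite [X in _ + X = _]horner_sum [X in _ + X = _]big1 ?addr0 => [->//|i _].
    have [? _] := Sv.
    by rewrite horner_comp phi_w // Sann_pX // w0 horner_linp0.
  have us : uniq [seq w v | v <- enumset (Sann c)].
    rewrite map_inj_in_uniq ?uniq_enumset // => x y.
    move=> /SannP[Sx _] /SannP[Sy _].
    exact: w_inj.
  have := max_poly_roots l0 rts us; rewrite size_map eE size_linp // ltnS.
  rewrite leqNgt ltn_exp2l ?q_gt1 // prednK ?lt0n ?size_poly_eq0 //.
  by rewrite Ps.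
case=> [//|i] ilt; apply: (IH (fun i => P i.+1)) => //.
have [k [y [yl]]] := dp; rewrite big_ord_recl P0 linp0 comp_poly0 add0r => E.
exists k, y; split=> //.
have s1 : (1 < size (phi p))%N by apply: size_phi_gt1 => //; exact: p_neq0.
apply/eqP; rewrite -subr_eq0 -(comp_poly_eq0 _ s1) comp_polyB subr_eq0; apply/eqP.
have Au' l : A (u ^+ l) by exact: AregX.
rewrite -!comp_polyA -!phiM // -[p ^+ n * p]exprSr -E mulrC phiM // comp_polyA.
congr (_ \Po _).
rewrite linear_sum; apply: eq_bigr => l _ /=.
by rewrite -comp_polyA -phiM // -exprSr.
Qed.

Lemma deep_dgr n a b d : A a -> A b -> b != 0 -> u ^+ n * b = p ^+ n * a ->
  dgr b = (q ^ d)%N -> (n * e <= d)%N.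
Proof.
move=> Aa Ab b0 E dE; rewrite leqNgt; apply/negP => lt.
have Ap' i : A (p ^+ i) by exact: AregX.
have Au' l : A (u ^+ l) by exact: AregX.
have linX t : is_linearized Fq ('X^(q ^ t) : {poly L}) by exists 'X^t; rewrite linpXn.
have /choice[C CE] : forall t, exists C, linp Fq C = 'X^(q ^ t) \Po phi b.
  move=> t; have [C CE] := is_linearized_comp kap (linX t) (phi_lin Ab).
  by exists C.
have /choice[E0 E0E] : forall il : nat * nat, exists C,
    linp Fq C = 'X^(q ^ il.2) \Po phi (p ^+ il.1).
  move=> il; have [C0 C0E] := is_linearized_comp kap (linX il.2) (phi_lin (Ap' il.1)).
  by exists C0.
(* The [M - d] elements [tau^t phi(b)] and the [n * e] others all have [q]-degree below [M]; if
   [d < n * e], there are more than [M] of them. *)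
pose M := (d + \max_(il : 'I_n * 'I_e) size (E0 (il.1 : nat, il.2 : nat)))%N.
have Es (il : 'I_n * 'I_e) : (size (E0 (il.1 : nat, il.2 : nat)) <= M)%N.
  apply: leq_trans (leq_addl _ _).
  exact: (leq_bigmax (F := fun il : 'I_n * 'I_e => size (E0 (il.1 : nat, il.2 : nat)))).
have Cs t : (t < M - d)%N -> (size (C t) <= M)%N.
  move=> tM; have C0 : C t != 0.
    apply: contra_neq (phi_neq0 Ab b0) => C0; have := CE t.
    rewrite C0 linp0 comp_Xn_poly => /esym/eqP.
    by rewrite expf_eq0 => /andP[_ /eqP].
  have := size_linp Fq C0; rewrite CE => H.
  have := size_comp_poly 'X^(q ^ t) (phi b); rewrite H size_polyXn /= -/(dgr b) dE -expnD.
  move=> /(expnI (q_gt1 Fq)) => H'.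
  have : (size (C t)).-1 = (t + d)%N := H'.
  by move: tM; rewrite ltn_subRL; case: (size (C t)) => //= s; lia.
pose fam (x : 'I_(M - d) + 'I_n * 'I_e) : {poly L} :=
  match x with inl t => C t | inr il => E0 (il.1 : nat, il.2 : nat) end.
have fs x : (size (fam x) <= M)%N by case: x => [t|il] /=; [exact: Cs | exact: Es].
have [|al [x0 alx0] alE] := @linear_dependence_fin L
    ('I_(M - d) + 'I_n * 'I_e)%type 'I_M (fun x i => (fam x)`_i).
  rewrite card_sum card_prod !card_ord.
  by have := leq_addr (\max_(il : 'I_n * 'I_e) size (E0 (il.1 : nat, il.2 : nat))) d; rewrite -/M; lia.
have {}alE : \sum_x al x *: fam x = 0.
  apply/polyP => i; rewrite coef0 coef_sum.
  have [iM|iM] := ltnP i M.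
    by rewrite -[RHS](alE (Ordinal iM)); apply: eq_bigr => x _; rewrite coefZ.
  by apply: big1 => x _; rewrite coefZ nth_default ?mulr0 // (leq_trans (fs x)).
pose z : {poly L} := \poly_(t < M - d) (if insub t is Some t' then al (inl t') else 0).
pose P i : {poly L} := \poly_(l < e) (if insub i is Some i' then
  if insub l is Some l' then al (inr (i', l')) else 0 else 0).
have zE : linp Fq z \Po phi b = \sum_t al (inl t) *: linp Fq (C t).
  rewrite (@linpE _ _ (M - d)) ?size_poly // linear_sum; apply: eq_bigr => t _.
  by rewrite /= comp_polyZ coef_poly ltn_ord valK CE.
have PE : \sum_(i < n) (linp Fq (P i) \Po phi (p ^+ i)) =
    \sum_il al (inr il) *: linp Fq (E0 (il.1 : nat, il.2 : nat)).
  transitivity (\sum_(i < n) \sum_(l < e) al (inr (i, l)) *: linp Fq (E0 (i : nat, l : nat))).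
    apply: eq_bigr => i _.
    rewrite (@linpE _ _ e) ?size_poly // linear_sum; apply: eq_bigr => l _.
    by rewrite /= comp_polyZ coef_poly ltn_ord !valK E0E.
  by rewrite pair_bigA; apply: eq_bigr => -[].
have sum0 : (linp Fq z \Po phi b) + \sum_(i < n) (linp Fq (P i) \Po phi (p ^+ i)) = 0.
  have H : linp Fq 0 = \sum_x al x *: linp Fq (fam x).
    have -> : linp Fq 0 = linp Fq (\sum_x al x *: fam x) by rewrite alE.
    by rewrite linp_sum; apply: eq_bigr => x _; rewrite linpZ.
  by rewrite zE PE -[RHS](linp0 Fq) H big_sumType.
have P0 : forall i, (i < n)%N -> P i = 0.
  apply: deep_indep; first by move=> i; exact: size_poly.
  exists n, (linp Fq (- z) \Po phi a); split.
    by apply: (is_linearized_comp kap); [exists (- z) | exact: phi_lin].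
  have -> : \sum_(i < n) (linp Fq (P i) \Po phi (p ^+ i)) = linp Fq (- z) \Po phi b.
    rewrite -(scaleN1r z) linpZ comp_polyZ scaleN1r; apply/eqP.
    by rewrite -addr_eq0 addrC sum0.
  by rewrite -!comp_polyA -!phiM // mulrC E mulrC.
have z0 : z = 0.
  apply: (@linp_eq0 Fq); apply/eqP.
  rewrite -(comp_poly_eq0 _ (size_phi_gt1 Ab b0)); apply/eqP.
  rewrite -[RHS]sum0 big1 ?addr0 // => i _; by rewrite P0 // linp0 comp_poly0.
move/eqP: alx0; apply; case: x0 => [t|[i l]].
  have := congr1 (fun h : {poly L} => h`_t) z0.
  by rewrite coef_poly ltn_ord valK coef0.
have := congr1 (fun h : {poly L} => h`_l) (P0 i (ltn_ord i)).
by rewrite coef_poly ltn_ord !valK coef0.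
Qed.

End TorsionBound.
Lemma exists_sel c : exists sel : mod_quot (A : set (res_scalars iota)) -> F,
  forall x, cls c x -> A (sel x) /\ prA (sel x * c / g) = x.
Proof.
have /choice[sel selP] : forall x, exists a, cls c x -> A a /\ prA (a * c / g) = x.
  move=> x; case: (pselect (cls c x)) => [[a Aa ax]|]; last by exists 0.
  by exists a.
by exists sel.
Qed.

Lemma cls_mem c a : A a -> cls c (prA (a * c / g)).
Proof. by move=> Aa; exists a. Qed.

Let fcls c (Ac : A c) : finite_set (cls c) := finite_cls hF Ag g0 Ac.

(* The torsion of phi at the maximal ideal killing c has at most the size
   predicted by the rank: otherwise elements b of A highly divisible there, which
   exist by pigeonhole among the expansions sum_i g^i b_i, would have phi_b of
   too large degree. *)
Lemma torsion_bound c e f G s : simple_mod c ->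
  size (enumset (Sann c)) = (q ^ e)%N -> size (enumset (cls c)) = (q ^ f)%N ->
  size (enumset (cls 1)) = (q ^ G)%N -> size (enumset S) = (q ^ s)%N ->
  (e * G <= f * s)%N.
Proof.
move=> sc eE fE GE sE; have [Ac nAc _] := sc.
have [p [u [Ap Au pE nu]]] := locally_principal hF Ag g0 Ac nAc.
have [sel selP] := exists_sel c; have [sel0 sel0P] := exists_sel 1.
have qg1 := q_gt1 Fq.
have A1 := @Areg1 Fq F iota infty.
have f1 := fcls A1; have fc := fcls Ac.
have D1 : (0 < dgr g)%N by exact: dgr_gt0.
(* A digit shift at the annihilator of [c]: [sel] picks a representative of the leading digit and
   [p * step b = u * (b - digit)]. If [b] and [b'] share [n] digits, then [p^n] divides
   [u^n (b - b')]. *)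
pose step b := c * (b - sel (prA (b * c / g))) / g.
have stepP b : A b -> A (step b) /\ p * step b = u * (b - sel (prA (b * c / g))).
  move=> Ab; have [As sE'] := selP _ (cls_mem c Ab); split.
    have -> : step b = b * c / g - sel (prA (b * c / g)) * c / g.
      by rewrite /step; field; exact: g0.
    by apply/prA_eq; rewrite sE'.
  have -> : u = p * c / g by rewrite pE mulrC mulKf.
  by rewrite /step; field; exact: g0.
have Astep b i : A b -> A (iter i step b).
  by move=> Ab; elim: i => //= i IH; case: (stepP _ IH).
have same n b b' : A b -> A b' ->
    (forall i, (i < n)%N -> prA (iter i step b * c / g) = prA (iter i step b' * c / g)) ->
    u ^+ n * (b - b') = p ^+ n * (iter n step b - iter n step b').
  move=> Ab Ab'; elim: n => [|n IH] E; first by rewrite !expr0.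
  have [_ Eb] := stepP _ (Astep b n Ab); have [_ Eb'] := stepP _ (Astep b' n Ab').
  have -> : p ^+ n.+1 * (iter n.+1 step b - iter n.+1 step b') =
      p ^+ n * (p * step (iter n step b) - p * step (iter n step b')).
    by rewrite exprSr -mulrA mulrBr.
  rewrite Eb Eb' (E n (ltnSn n)) exprS -mulrA IH; last by move=> i /ltnW/E.
  by ring.
(* Values of [g]-adic expansions: [m] digits give [q^(G m)] distinct elements of [dgr] at most
   [K (dgr g)^m], where [dgr g = q^s]. *)
pose bseq := foldr (fun x b => sel0 x + g * b) 0.
pose in1 (t : seq (mod_quot (A : set (res_scalars iota)))) := forall x, x \in t -> cls 1 x.
have in1c x t : in1 (x :: t) -> cls 1 x /\ in1 t.
  move=> h; split; first by apply: h; rewrite mem_head.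
  by move=> y yt; apply: h; rewrite inE yt orbT.
have Abseq t : in1 t -> A (bseq t).
  elim: t => [_|x t IH /in1c[x1 t1]] /=; first exact: Areg0.
  by apply: AregD; [case: (sel0P _ x1) | apply: AregM => //; exact: IH].
have bseq_inj t t' : size t = size t' -> in1 t -> in1 t' -> bseq t = bseq t' -> t = t'.
  elim: t t' => [|x t IH] [|x' t'] //= [st] /in1c[x1 t1] /in1c[x1' t1'] E.
  have [Ax xE] := sel0P _ x1; have [Ax' xE'] := sel0P _ x1'.
  have At := Abseq _ t1; have At' := Abseq _ t1'.
  have xx : x = x'.
    rewrite -xE -xE'; apply/prA_eq.
    have -> : sel0 x * 1 / g - sel0 x' * 1 / g = bseq t' - bseq t.
      apply: (mulfI g0); have -> : g * (sel0 x * 1 / g - sel0 x' * 1 / g) = sel0 x - sel0 x'.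
        by field; exact: g0.
      have -> : sel0 x = sel0 x' + g * bseq t' - g * bseq t by rewrite -E addrK.
      by ring.
    exact: AregB.
  rewrite xx; congr (_ :: _); apply: IH => //.
  by move: E; rewrite xx => /addrI/(mulfI g0).
pose K := (\max_(x <- enumset (cls 1)) dgr (sel0 x)).+1.
have selK x : cls 1 x -> (dgr (sel0 x) <= K)%N.
  move=> x1; apply: leqW; rewrite (big_rem x) ?leq_maxl //.
  exact/enumsetP.
have bseqK t : in1 t -> (dgr (bseq t) <= K * dgr g ^ size t)%N.
  elim: t => [_|x t IH /in1c[x1 t1]]; first by rewrite dgr0.
  have [Ax _] := sel0P _ x1; have At := Abseq _ t1.
  apply: (leq_trans (dgrD Ax (AregM Ag At))).
  rewrite geq_max (leq_trans (selK _ x1)) /=; last first.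
    by rewrite leq_pmulr // expn_gt0 D1.
  by rewrite dgrM // expnS mulnCA leq_mul2l IH ?orbT.
(* There are more expansions than strings of [n] digits. Two expansions with the same string have a
   difference to which [deep_dgr] applies and whose [dgr] is at most [q^(K + s m)]. *)
have key n m : (f * n < G * m)%N -> (n * e <= K + s * m)%N.
  move=> nm.
  have in1t (t : m.-tuple (fset_set (cls 1))) : in1 [seq val x | x <- t].
    move=> _ /mapP[x _ ->]; have := valP x; rewrite in_fset_set // inE; exact.
  have /choice[dig digP] : forall t : m.-tuple (fset_set (cls 1)),
      exists d : {ffun 'I_n -> fset_set (cls c)},
      forall i, val (d i) = prA (iter i step (bseq [seq val x | x <- t]) * c / g).
    move=> t.
    have mem i : prA (iter i step (bseq [seq val x | x <- t]) * c / g) \in fset_set (cls c).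
      rewrite in_fset_set // inE; apply: cls_mem; apply: Astep; exact: Abseq.
    by exists [ffun i : 'I_n => FSetSub (mem i)] => i; rewrite ffunE.
  have : ~~ injectiveb dig.
    apply/negP => /injectiveP inj; have := leq_card _ inj.
    rewrite card_tuple card_ffun card_ord -!cardfE.
    rewrite -[#|` fset_set (cls 1)|]/(size (enumset (cls 1))) GE.
    rewrite -[#|` fset_set (cls c)|]/(size (enumset (cls c))) fE.
    by rewrite -!expnM leq_exp2l // leqNgt nm.
  move=> /injectivePn[t [t' tt' E]].
  set b := bseq [seq val x | x <- t]; set b' := bseq [seq val x | x <- t'].
  have Ab : A b by exact: Abseq.
  have Ab' : A b' by exact: Abseq.
  have bb' : b - b' != 0.
    rewrite subr_eq0; apply: contraNneq tt' => /bseq_inj H; apply/eqP/val_inj.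
    by apply: (inj_map val_inj); apply: H => //; rewrite !size_map !size_tuple.
  have Abb : A (b - b') by exact: AregB.
  have [d dE] := dgr_expq Abb bb'.
  have := deep_dgr sc Ap Au pE nu eE (AregB (Astep b n Ab) (Astep b' n Ab')) Abb bb' _ dE.
  move=> /(_ n) H.
  apply: (@leq_trans d).
    apply: H; apply: same => // i lt; rewrite -(digP t (Ordinal lt)) -(digP t' (Ordinal lt)).
    by rewrite E.
  have : (q ^ d <= K * q ^ (s * m))%N.
    rewrite -dE expnM -sE -dgr_g.
    have bK : (dgr b <= K * dgr g ^ m)%N.
      by have := bseqK _ (in1t t); rewrite size_map size_tuple.
    have bK' : (dgr b' <= K * dgr g ^ m)%N.
      by have := bseqK _ (in1t t'); rewrite size_map size_tuple.
    apply: (leq_trans (dgrD Ab (AregN Ab'))).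
    by rewrite dgrN // geq_max bK.
  move=> H'; rewrite -(leq_exp2l _ _ qg1); apply: (leq_trans H').
  by rewrite expnD leq_mul2r (ltnW (ltn_expl _ qg1)) orbT.
have G0 : (0 < G)%N.
  rewrite lt0n; apply/eqP => G0; move: GE; rewrite G0 expn0 => G1.
  have : (2 <= size (enumset (cls 1)))%N; last by rewrite G1.
  apply: (@uniq_leq_size _ [:: 0; prA g^-1]) => [|x].
    rewrite /= inE andbT eq_sym; apply/negP => /eqP/prA_eq0; exact: gnu.
  rewrite !inE => /orP[]/eqP ->; apply/enumsetP => //.
    by exists 0; [exact: Areg0 | rewrite !mul0r prA0].
  by exists 1; rewrite ?mulr1 ?div1r.
rewrite leqNgt; apply/negP => lt.
(* With [n = (K+s+1) G] and [m = (K+s+1) f + 1], [key] gives [(K+s+1) e G <= K + s + (K+s+1) f s],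
   which is less than [(K+s+1) (f s + 1)]: the large common factor absorbs the constant [K]. *)
have cond : (f * ((K + s).+1 * G) < G * ((K + s).+1 * f).+1)%N by nia.
have H := key _ _ cond.
have : ((K + s).+1 * (f * s).+1 <= (K + s).+1 * (e * G))%N by rewrite leq_mul2l lt.
by move: H; nia.
Qed.

(** * Free complements of S in V_N *)

Section Span.
Variables (k : nat) (vs : 'I_k -> tor).

Definition spanned : set tor := [set v | exists v' a, [/\ S v', forall i, A (a i)
  & v = v' + \sum_(i < k) act (a i) (vs i)]].

Definition independent : Prop := (forall i, VN (vs i)) /\
  forall v' a, S v' -> (forall i, A (a i)) -> v' + \sum_(i < k) act (a i) (vs i) = 0 ->
    v' = 0 /\ forall i, A (a i / g).

Hypothesis ind : independent.

Lemma spanned_VN : spanned `<=` VN.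
Proof.
have [Vvs _] := ind; move=> _ [v' [a [Sv' Aa ->]]].
apply: (submodD subVN); first exact: S_VN.
by apply: (submod_sum subVN) => i _; apply: (VN_act g0 NE) => //; exact: Vvs.
Qed.

Lemma spannedD u v : spanned u -> spanned v -> spanned (u + v).
Proof.
move=> [u' [a [Su' Aa ->]]] [v' [b [Sv' Ab ->]]].
exists (u' + v'), (fun i => a i + b i); split.
- exact: (submodD subS).
- by move=> i; exact: AregD.
- rewrite addrACA -big_split /=; congr (_ + _); apply: eq_bigr => i _.
  by rewrite actDl.
Qed.

Lemma spanned_act a v : A a -> spanned v -> spanned (act a v).
Proof.
move=> Aa [v' [b [Sv' Ab ->]]]; exists (act a v'), (fun i => a * b i); split.
- exact: S_act.
- by move=> i; exact: AregM.
- by rewrite actD // act_sum //; congr (_ + _); apply: eq_bigr => i _; rewrite actM.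
Qed.

Lemma spannedN v : spanned v -> spanned (- v).
Proof.
have A1 := @Areg1 Fq F iota infty.
move=> sv; have := spanned_act (AregN A1) sv.
by rewrite actNl // act1.
Qed.

Lemma size_spanned_bound c (X : set tor) (Y : set tor) : A c -> X `<=` S -> finite_set X ->
  finite_set Y ->
  (forall v, Y v -> exists v' a, [/\ X v', forall i, A (a i)
     & v = v' + \sum_(i < k) act (a i * c) (vs i)]) ->
  (size (enumset Y) <= size (enumset X) * size (enumset (cls c)) ^ k)%N.
Proof.
move=> Ac XS fX fY YP; have [sel selP] := exists_sel c; have fc := fcls Ac.
have [Vvs _] := ind.
pose f (x : fset_set X * {ffun 'I_k -> fset_set (cls c)}) : tor :=
  val x.1 + \sum_(i < k) act (sel (val (x.2 i)) * c) (vs i).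
have -> : (size (enumset X) * size (enumset (cls c)) ^ k)%N =
    size [seq f x | x : fset_set X * {ffun 'I_k -> fset_set (cls c)}].
  by rewrite size_map -cardE card_prod card_ffun card_ord -!cardfE.
apply: uniq_leq_size => [|v /enumsetP Yv]; first exact: uniq_enumset.
have [v' [a [Xv' Aa vE]]] := YP _ (Yv fY).
have Xv'' : v' \in fset_set X by rewrite in_fset_set // inE.
have mem i : prA (a i * c / g) \in fset_set (cls c).
  by rewrite in_fset_set // inE; exact: cls_mem.
apply/mapP; exists (FSetSub Xv'', [ffun i => FSetSub (mem i)]); first by rewrite mem_enum.
rewrite vE /f /=; congr (_ + _); apply: eq_bigr => i _; rewrite ffunE /=.
have [As sE] := selP _ (cls_mem c (Aa i)).
apply: (act_mod Ag g0 NE) => //; try exact: AregM.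
by move/prA_eq: (esym sE); rewrite -mulrBl.
Qed.

Lemma size_spanned_ge : (size (enumset S) * size (enumset (cls 1)) ^ k <= size (enumset spanned))%N.
Proof.
have A1 := @Areg1 Fq F iota infty; have f1 := fcls A1.
have fS := finite_S; have [sel selP] := exists_sel 1; have [Vvs indP] := ind.
have fsp : finite_set spanned by apply: sub_finite_set finVN; exact: spanned_VN.
pose f (x : fset_set S * {ffun 'I_k -> fset_set (cls 1)}) : tor :=
  val x.1 + \sum_(i < k) act (sel (val (x.2 i))) (vs i).
have -> : (size (enumset S) * size (enumset (cls 1)) ^ k)%N =
    size [seq f x | x : fset_set S * {ffun 'I_k -> fset_set (cls 1)}].
  by rewrite size_map -cardE card_prod card_ffun card_ord -!cardfE.
have Sval (x : fset_set S) : S (val x).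
  by have := valP x; rewrite in_fset_set // inE; exact.
have cval (x : fset_set (cls 1)) : cls 1 (val x).
  by have := valP x; rewrite in_fset_set // inE; exact.
have Asel (x : fset_set (cls 1)) : A (sel (val x)) by case: (selP _ (cval x)).
apply: uniq_leq_size => [|_ /mapP[x _ ->]]; last first.
  apply/enumsetP => //; exists (val x.1), (fun i => sel (val (x.2 i))); split=> //.
rewrite map_inj_uniq ?enum_uniq // => -[x h] [x' h'] E.
have [|||/eqP dx H] := indP (val x - val x') (fun i => sel (val (h i)) - sel (val (h' i))).
- exact: (submodB subS).
- by move=> i; exact: AregB.
- have -> : \sum_(i < k) act (sel (val (h i)) - sel (val (h' i))) (vs i) =
      \sum_(i < k) act (sel (val (h i))) (vs i) - \sum_(i < k) act (sel (val (h' i))) (vs i).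
    by rewrite -sumrB; apply: eq_bigr => i _; rewrite actBl.
  by rewrite addrACA -opprD; apply/eqP; rewrite subr_eq0; apply/eqP.
move: dx; rewrite subr_eq0 => /eqP/val_inj ->; congr (_, _); apply/ffunP => i; apply: val_inj.
have [_ <-] := selP _ (cval (h i)); have [_ <-] := selP _ (cval (h' i)).
by apply/prA_eq; rewrite -mulrBl -mulrBl mulr1.
Qed.

(* Counting with the torsion bound: multiplication by a simple element detects
   whether S and the vs already fill V_N. *)
Lemma simple_spanned c : simple_mod c -> (forall v, VN v -> spanned (act c v)) ->
  VN `<=` spanned.
Proof.
move=> sc cV; have [Ac nAc _] := sc; have A1 := @Areg1 Fq F iota infty.
have [Vvs indP] := ind.
have fc := fcls Ac; have f1 := fcls A1.
have [e eE] := size_enumset_submod (sub_Sann c) (finite_Sann c).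
have [f fE] := size_enumset_submod (sub_cls iota infty g c) fc.
have [G GE] := size_enumset_submod (sub_cls iota infty g 1) f1.
have [s sE] := size_enumset_submod subS finite_S.
have bound := torsion_bound sc eE fE GE sE.
have qg1 := q_gt1 Fq.
have f0 : (0 < f)%N.
  rewrite lt0n; apply/eqP => f0; move: fE; rewrite f0 expn0 => c1.
  have : (2 <= size (enumset (cls c)))%N; last by rewrite c1.
  apply: (@uniq_leq_size _ [:: 0; prA (c / g)]) => [|x].
    by rewrite /= inE andbT eq_sym; apply/negP => /eqP/prA_eq0.
  rewrite !inE => /orP[]/eqP ->; apply/enumsetP => //.
    by exists 0; [exact: Areg0 | rewrite !mul0r prA0].
  by exists 1; rewrite ?mul1r.
have cVE := act_pow g0 r NE Ac.
have szcV : size (enumset [set act c v | v in VN]) = (q ^ (f * r))%N.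
  by rewrite cVE size_ffun_pow // fE expnM.
have le1 : (q ^ (f * r) <= q ^ e * (q ^ f) ^ k)%N.
  rewrite -szcV -eE -fE; apply: size_spanned_bound => //.
  - by move=> v [].
  - exact: finite_Sann.
  - by rewrite cVE; exact: finite_ffun_pow.
  move=> _ [v Vv <-]; have [v' [a [Sv' Aa cvE]]] := cV _ Vv.
  (* What kills [c] kills [c v], hence by independence its component in [S] and its coefficients,
     which are therefore multiples of [c] by [simple_colon]. This bounds the cardinality of [c V_N]
     by [q^(e + f k)]. *)
  have ann x : A x -> A (x * c / g) -> act x v' = 0 /\ forall i, A (x * a i / g).
    move=> Ax xc; apply: indP; [exact: S_act | by move=> i; exact: AregM |].
    transitivity (act x (act c v)).
      by rewrite cvE actD // act_sum //; congr (_ + _); apply: eq_bigr => i _; rewrite actM.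
    by rewrite -actM // -[x * c](divfK g0) (act_gM Ag g0 NE).
  have /choice2[b bP] : forall i, exists2 b, A b & A ((a i - b * c) / g).
    by move=> i; apply: (simple_colon hF Ag g0 sc) => // x Ax /(ann _ Ax)[].
  exists v', b; split.
  - by split=> // x Ax /(ann _ Ax)[].
  - by move=> i; case: (bP i).
  - rewrite cvE; congr (_ + _); apply: eq_bigr => i _; have [Ab ab] := bP i.
    by apply: (act_mod Ag g0 NE) => //; exact: AregM.
have fsp : finite_set spanned by apply: sub_finite_set finVN; exact: spanned_VN.
(* Multiplying [f r <= e + f k] by [G] and using [e G <= f s] gives [G r <= s + G k] after division
   by [f]. *)
have le2 : (size (enumset VN) <= size (enumset spanned))%N.
  apply: leq_trans size_spanned_ge.
  rewrite (VN_pow g0 r NE) size_ffun_pow // GE sE -!expnM -expnD leq_exp2l //.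
  move: le1; rewrite -expnM -expnD leq_exp2l // => le1.
  rewrite -(leq_pmul2l f0); have := leq_mul (leqnn G) le1; move: bound; nia.
have sub : {subset enumset spanned <= enumset VN}.
  by move=> v /enumsetP h; apply/enumsetP => //; apply: spanned_VN; exact: h.
have [_ eqE] := uniq_min_size (uniq_enumset _) sub le2.
by move=> v Vv; apply/(enumsetP v fsp); rewrite eqE; apply/(enumsetP v finVN).
Qed.

(** By [simple_spanned] each simple [c] has a [u] with [c u] outside the span. One [v] serving all
    simple classes is built by successive corrections, as in the Chinese remainder theorem. An [a]
    not divisible by [g] has a simple multiple, so [a v] is outside the span too. *)
Lemma exists_free : ~ VN `<=` spanned -> exists2 v, VN v &
  forall a, A a -> spanned (act a v) -> A (a / g).
Proof.
move=> nsp.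
have wit c : simple_mod c -> exists2 u, VN u & ~ spanned (act c u).
  move=> sc; apply: contrapT => no; apply: nsp; apply: (simple_spanned sc) => v Vv.
  by apply: contrapT => h; apply: no; exists v.
have avoid (ws : seq (mod_quot (A : set (res_scalars iota)))) : exists2 v, VN v &
    forall c, simple_mod c -> prA (c / g) \in ws -> ~ spanned (act c v).
  elim: ws => [|x ws [v Vv vP]]; first by exists 0; [exact: (submod0 subVN) |].
  have sameact c c' u : A c -> A c' -> prA (c / g) = prA (c' / g) -> VN u -> act c u = act c' u.
    move=> Ac Ac' /prA_eq E Vu; apply: (act_mod Ag g0 NE) => //.
    by rewrite mulrBl.
  case: (pselect (exists c0, [/\ simple_mod c0, prA (c0 / g) = x & spanned (act c0 v)]));
    last first.
    move=> no; exists v => // c sc; rewrite inE => /orP[/eqP cx|]; last exact: vP.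
    by move=> cv; apply: no; exists c.
  move=> [c0 [sc0 c0x c0v]]; have [Ac0 nAc0 c0P] := sc0.
  have [u Vu nu] := wit _ sc0.
  have prime e e' : A e -> A e' -> ~ A (e * c0 / g) -> ~ A (e' * c0 / g) ->
      ~ A (e * e' * c0 / g).
    move=> Ae Ae' ne ne' h; have [y Ay yE] := c0P _ Ae ne; apply: ne'.
    have -> : e' * c0 / g = y * (e * e' * c0 / g) - e' * ((y * e * c0 - c0) / g) by ring.
    by apply: AregB; exact: AregM.
  (* If every element killing [c'] killed [c0], then [c0] and [c'] would be multiples of each other
     modulo [g], and [c' v] would be spanned along with [c0 v]. *)
  have one x' : x' \in ws -> exists e, [/\ A e, ~ A (e * c0 / g) &
      forall c', simple_mod c' -> prA (c' / g) = x' -> A (e * c' / g)].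
    move=> x'ws; case: (pselect (exists c', simple_mod c' /\ prA (c' / g) = x')); last first.
      move=> no; exists 1; split; [exact: Areg1 | by rewrite mul1r |].
      by move=> c' sc' c'x; case: no; exists c'.
    move=> [c' [sc' c'x]]; have [Ac' nAc' c'P] := sc'.
    have [e [Ae ec' ec0]] : exists e, [/\ A e, A (e * c' / g) & ~ A (e * c0 / g)].
      apply: contrapT => no.
      have [|b Ab bE] := simple_colon hF Ag g0 sc' Ac0.
        by move=> p Ap pc'; apply: contrapT => h; apply: no; exists p.
      have nb : ~ A (b * c' / g).
        move=> h; apply: nAc0; have -> : c0 / g = (c0 - b * c') / g + b * c' / g by ring.
        exact: AregD.
      have [y Ay yE] := c'P _ Ab nb.
      apply: (vP c') => //; first by rewrite c'x.
      have -> : act c' v = act (y * c0) v.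
        apply: (act_mod Ag g0 NE) => //; first exact: AregM.
        have -> : (c' - y * c0) / g = - ((y * b * c' - c') / g) - y * ((c0 - b * c') / g) by ring.
        by apply: AregB; [exact: AregN | exact: AregM].
      by rewrite actM //; exact: spanned_act.
    exists e; split=> // c'' sc'' c''x; have [Ac'' _ _] := sc''.
    have /prA_eq h : prA (c'' / g) = prA (c' / g) by rewrite c'x.
    have -> : e * c'' / g = e * c' / g + e * (c'' / g - c' / g) by ring.
    by apply: AregD => //; exact: AregM.
  have [e [Ae ec0 eP]] : exists e, [/\ A e, ~ A (e * c0 / g) &
      forall c', simple_mod c' -> prA (c' / g) \in ws -> A (e * c' / g)].
    elim: {vP} ws one => [|x' ws IH] one.
      by exists 1; split; [exact: Areg1 | rewrite mul1r |].
    have [e1 [Ae1 e1c e1P]] := one x' (mem_head _ _).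
    have [|e2 [Ae2 e2c e2P]] := IH.
      by move=> y yws; apply: one; rewrite inE yws orbT.
    exists (e1 * e2); split; [exact: AregM | exact: prime |].
    move=> c' sc'; rewrite inE => /orP[/eqP|] h.
      have -> : e1 * e2 * c' / g = e2 * (e1 * c' / g) by ring.
      by apply: AregM => //; exact: e1P.
    have -> : e1 * e2 * c' / g = e1 * (e2 * c' / g) by ring.
    by apply: AregM => //; exact: e2P.
  have Veu := VN_act g0 NE Ae Vu.
  (* [e] kills the classes already treated, so their conditions on [v] persist; it is invertible
     modulo the annihilator of [c0], so [c0 e u] is outside the span while [c0 v] is inside. *)
  exists (v + act e u); first exact: (submodD subVN).
  move=> c sc; have [Ac _ _] := sc; rewrite inE => /orP[/eqP cx|cws]; last first.
    rewrite actD // -actM // mulrC -[e * c](divfK g0) (act_gM Ag g0 NE) ?addr0 //.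
      exact: vP.
    exact: eP.
  rewrite (sameact c c0) ?c0x //; last exact: (submodD subVN).
  rewrite actD // => h.
  have {}h : spanned (act (c0 * e) u).
    rewrite actM // -[act c0 _](addKr (act c0 v)); apply: spannedD => //.
    exact: spannedN.
  have [y Ay yE] := c0P _ Ae ec0; apply: nu.
  have -> : act c0 u = act (y * (c0 * e)) u.
    apply: (act_mod Ag g0 NE) => //; first by apply: AregM => //; exact: AregM.
    have -> : (c0 - y * (c0 * e)) / g = - ((y * e * c0 - c0) / g) by ring.
    exact: AregN.
  by rewrite actM //; [exact: spanned_act | exact: AregM].
have f1 := fcls (@Areg1 Fq F iota infty).
have [v Vv vP] := avoid (enumset (cls 1)); exists v => // a Aa av.
apply: contrapT => na; have [x Ax sxa] := simple_multiple hF Ag g0 Aa na.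
apply: (vP _ sxa); last by rewrite actM //; exact: spanned_act.
by apply/enumsetP => //; exists (x * a); [exact: AregM | rewrite mulr1].
Qed.

End Span.

(** Adding free vectors must stop: [k] independent ones produce at least [|A/(g)|^k] elements of the
    finite [V_N]. *)
Lemma exists_complement : exists k (vs : 'I_k -> tor), independent vs /\ VN `<=` spanned vs.
Proof.
have A1 := @Areg1 Fq F iota infty; have f1 := fcls A1.
have q1 : (1 < size (enumset (cls 1)))%N.
  apply: (@uniq_leq_size _ [:: 0; prA g^-1]) => [|x].
    rewrite /= inE andbT eq_sym; apply/negP => /eqP/prA_eq0; exact: gnu.
  rewrite !inE => /orP[]/eqP ->; apply/enumsetP => //.
    by exists 0; [exact: Areg0 | rewrite !mul0r prA0].
  by exists 1; rewrite ?mulr1 ?div1r.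
apply: contrapT => no.
have grow k : exists vs : 'I_k -> tor, independent vs.
  elim: k => [|k [vs ind]].
    exists (fun=> 0); split=> [[]//|v' a Sv' Aa]; rewrite big_ord0 addr0 => ->.
    by split=> // -[].
  case: (pselect (VN `<=` spanned vs)) => [sp|nsp]; first by case: no; exists k, vs.
  have [v Vv vP] := exists_free ind nsp; have [Vvs indP] := ind.
  exists (fun i => if unlift ord_max i is Some l then vs l else v).
  split=> [i|v' a Sv' Aa]; first by case: (unlift ord_max i).
  rewrite big_ord_recr /= unlift_none.
  under eq_bigr => i _.
    have -> : unlift ord_max (widen_ord (leqnSn k) i) = Some i.
      have -> : widen_ord (leqnSn k) i = lift ord_max i
        by apply: val_inj; rewrite /= /bump leqNgt ltn_ord.
      exact: liftK.
    over.
  move=> E; have av : act (a ord_max) v =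
      - (v' + \sum_(i < k) act (a (widen_ord (leqnSn k) i)) (vs i)).
    by apply/eqP; rewrite -addr_eq0 addrC -addrA; apply/eqP.
  have sp : spanned vs (act (a ord_max) v).
    rewrite av; apply: spannedN => //.
    by exists v', (fun i => a (widen_ord (leqnSn k) i)).
  have am := vP _ (Aa _) sp.
  have av0 : act (a ord_max) v = 0.
    by rewrite -[a ord_max](divfK g0) (act_gM Ag g0 NE).
  have [|||v'0 aP] := indP v' (fun i => a (widen_ord (leqnSn k) i)) => //.
    by rewrite -[RHS]E av0 addr0.
  split=> // i; case: (unliftP ord_max i) => [l ->|->//].
  have -> : lift ord_max l = widen_ord (leqnSn k) l
        by apply: val_inj; rewrite /= /bump leqNgt ltn_ord.
  exact: aP.
pose M := size (enumset VN).
have [vs ind] := grow M.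
have fsp : finite_set (spanned vs) by apply: sub_finite_set finVN; exact: spanned_VN.
have le : (size (enumset (spanned vs)) <= M)%N.
  apply: uniq_leq_size => [|v /enumsetP h]; first exact: uniq_enumset.
  by apply/enumsetP => //; apply: (spanned_VN ind); exact: h.
have := leq_trans (size_spanned_ge ind) le.
have S0 : (0 < size (enumset S))%N.
  by have /SP := submod0 subS; case: (enumset S).
rewrite leqNgt (leq_trans (ltn_expl M q1)) //.
by rewrite leq_pmull.
Qed.

(** * The lattice uniformization *)

Section Lattice.
Variables (k : nat) (vs : 'I_k -> tor).
Hypotheses (ind : independent vs) (full : VN `<=` spanned vs).
Local Notation K := {fraction {poly {poly L}}}.
Local Notation fr := (@frL L).
Local Notation T := (@frT L).
Local Notation Va := (@Va Fq F iota infty r).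
Local Notation Yt := (tor * {ffun 'I_k -> res_scalars iota})%type.

Definition inY : set Yt := [set y : Yt | S y.1 /\ forall i : 'I_k, A (y.2 i)].

(* The exponents q i + 1 keep the degrees of the summands distinct. *)
Definition xi (y : Yt) : {poly L} :=
  (w y.1)%:P + \sum_(i < k) (phi (y.2 i) \Po 'X^((q * i).+1)).

Definition prY (y : Yt) : tor := y.1 + \sum_(i < k) act (y.2 i) (vs i).

Definition mulY (a : F) (y : Yt) : Yt := (act a y.1, [ffun i => a * (y.2 i : F) : F]).

Lemma sub_inY : is_submodule inY.
Proof.
split.
  split=> [|i]; first exact: (submod0 subS).
  by rewrite ffunE; exact: Areg0.
move=> a x y [Sx Ax] [Sy Ay]; split; first by case: subS => _; apply.
move=> i; rewrite !ffunE; apply: AregD => //.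
by apply: AregM => //; exact: Areg_const.
Qed.

Lemma inY_mul a y : A a -> inY y -> inY (mulY a y).
Proof.
move=> Aa [Sy Ay]; split; first exact: S_act.
by move=> i; rewrite ffunE; exact: AregM.
Qed.

Lemma phiZ a c : A c -> phi (iota a * c) = kap a *: phi c.
Proof.
move=> Ac; rewrite phiM ?phi_const; [|exact: Areg_const|done].
by rewrite comp_polyZ comp_polyX.
Qed.

Lemma xiD y y' : inY y -> inY y' -> xi (y + y') = xi y + xi y'.
Proof.
move=> [Sy Ay] [Sy' Ay']; rewrite /xi wD // polyCD addrACA -big_split /=.
congr (_ + _); apply: eq_bigr => i _.
by rewrite ffunE phiD // comp_polyD.
Qed.

Lemma xiZ a y : inY y -> xi (a *: y) = kap a *: xi y.
Proof.
move=> [Sy Ay]; rewrite /xi wZ // scalerDr scaler_sumr polyCM mul_polyC.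
congr (_ + _); apply: eq_bigr => i _.
by rewrite ffunE -comp_polyZ -phiZ.
Qed.

Lemma xiN y : inY y -> xi (- y) = - xi y.
Proof. by move=> Yy; rewrite -scaleN1r xiZ // rmorphN1 scaleN1r. Qed.

Lemma xiB y y' : inY y -> inY y' -> xi (y - y') = xi y - xi y'.
Proof. by move=> Yy Yy'; rewrite xiD ?xiN //; exact: (submodN sub_inY). Qed.

Lemma xi_mul a y : A a -> inY y -> xi (mulY a y) = phi a \Po xi y.
Proof.
move=> Aa [Sy Ay]; have [c cE] := phi_lin Aa.
rewrite /xi /= cE (linp_compD kap) (linp_comp_sum kap) -cE.
congr (_ + _); first by rewrite comp_polyCr phi_w.
by apply: eq_bigr => i _; rewrite ffunE phiM // comp_polyA.
Qed.

(** After cancelling the smaller power of [q], a remaining factor [q] on one side would contradict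
    the residue 1 of [q i + 1] modulo [q]. *)
Lemma expq_inj d d' i i' :
  (q ^ d * (q * i).+1 = q ^ d' * (q * i').+1)%N -> i = i'.
Proof.
have q1 := q_gt1 Fq; have q0 : (0 < q)%N by exact: ltnW.
wlog le : d d' i i' / (d <= d')%N.
  move=> H E; case: (leqP d d') => [le|/ltnW le]; first exact: (H d d').
  by apply/esym; apply: (H d' d).
rewrite -(subnK le) [(d' - d + d)%N]addnC expnD -mulnA => /eqP.
rewrite eqn_pmul2l ?expn_gt0 ?q0 //; case: (d' - d)%N => [|m] /eqP.
  by rewrite mul1n => -[] /eqP; rewrite eqn_pmul2l // => /eqP.
move=> /(congr1 (fun x => x %% q)%N); rewrite expnS -mulnA modnMr.
by rewrite -addn1 mulnC modnMDl modn_small.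
Qed.

(** The degrees of the non-zero summands are pairwise distinct by [expq_inj], so the highest one
    survives; it is positive, out of reach of the constant [w y.1]. *)
Lemma size_xi y i : inY y -> (y.2 i : F) != 0 ->
  (dgr (y.2 i) < size (xi y))%N /\ (1 < size (xi y))%N.
Proof.
move=> [Sy Ay] yi0.
pose D (l : 'I_k) := (dgr (y.2 l) * (q * l).+1)%N.
have [m m0 mmax] := @arg_maxnP _ i (fun l => (y.2 l : F) != 0) D yi0.
have szt (l : 'I_k) : (size (phi (y.2 l) \Po 'X^((q * l).+1))).-1 = D l.
  by rewrite size_comp_poly size_polyXn.
have D1 : (0 < D m)%N by rewrite muln_gt0 dgr_gt0.
have cm : (xi y)`_(D m) != 0.
  rewrite /xi coefD coefC -[(D m == 0)%N]negbK -lt0n D1 /= add0r coef_sum.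
  rewrite (bigD1 m) //= big1 ?addr0 => [|l lm].
    rewrite -szt -lead_coefE lead_coef_eq0 comp_poly_eq0 ?size_polyXn //.
    exact: phi_neq0.
  have [l0|l0] := eqVneq (y.2 l : F) 0.
    have -> : phi (y.2 l) = 0 by rewrite -phi0; congr phi.
    by rewrite comp_poly0 coef0.
  have lt : (D l < D m)%N.
    have le : (D l <= D m)%N := mmax l l0.
    rewrite ltn_neqAle le andbT; apply/eqP => E; move/eqP: lm; apply; move: E.
    have [d dE] := dgr_expq (Ay l) l0; have [d' dE'] := dgr_expq (Ay m) m0.
    by rewrite /D dE dE' => /expq_inj/val_inj.
  by rewrite nth_default //; move: lt; rewrite -(szt l); case: (size _).
have szm : (D m < size (xi y))%N.
  by rewrite ltnNge; apply: contraNN cm => h; rewrite nth_default.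
split; last exact: leq_ltn_trans D1 szm.
apply: leq_ltn_trans szm; apply: leq_trans (mmax i yi0).
by rewrite /D leq_pmulr.
Qed.

Lemma xi_eq0 y : inY y -> xi y = 0 -> y = 0.
Proof.
move=> Yy xi0; have [Sy Ay] := Yy.
have y20 i : (y.2 i : F) = 0.
  apply/eqP; apply: contraT => /(size_xi Yy)[_].
  by rewrite xi0 size_poly0.
have y1 : y.1 = 0.
  apply: w_eq0 => //; move: xi0; rewrite /xi big1 ?addr0 => [/polyC_inj //|i _].
  have -> : phi (y.2 i) = 0 by rewrite -phi0; congr phi; exact: y20.
  by rewrite comp_poly0.
case: y {Yy xi0 Sy Ay} y20 y1 => y1 y2 /= y20 ->; congr (_, _).
by apply/ffunP => i; rewrite ffunE; exact: y20.
Qed.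

Lemma prYD y y' : inY y -> inY y' -> prY (y + y') = prY y + prY y'.
Proof.
move=> [Sy Ay] [Sy' Ay']; rewrite /prY addrACA -big_split /=.
congr (_ + _); apply: eq_bigr => i _.
by rewrite ffunE actDl.
Qed.

Lemma prYZ a y : inY y -> prY (a *: y) = a *: prY y.
Proof.
move=> [Sy Ay]; rewrite /prY scalerDr scaler_sumr /=.
congr (_ + _); apply: eq_bigr => i _.
rewrite ffunE -act_const -actM //; exact: Areg_const.
Qed.

Lemma prYB y y' : inY y -> inY y' -> prY (y - y') = prY y - prY y'.
Proof.
move=> Yy Yy'; have := prYZ (-1) Yy'; rewrite !scaleN1r => <-.
by rewrite prYD //; exact: (submodN sub_inY).
Qed.

Lemma prY_mul a y : A a -> inY y -> prY (mulY a y) = act a (prY y).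
Proof.
move=> Aa [Sy Ay]; rewrite /prY actD // act_sum //=.
by congr (_ + _); apply: eq_bigr => i _; rewrite ffunE actM.
Qed.

Lemma prY_surj v : VN v -> exists2 y, inY y & prY y = v.
Proof.
move=> /full[v' [a [Sv' Aa ->]]]; exists (v', [ffun i => a i : F]).
  by split=> // i; rewrite ffunE.
by rewrite /prY /=; congr (_ + _); apply: eq_bigr => i _; rewrite ffunE.
Qed.

(* An element of Y lying over a multiple is itself a multiple, since the kernel
   of Y -> V_N is divisible by every divisor of N. *)
Lemma mulY_lift a z v : Div a -> inY z -> VN v -> prY z = act a v ->
  exists2 y, inY y & mulY a y = z.
Proof.
move=> Da [Sz Az] Vv; have a0 := Div_neq0 g0 NE Da.
have [Aa [b Ab abE]] := (DivP NE a).1 Da.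
have b0 : b != 0 by apply: contra_neq g0 => b0; rewrite -abE b0 mulr0.
have [y [Sy Ay] <-] := prY_surj Vv; rewrite -prY_mul // => E.
have [Vvs indP] := ind.
have Yay : inY (mulY a y) by exact: inY_mul.
have [|||d0 dA] := indP (z.1 - (mulY a y).1) (fun i => (z.2 i : F) - (mulY a y).2 i).
- by apply: (submodB subS) => //; case: Yay.
- by move=> i; apply: AregB; [exact: Az | case: Yay].
- by move/eqP: E; rewrite -subr_eq0 -prYB // => /eqP E; apply: etrans E;
    rewrite /prY; congr (_ + _); apply: eq_bigr => i _; rewrite !ffunE.
have cA i : A ((z.2 i : F) / a).
  have -> : (z.2 i : F) / a = b * (((z.2 i : F) - a * (y.2 i : F)) / g) + (y.2 i : F).
    by rewrite -abE; field; rewrite a0 b0.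
  apply: AregD; last exact: Ay.
  by apply: AregM => //; have := dA i; rewrite ffunE.
exists (y.1, [ffun i => (z.2 i : F) / a : F]).
  by split=> // i; rewrite ffunE; exact: cA.
case: z {Sz Az E dA cA} d0 => z1 z2 /= /eqP; rewrite subr_eq0 => /eqP ->.
congr (_, _); apply/ffunP => i; rewrite !ffunE /=.
by rewrite mulrC divfK.
Qed.

(** A non-zero multiple of [g^(n+1)] has [dgr] above [n], so elements of [dgr] at most [n] are
    separated by their classes modulo [g^(n+1)], which are finite in number. *)
Lemma finite_dgr n : finite_set [set c | A c /\ (dgr c <= n)%N].
Proof.
have D1 := dgr_g_gt1; pose h := g ^+ n.+1.
have Ah : A h by exact: AregX.
have h0 : h != 0 by exact: expf_neq0.
pose R : set (mod_quot (A : set (res_scalars iota))) := [set prA (a * 1 / h) | a in A].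
have fin : finite_set R := finite_cls1 hF Ah h0.
have /choice[sel selP] : forall x : mod_quot (A : set (res_scalars iota)), exists c,
    (exists2 c', A c' /\ (dgr c' <= n)%N & prA (c' / h) = x) ->
    [/\ A c, (dgr c <= n)%N & prA (c / h) = x].
  move=> x; case: (pselect (exists2 c', A c' /\ (dgr c' <= n)%N & prA (c' / h) = x)).
    by move=> [c [? ?] ?]; exists c.
  by move=> ?; exists 0.
apply: (finite_set_seq (s := [seq sel x | x <- enumset R])).
move=> c [Ac cn]; apply/mapP; exists (prA (c / h)).
  by apply/enumsetP => //; exists c; rewrite ?mulr1.
have [|As sn /prA_eq] := selP (prA (c / h)); first by exists c.
rewrite -mulrBl => Ad; apply/eqP; rewrite eq_sym -subr_eq0; apply: contraT => d0.
set d := sel _ - c in Ad d0 *.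
have Adc : A d by exact: AregB.
have dn : (dgr d <= n)%N.
  apply: leq_trans (dgrD As (AregN Ac)) _.
  by rewrite dgrN // geq_max sn.
have dh0 : d / h != 0 by rewrite mulf_neq0 // invr_neq0.
have := dgrM Ah Ad; rewrite mulrC divfK // dgrX // => dE.
have : (n < dgr d)%N.
  rewrite dE (leq_trans (ltn_expl n D1)) //.
  apply: leq_trans (leq_pmulr _ (dgr_gt0 Ad dh0)).
  by rewrite leq_exp2l.
by rewrite ltnNge dn.
Qed.

Lemma finite_size_xi n : finite_set [set y | inY y /\ (size (xi y) <= n)%N].
Proof.
pose X : set F := [set c | A c /\ (dgr c <= n)%N].
have fX : finite_set X by exact: finite_dgr.
have fP := finite_ffun_pow k fX.
apply: (@finite_set_seq _ _ [seq ((x.1, x.2) : Yt) | x <-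
   [seq (v, f) | v <- enumset S, f <- enumset (ffun_pow (r := k) X)]]).
move=> y [Yy yn]; have [Sy Ay] := Yy.
apply/mapP; exists (y.1, y.2 : {ffun 'I_k -> F}); last by case: y {Yy yn Sy Ay}.
apply/allpairsP; exists (y.1, y.2 : {ffun 'I_k -> F}); split=> //=; first exact/SP.
apply/enumsetP => // i; split; first exact: Ay.
have [->|yi0] := eqVneq (y.2 i : F) 0; first by rewrite dgr0.
by have [lt _] := size_xi Yy yi0; apply: leq_trans yn; exact: ltnW.
Qed.

(** [F_q]-linearity of the lifts is what makes the truncated values exactly linear in [v]; it is
    arranged on a basis of [V_N]. *)
Lemma exists_section : exists sc : tor -> Yt,
  (forall v, VN v -> inY (sc v) /\ prY (sc v) = v) /\
  forall a u v, VN u -> VN v -> sc (a *: u + v) = a *: sc u + sc v.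
Proof.
set e := basis VN; have eb : is_basis VN e by exact: basisP.
have eV i : VN (lincomb (e := e) (delta_mx 0 i)) by case: eb.
have /choice2[y yP] : forall i : 'I_(size e), exists2 y, inY y &
    prY y = lincomb (e := e) (delta_mx 0 i).
  by move=> i; apply: prY_surj.
have lindelta i : lincomb (e := e) (delta_mx 0 i) = e`_i.
  rewrite /lincomb (bigD1 i) //= mxE !eqxx scale1r big1 ?addr0 // => l li.
  by rewrite mxE eqxx (negbTE li) scale0r.
have linD a (c d : 'rV[Fq]_(size e)) :
    lincomb (e := e) (a *: c + d) = a *: lincomb c + lincomb d.
  rewrite /lincomb scaler_sumr -big_split /=; apply: eq_bigr => i _.
  by rewrite !mxE scalerDl scalerA.
have coordsD a u v : VN u -> VN v -> coords VN (a *: u + v) = a *: coords VN u + coords VN v.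
  move=> Vu Vv; apply: (coords_uniq subVN finVN); rewrite linD.
  by rewrite -!(coordsP subVN finVN).
exists (fun v => \sum_i coords VN v 0 i *: y i); split=> [v Vv|a u v Vu Vv].
  have Ys : forall i, true -> inY (coords VN v 0 i *: y i).
    by move=> i _; apply: (submodZ sub_inY); case: (yP i).
  split; first exact: (submod_sum sub_inY).
  rewrite [RHS](coordsP subVN finVN Vv) /lincomb.
  have prY0 : prY 0 = 0 by have := prYZ 0 (submod0 sub_inY); rewrite !scale0r.
  have : inY (\sum_i coords VN v 0 i *: y i) /\ prY (\sum_i coords VN v 0 i *: y i) =
      \sum_i prY (coords VN v 0 i *: y i).
    elim/big_rec2: _ => [|i u z _ [Yz zE]]; first by split; [exact: (submod0 sub_inY) |].
    by split; [apply: (submodD sub_inY) => //; exact: Ys | rewrite prYD ?zE //; exact: Ys].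
  move=> [_ ->]; apply: eq_bigr => i _; have [Yi yE] := yP i.
  by rewrite prYZ // yE lindelta.
rewrite coordsD // scaler_sumr -big_split /=; apply: eq_bigr => i _.
by rewrite !mxE scalerDl scalerA.
Qed.

(** * Truncated lattices, their exponential functions and Eisenstein series *)

Definition Lam n : set Yt := [set y | [/\ inY y, prY y = 0 & (size (xi y) <= n)%N]].
Definition fib n v : set Yt := [set y | [/\ inY y, prY y = v & (size (xi y) <= n)%N]].

Lemma finite_fib n v : finite_set (fib n v).
Proof. by apply: sub_finite_set (finite_size_xi n) => y []. Qed.

Lemma finite_Lam n : finite_set (Lam n).
Proof. by apply: sub_finite_set (finite_size_xi n) => y []. Qed.

Lemma fibP n v y : reflect (fib n v y) (y \in enumset (fib n v)).
Proof. by apply: enumsetP; exact: finite_fib. Qed.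

Lemma LamP n y : reflect (Lam n y) (y \in enumset (Lam n)).
Proof. by apply: enumsetP; exact: finite_Lam. Qed.

Definition lseq n : seq K := [seq fr (xi y) | y <- enumset (Lam n)].
Definition lpoly n : {poly K} := \prod_(u <- lseq n) ('X - u%:P).
(** A truncated Eisenstein series of weight one over the points above [v]; the factor [T] places it
    in degree 1. *)
Definition lrho n v : K := \sum_(y <- enumset (fib n v)) T / fr (xi y).

Let kapK : {rmorphism Fq -> K} := (fr \o (polyC \o kap))%FUN.

Lemma xi_inj y y' : inY y -> inY y' -> fr (xi y) = fr (xi y') -> y = y'.
Proof.
move=> Yy Yy' E; apply/eqP; rewrite -subr_eq0; apply/eqP; apply: xi_eq0.
  exact: (submodB sub_inY).
by rewrite xiB //; apply/eqP; rewrite -frL_eq0 frLB E subrr.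
Qed.

Lemma uniq_lseq n : uniq (lseq n).
Proof.
rewrite map_inj_in_uniq ?uniq_enumset // => y y' /LamP[Yy _ _] /LamP[Yy' _ _].
exact: xi_inj.
Qed.

Lemma xi0 : xi 0 = 0.
Proof. by have := xiZ 0 (submod0 sub_inY); rewrite scale0r rmorph0 scale0r. Qed.

Lemma prY0 : prY 0 = 0.
Proof. by have := prYZ 0 (submod0 sub_inY); rewrite !scale0r. Qed.

Lemma lseq0 n : 0 \in lseq n.
Proof.
apply/mapP; exists 0; last by rewrite xi0 frL0.
by apply/LamP; split; [exact: (submod0 sub_inY) | exact: prY0 | rewrite xi0 size_poly0].
Qed.

Lemma lpoly_linearized n : is_linearized Fq (lpoly n).
Proof.
apply: (subspace_poly_linearized (kap := kapK)); [exact: uniq_lseq | exact: lseq0 |].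
move=> a _ _ /mapP[y /LamP[Yy y0 ys] ->] /mapP[y' /LamP[Yy' y0' ys'] ->].
have Yay : inY (a *: y) by exact: (submodZ sub_inY).
apply/mapP; exists (a *: y + y').
  apply/LamP; split; first exact: (submodD sub_inY).
    by rewrite prYD // prYZ // y0 y0' scaler0 addr0.
  rewrite xiD // xiZ //; apply: leq_trans (size_polyD _ _) _.
  by rewrite geq_max ys' andbT (leq_trans (size_scale_leq _ _)).
by rewrite xiD // xiZ // -mul_polyC frLD frLM.
Qed.

Lemma lpoly_coef1 n : (lpoly n)`_1 != 0.
Proof. by apply: coef1_prod_XsubC_neq0; [exact: uniq_lseq | exact: lseq0]. Qed.

Section Uniformized.
Variable sc : tor -> Yt.
Hypothesis scP : forall v, VN v -> inY (sc v) /\ prY (sc v) = v.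
Hypothesis sc_lin : forall a u v, VN u -> VN v -> sc (a *: u + v) = a *: sc u + sc v.

(** The exponential function of the truncated lattice, with derivative 1 at 0, evaluated at a lift
    of [v] and divided by [T]. *)
Definition lw n v : K := T^-1 * ((lpoly n).[fr (xi (sc v))] / (lpoly n)`_1).

Lemma lw_lin n a u v : VN u -> VN v -> lw n (a *: u + v) = kapK a * lw n u + lw n v.
Proof.
move=> Vu Vv; have [[Yu _] [Yv _]] := (scP Vu, scP Vv).
have Yau : inY (a *: sc u) by exact: (submodZ sub_inY).
have [c cE] := lpoly_linearized n.
rewrite /lw sc_lin // xiD // xiZ // -mul_polyC frLD frLM cE.
rewrite (horner_linpD kapK) -/(kapK a) (horner_linpZ kapK).
rewrite mulrDl mulrDr; congr (_ + _).
by rewrite -[kapK a * _ / _]mulrA mulrCA.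
Qed.

Lemma sc_notin n v : VN v -> v != 0 -> fr (xi (sc v)) \notin lseq n.
Proof.
move=> Vv v0; have [Yv vE] := scP Vv; apply/negP => /mapP[y /LamP[Yy y0 _]].
by move/(xi_inj Yv Yy) => E; move/eqP: v0; apply; rewrite -vE E.
Qed.

Lemma lw_neq0_inv n v : VN v -> v != 0 -> lw n v != 0 /\
  (lw n v)^-1 = \sum_(y <- enumset (Lam n)) T / fr (xi (sc v - y)).
Proof.
move=> Vv v0; have [Yv vE] := scP Vv.
have E1 : lpoly n = 1 *: lpoly n by rewrite scale1r.
have [h1 h2] := sum_inv_linearized kapK (lpoly_linearized n) E1 (oner_neq0 _) (sc_notin n Vv v0).
have c1 := lpoly_coef1 n.
split; first by rewrite /lw !mulf_neq0 ?invr_neq0 ?frT_neq0.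
rewrite /lw invfM invrK invf_div -h2 big_map mulr_sumr big_seq [RHS]big_seq.
by apply: eq_bigr => y /LamP[Yy _ _]; rewrite xiB // frLB.
Qed.

(** Once [n] reaches the size of the chosen lift, subtracting the truncated lattice from the lift
    gives the whole truncated fibre, so the dependence on the section disappears. *)
Lemma lw_inv n v : VN v -> v != 0 -> (size (xi (sc v)) <= n)%N -> (lw n v)^-1 = lrho n v.
Proof.
move=> Vv v0 vn; have [Yv vE] := scP Vv; have [_ ->] := lw_neq0_inv n Vv v0.
rewrite /lrho -(big_map (fun y => sc v - y) xpredT (fun y => T / fr (xi y))).
have szB y y' : inY y -> inY y' -> (size (xi y) <= n)%N -> (size (xi y') <= n)%N ->
    (size (xi (y - y')%R) <= n)%N.
  move=> Yy Yy' yn yn'; rewrite xiB //; apply: leq_trans (size_polyD _ _) _.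
  by rewrite size_polyN geq_max yn.
apply: perm_big; apply: uniq_perm; last first.
- move=> y; apply/mapP/fibP => [[z /LamP[Yz z0 zn] ->]|[Yy yE yn]].
    split; first exact: (submodB sub_inY).
      by rewrite prYB // z0 vE subr0.
    exact: szB.
  exists (sc v - y); last by rewrite subKr.
  apply/LamP; split; first exact: (submodB sub_inY).
    by rewrite prYB // vE yE subrr.
  exact: szB.
- exact: uniq_enumset.
- by rewrite map_inj_uniq ?uniq_enumset // => y y' /addrI/oppr_inj.
Qed.

(** In the product formula a factor [1 - x/u] can have a pole only if [u] has smaller degree than
    [x]. Such [u] lie in the truncation at [b], which does not grow with [n], whence a bound uniform
    in [n]. *)
Lemma lw_pole v : VN v -> v != 0 -> exists M, forall n, pole_le M (lw n v).
Proof.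
move=> Vv v0; have [Yv vE] := scP Vv; pose x := xi (sc v); pose b := size x.
(* [T^-1] contributes no pole, the factor [x] one of order at most [b], and each of the at most
   [size (enumset (Lam b))] relevant factors again at most [b]. *)
exists (0 + (b + size (enumset (Lam b)) * b))%N => n.
have sP u : u \in rem 0 (lseq n) -> exists y, [/\ inY y, Lam n y, xi y != 0 & u = fr (xi y)].
  rewrite mem_rem_uniq ?uniq_lseq // inE => /andP[u0 /mapP[y /LamP Ly uE]].
  by exists y; split=> //; [case: Ly | rewrite -frL_eq0 -uE].
set s := rem 0 _ in sP.
have us : uniq s by rewrite rem_uniq // uniq_lseq.
have E : lw n v = T^-1 * (fr x * \prod_(u <- s) ((fr x - u) / (0 - u))).
  congr (_ * _); exact: horner_div_coef1 (lseq0 n).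
clearbody s.
rewrite E; apply: pole_leM; first exact: pole_le_frT_inv.
apply: pole_leM.
  rewrite -[fr x]divr1 -(rmorph1 (@frL L)); apply: pole_le_frL; first exact: oner_neq0.
  by rewrite leq_addl.
pose c u := if u \in lseq b then b else 0%N.
have : pole_le (\sum_(u <- s) c u) (\prod_(u <- s) ((fr x - u) / (0 - u))).
  apply: pole_le_prod => u /sP[y [Yy [_ y0 _] xy0 ->]].
  rewrite -frL0 -!frLB; apply: pole_le_frL; first by rewrite sub0r oppr_eq0.
  rewrite sub0r size_polyN /c; have := size_polyD x (- xi y); rewrite size_polyN -/b.
  have [yb|yb] := leqP (size (xi y)) b; last by lia_size.
  have -> : fr (xi y) \in lseq b by apply/mapP; exists y => //; apply/LamP.
  by lia_size.
move=> [P [Q [Q0 E' le]]]; exists P, Q; split=> //; apply: leq_trans le _.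
rewrite leq_add2l -big_mkcond /= big_const_seq iter_addn_0 mulnC leq_mul2r.
rewrite -size_filter; apply/orP; right.
have -> : size (enumset (Lam b)) = size (lseq b) by rewrite size_map.
apply: uniq_leq_size; first by rewrite filter_uniq.
by move=> u; rewrite mem_filter => /andP[].
Qed.

End Uniformized.

Lemma lrho_homog n v : homog 1 (lrho n v).
Proof.
by rewrite /lrho; apply: big_ind => [||y _]; [exact: homog0 | exact: homogD | exact: homog_frT].
Qed.

(** If [y] has a non-zero component in [A^k], then [xi y] is not constant and [T / xi y] vanishes at
    X = oo. The only other possible point above [v] is [(v, 0)], present when [v] is in [S]; its
    image is a constant, of size 1, whence [0 < n]. *)
Lemma lrho_residue n v : (0 < n)%N -> VN v -> v != 0 ->
  residue (lrho n v) (if `[< S v >] then (w v)^-1 else 0).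
Proof.
move=> n0 Vv v0.
pose h (y : Yt) : L := if `[< forall i, (y.2 i : F) = 0 >] then (w y.1)^-1 else 0.
have prY1 (y : Yt) : (forall i, (y.2 i : F) = 0) -> prY y = y.1.
  move=> y0; rewrite /prY big1 ?addr0 // => i _.
  have E : act (y.2 i) = act 0 := congr1 (fun c : F => act c) (y0 i).
  by rewrite E act0l.
have -> : (if `[< S v >] then (w v)^-1 else 0) = \sum_(y <- enumset (fib n v)) h y.
  case: asboolP => Sv.
    have Yv : inY (v, 0) by split=> // i; rewrite ffunE; exact: Areg0.
    have xv : xi (v, 0) = (w v)%:P.
      rewrite /xi big1 ?addr0 // => i _; rewrite ffunE phi0 comp_poly0 //.
    have fv : (v, 0) \in enumset (fib n v).
      apply/fibP; split=> //; first by apply: prY1 => i; rewrite ffunE.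
      by rewrite xv (leq_trans (size_polyC_leq1 _)).
    rewrite (big_rem _ fv) /= [X in _ + X]big_seq big1 ?addr0 => [|y].
      by rewrite /h; case: asboolP => // H; case: H => i; rewrite ffunE.
    rewrite mem_rem_uniq ?uniq_enumset // inE => /andP[yv /fibP[Yy yE _]].
    rewrite /h; case: asboolP => // y0; case/eqP: yv.
    rewrite (prY1 _ y0) in yE; case: y y0 yE {Yy} => y1 y2 /= y0 ->.
    by congr (_, _); apply/ffunP => i; rewrite ffunE; exact: y0.
  rewrite big_seq big1 // => y /fibP[[Sy _] yE _]; rewrite /h; case: asboolP => // y0.
  by case: Sv; rewrite -yE prY1.
rewrite /lrho big_seq [X in residue _ X]big_seq.
rewrite -!(big_filter (enumset (fib n v))).
set s := seq.filter _ _.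
have sP y : y \in s -> fib n v y.
  by rewrite mem_filter => /andP[/fibP].
elim: s sP => [|y s IH] sP.
  by rewrite !big_nil; have := residue_const (0 : L); rewrite polyC0 rmorph0.
rewrite !big_cons; apply: residueD; last first.
  by apply: IH => z zs; apply: sP; rewrite inE zs orbT.
have [Yy yE yn] := sP y (mem_head _ _); rewrite /h; case: asboolP => y0.
  have xy : xi y = (w y.1)%:P.
    rewrite /xi big1 ?addr0 // => i _.
    have -> : phi (y.2 i) = phi 0 by congr phi; exact: y0.
    by rewrite phi0 comp_poly0.
  rewrite xy; apply: residue_unit; apply: contra_neq v0 => wy.
  rewrite -yE prY1 //; apply: w_eq0 => //; by case: Yy.
have [i yi0] : exists i, (y.2 i : F) != 0.
  apply: contrapT => no; apply: y0 => i; apply/eqP; rewrite -[_ == _]negbK; apply/negP => h'.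
  by apply: no; exists i.
by apply: residue_pole; case: (size_xi Yy yi0).
Qed.

(** Multiplication by [a] multiplies degrees in X by [dgr a]. The left side is a sum over the points
    [y] with [a y] within the truncation ([Z']), the right side over those with [y] within it ([Z]).
    The extra points have degree at least [n / dgr a], so their reciprocals have order at least
    [M]. *)
Lemma lrho_level a v M : Div a -> VN v -> act a v != 0 -> exists n1, forall n, (n1 <= n)%N ->
  vge M (fr (j a)%:P * lrho n (act a v) -
         \sum_(v' <- enumset (Va a)) lrho n (v - v')).
Proof.
move=> Da Vv av0; have [Aa _] := Da; have a0 := Div_neq0 g0 NE Da.
have d0 := dgr_gt0 Aa a0.
have VaS : Va a `<=` VN := @Va_sub _ _ _ _ _ g0 r N NE a Da.
have fVa : finite_set (Va a) by exact: sub_finite_set finVN.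
exists (dgr a * M)%N => n nM.
pose Z : set Yt := [set y | [/\ inY y, act a (prY y) = act a v & (size (xi y) <= n)%N]].
pose Z' : set Yt := [set y | [/\ inY y, act a (prY y) = act a v
                             & (size (xi (mulY a y)) <= n)%N]].
have szm y : inY y -> (size (xi (mulY a y))).-1 = ((size (xi y)).-1 * dgr a)%N.
  by move=> Yy; rewrite xi_mul // size_comp_poly mulnC.
have xi_neq0 y : inY y -> act a (prY y) = act a v -> xi y != 0.
  move=> Yy yE; apply/eqP => /(xi_eq0 Yy) y0; move/eqP: av0; apply.
  by rewrite -yE y0 prY0 act0.
have Z'Z : Z' `<=` Z.
  move=> y [Yy yE yn]; split=> //.
  have s0 : (0 < size (xi y))%N by rewrite lt0n size_poly_eq0 xi_neq0.
  have s1 : (0 < size (xi (mulY a y)))%N.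
    rewrite lt0n size_poly_eq0; apply/eqP => /(xi_eq0 (inY_mul Aa Yy)) h.
    by move/eqP: av0; apply; rewrite -yE -prY_mul // h prY0.
  have := szm y Yy; have := leq_pmulr (size (xi y)).-1 d0; move: yn s0 s1; lia.
have fZ : finite_set Z by apply: sub_finite_set (finite_size_xi n) => y [].
have fZ' : finite_set Z' by exact: sub_finite_set fZ.
have E2 : \sum_(v' <- enumset (Va a)) lrho n (v - v') =
    \sum_(y <- enumset Z) T / fr (xi y).
  rewrite /enumset (@big_fibers _ _ _ Z (fun y => v - prY y) (enumset (Va a))) //.
  - rewrite big_seq [RHS]big_seq; apply: eq_bigr => v' /(enumsetP _ fVa) Vv'.
    rewrite /lrho /enumset; congr bigop.body; congr (enum_fset _); congr fset_set.
    apply/seteqP; split=> y /=.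
      move=> [Yy yE yn]; split; last by rewrite yE subKr.
      split=> //; rewrite yE actB //.
      by have /(VaE v' Aa a0) -> := Vv'; rewrite subr0.
    by move=> [[Yy _ yn] <-]; split=> //; rewrite subKr.
  - exact: uniq_enumset.
  - move=> y [Yy yE _]; apply/(enumsetP _ fVa)/(VaE _ Aa a0).
    by rewrite actB // yE subrr.
(* Group [Z'] by [z = a y]: the points over [z] are the [y0 - (u, 0)] with [u] in [S] killed by [a],
   and the sum of their reciprocals is the logarithmic derivative of [phi a] at [xi y0]. *)
have E1 : fr (j a)%:P * lrho n (act a v) = \sum_(y <- enumset Z') T / fr (xi y).
  rewrite /enumset (@big_fibers _ _ _ Z' (mulY a) (enumset (fib n (act a v)))) //; first last.
  - by move=> y [Yy yE yn]; apply/fibP; split; rewrite ?prY_mul //; exact: inY_mul.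
  - exact: uniq_enumset.
  rewrite /lrho mulr_sumr big_seq [RHS]big_seq; apply: eq_bigr => z /fibP[Yz zE zn].
  have [y0 Yy0 y0E] := mulY_lift Da Yz Vv zE.
  pose Sa : set tor := [set u | S u /\ act a u = 0].
  have fSa : finite_set Sa by apply: sub_finite_set finite_S => u [].
  have Yu u : S u -> inY (u, 0) by move=> Su; split=> // i; rewrite ffunE; exact: Areg0.
  have xu u : xi (u, 0) = (w u)%:P.
    by rewrite /xi big1 ?addr0 // => i _; rewrite ffunE phi0 comp_poly0.
  have [k0 k00 phiE] := phi_prod Da.
  have [c cE] := phi_lin Aa.
  pose s : seq K := [seq fr (w u)%:P | u <- enumset Sa].
  pose f : {poly K} := map_poly (fr \o polyC) (phi a).
  have fE : f = fr k0%:P *: \prod_(u <- s) ('X - u%:P).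
    rewrite /f phiE map_polyZ rmorph_prod; congr (_ *: _).
    rewrite /s !big_map; apply: eq_bigr => u _.
    by rewrite rmorphB /= map_polyX map_polyC.
  have flin : is_linearized Fq f.
    exists (map_poly (fr \o polyC) c); rewrite /f cE /linp rmorph_sum /= size_map_poly.
    by apply: eq_bigr => i _; rewrite map_polyZ map_polyXn coef_map.
  have fx : f.[fr (xi y0)] = fr (xi z).
    rewrite -y0E xi_mul // /f.
    have -> : phi a \Po xi y0 = (map_poly polyC (phi a)).[xi y0] by [].
    by rewrite -horner_map -map_poly_comp.
  have xz : xi z != 0.
    apply/eqP => /(xi_eq0 Yz) h; move/eqP: av0; apply; by rewrite -zE h prY0.
  have fk0 : fr k0%:P != 0 by rewrite frL_eq0 polyC_eq0.
  have xs : fr (xi y0) \notin s.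
    apply/negP => h; move/eqP: xz; apply; apply/eqP; rewrite -frL_eq0 -fx fE hornerZ.
    by rewrite mulf_eq0 (negbTE fk0) -[_ == 0]/(root _ _) root_prod_XsubC.
  have [_ h] := sum_inv_linearized kapK flin fE fk0 xs.
  rewrite fx coef_map /= phi_coef1 // big_map in h.
  rewrite mulrCA -h mulr_sumr.
  rewrite [LHS]big_seq.
  transitivity (\sum_(u <- enumset Sa | u \in enumset Sa) T / fr (xi (y0 - (u, 0)))).
    apply: eq_bigr => u /(enumsetP _ fSa)[Su _].
    by rewrite xiB ?xu ?frLB //; exact: Yu.
  rewrite -big_seq -(big_map (fun u => y0 - ((u, 0) : Yt)) xpredT (fun y => T / fr (xi y))).
  apply: perm_big; apply: uniq_perm.
  - by rewrite map_inj_uniq ?uniq_enumset // => u u' /addrI/oppr_inj [].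
  - exact: uniq_enumset.
  have fin : finite_set [set y | Z' y /\ mulY a y = z].
    by apply: sub_finite_set fZ' => y [].
  move=> y; apply/mapP/(enumsetP _ fin) => [[u /(enumsetP _ fSa)[Su au] ->]|[[Yy yE yn] yz]].
    have Yyu : inY (y0 - (u, 0)) by apply: (submodB sub_inY) => //; exact: Yu.
    have mE : mulY a (y0 - (u, 0)) = z.
      apply: xi_inj => //; first exact: inY_mul.
      rewrite xi_mul // xiB ?xu //; last exact: Yu.
      rewrite cE (linp_compB kap) -cE comp_polyCr phi_w // au w0 polyC0 subr0.
      by rewrite -xi_mul // y0E.
    split=> //; split=> //; last by rewrite mE.
    by rewrite -prY_mul // mE zE.
  have y2 i : ((y0 - y).2 i : F) = 0.
    have := congr1 (fun x : Yt => x.2 i : F) yz; rewrite -y0E !ffunE /= => h'.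
    by apply: (mulfI a0); rewrite mulr0 mulrBr h' subrr.
  have Ydy : inY (y0 - y) by exact: (submodB sub_inY).
  exists (y0 - y).1.
    apply/(enumsetP _ fSa); split; first by case: Ydy.
    rewrite /= actB //; apply/eqP; rewrite subr_eq0; apply/eqP.
    by have := congr1 (fun x : Yt => x.1) yz; rewrite -y0E /= => ->.
  rewrite -[LHS](subKr y0); congr (_ - _); rewrite [LHS]surjective_pairing; congr (_, _).
  by apply/ffunP => i; rewrite [RHS]ffunE; exact: y2.
rewrite E1 E2.
have -> : \sum_(y <- enumset Z') T / fr (xi y) =
    \sum_(y <- enumset Z | y \in Z') T / fr (xi y).
  rewrite -[RHS]big_filter; apply: perm_big; apply: uniq_perm.
  - exact: uniq_enumset.
  - by rewrite filter_uniq // uniq_enumset.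
  move=> y; rewrite mem_filter; apply/(enumsetP _ fZ')/andP => [Zy|[]].
    by split; [rewrite inE | apply/(enumsetP _ fZ); exact: Z'Z].
  by rewrite inE.
rewrite [X in _ - X](bigID (fun y => y \in Z')) /= opprD addrA subrr add0r.
apply: vgeN; rewrite big_seq_cond; apply: vge_sum => y /andP[/(enumsetP _ fZ)[Yy yE yn] nZ'].
apply: vge_pole.
have lt : (n < size (xi (mulY a y)))%N.
  by rewrite ltnNge; apply: contraNN nZ' => h; rewrite inE.
have := szm y Yy; have s0 : (0 < size (xi y))%N by rewrite lt0n size_poly_eq0 xi_neq0.
move=> E; have : (dgr a * M <= (size (xi y)).-1 * dgr a)%N.
  by rewrite -E; apply: leq_trans nM _; move: lt; case: (size _).
by rewrite mulnC leq_pmul2r //; move: s0; case: (size (xi y)).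
Qed.

Lemma lattice_family : exists lam : nat -> tor -> K,
  [/\ forall n a u v, VN u -> VN v -> lam n (a *: u + v) = kapK a * lam n u + lam n v,
      forall n v, VN v -> v != 0 -> [/\ lam n v != 0, homog 1 (lam n v)^-1
        & residue (lam n v)^-1 (if `[< S v >] then (w v)^-1 else 0)],
      forall v, VN v -> v != 0 -> exists M, forall n, ~ vge M (lam n v)^-1
    & forall a v M, Div a -> VN v -> act a v != 0 -> exists n1, forall n, (n1 <= n)%N ->
        vge M (fr (j a)%:P * (lam n (act a v))^-1 -
               \sum_(v' \in Va a) (lam n (v - v'))^-1)].
Proof.
have [sc [scP sc_lin]] := exists_section.
(* Shifting the index by [n0] puts all lifts [sc v] within the truncation for every [n], as [lw_inv]
   requires; it also makes the index positive. *)
pose n0 := (\max_(v <- enumset VN) size (xi (sc v))).+1.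
have n0P v : VN v -> (size (xi (sc v)) <= n0)%N.
  move=> Vv; apply: leqW; rewrite (big_rem v) ?leq_maxl //.
  exact/(enumsetP _ finVN).
have inv n v : VN v -> v != 0 -> (lw sc (n + n0) v)^-1 = lrho (n + n0) v.
  move=> Vv v0; apply: lw_inv => //; apply: leq_trans (n0P _ Vv) _.
  exact: leq_addl.
exists (fun n => lw sc (n + n0)); split=> [n a u v|n v Vv v0|v Vv v0|a v M Da Vv av0].
- exact: lw_lin.
- have [h _] := lw_neq0_inv scP (n + n0) Vv v0; split=> //; rewrite inv //.
    exact: lrho_homog.
  by apply: lrho_residue => //; rewrite addnS.
- have [M MP] := lw_pole scP Vv v0; exists M.+1 => n.
  by have [h _] := lw_neq0_inv scP (n + n0) Vv v0; exact: pole_le_ninv.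
have [n1 n1P] := lrho_level M Da Vv av0; exists n1 => n nn1.
have [Aa _] := Da; have a0 := Div_neq0 g0 NE Da.
have VaS : Va a `<=` VN := @Va_sub _ _ _ _ _ g0 r N NE a Da.
have fVa : finite_set (Va a) by exact: sub_finite_set finVN.
have Vav : VN (act a v) by exact: (VN_act g0 NE).
rewrite inv // fsbig_finite //.
rewrite [X in _ - X](_ : _ = \sum_(v' <- enumset (Va a)) lrho (n + n0) (v - v')).
  by apply: n1P; apply: leq_trans nn1 _; exact: leq_addr.
rewrite /enumset big_seq [RHS]big_seq; apply: eq_bigr => v' /(enumsetP _ fVa) Vv'.
rewrite inv //; first by apply: (submodB subVN) => //; exact: VaS.
apply: contra_neq av0 => vv; have /(VaE v' Aa a0) := Vv'.
by have -> : v = v' by apply/eqP; rewrite -subr_eq0 vv.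
Qed.

End Lattice.

End Drinfeld.

(** * Morphisms out of R_A *)

Lemma ring_quot_lift (R S : comPzRingType) (E : set R) (h : {rmorphism R -> S}) :
  (forall x, E x -> h x = 0) ->
  exists h' : {rmorphism ring_quot E -> S}, forall x, h' (ring_proj E x) = h x.
Proof.
move=> hE; pose h' (u : ring_quot E) := h (repr u).
have h'E x : h' (ring_proj E x) = h x.
  apply/eqP; rewrite -subr_eq0 -rmorphB; apply/eqP.
  have : repr (ring_proj E x) - x \in ideal_pred E by apply/ring_projP; rewrite ring_proj_repr.
  move=> /asboolP /(_ [set x | h x = 0]); apply; split=> //; split=> [|a y z /= hy hz].
    by rewrite /= rmorph0.
  by rewrite rmorphD rmorphM hy mulr0 hz addr0.
have zm : zmod_morphism h'.
  move=> u v; rewrite -[u]ring_proj_repr -[v]ring_proj_repr.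
  by rewrite -(rmorphB (ring_proj E)) !h'E rmorphB.
have mm : monoid_morphism h'.
  split=> [|u v]; first by rewrite -(rmorph1 (ring_proj E)) h'E rmorph1.
  rewrite -[u]ring_proj_repr -[v]ring_proj_repr.
  by rewrite -(rmorphM (ring_proj E)) !h'E rmorphM.
pose H : {rmorphism ring_quot E -> S} := HB.pack h'
  (GRing.isZmodMorphism.Build _ _ h' zm) (GRing.isMonoidMorphism.Build _ _ h' mm).
by exists H.
Qed.

(** * Morphisms out of the tensor product *)

Section FreeMonomials.
Context {I : choiceType}.
Local Notation cm := (monalg.cmonom I).

Lemma cmonom_ind (P : cm -> Prop) : P (monalg.one) ->
  (forall i m, P m -> P (monalg.mmul (monalg.ucm i) m)) -> forall m, P m.
Proof.
move=> P1 PM m; have [n] := ubnP (monalg.mdeg m); elim: n m => // n IH m.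
rewrite ltnS => mn; have [->//|m1] := eqVneq m monalg.one.
have [i im] : exists i, (m i != 0)%N.
  apply: contrapT => no; move/eqP: m1; apply; apply/eqP/monalg.cmP => i.
  rewrite monalg.cm1; apply/eqP; rewrite -[_ == _]negbK; apply/negP => h.
  by apply: no; exists i.
have mE : m = monalg.mmul (monalg.ucm i) (monalg.divcm m (monalg.ucm i)).
  apply/eqP/monalg.cmP => l; rewrite monalg.cmM monalg.divcmE monalg.cmU.
  by case: eqP => [<-|_]; rewrite ?subn0 ?add0n // add1n subn1 prednK ?lt0n.
rewrite mE; apply: PM; apply: IH; apply: leq_trans mn.
by rewrite [X in (_ < monalg.mdeg X)%N]mE monalg.mdegM monalg.mdegU.
Qed.

Lemma malg_lift (K : comNzRingType) (phi : I -> K) :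
  exists h : {rmorphism monalg.malg cm int -> K},
    forall i, h (monalg.mkmalgU (monalg.ucm i) 1) = phi i.
Proof.
pose e (m : cm) := \prod_(i <- finmap.finsupp m) phi i ^+ m i.
have eW (m : cm) (d : {fset I}) : (finmap.finsupp m `<=` d)%fset ->
    e m = \prod_(i <- d) phi i ^+ m i.
  move=> le; rewrite /e (big_fset_incl _ le) // => i _.
  by rewrite -monalg.cmE_neq0 negbK => /eqP ->; rewrite expr0.
have eM : {morph e : x y / monalg.mmul x y >-> x * y}.
  move=> x y; rewrite {1}/e monalg.mdomD.
  rewrite (eW _ _ (fsubsetUl _ (finmap.finsupp y))) (eW _ _ (fsubsetUr (finmap.finsupp x) _)).
  by rewrite -big_split /=; apply: eq_bigr => i _; rewrite monalg.cmM exprD.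
have e1 : e monalg.one = 1 by rewrite /e monalg.mdom1 big_seq_fset0.
pose E : monalg.MMorphism.type cm K :=
  HB.pack e (monalg.isMultiplicative.Build cm K e (conj eM e1)).
pose f : {rmorphism int -> K} := intmul 1.
exists (monalg.mmap f E) => i.
apply: etrans (@monalg.mmapU _ _ _ f E 1 (monalg.ucm i)) _.
have H x : x = 1 -> x * e (monalg.ucm i) = phi i.
  by move=> ->; rewrite mul1r /e monalg.mdomU big_seq_fset1 monalg.cmUU expr1.
apply: H; exact: rmorph1.
Qed.

(** [G] spreads along products to the images of all monomials, and [Q] along differences to their
    integer combinations. *)
Lemma malg_morph_ind (R : pzRingType) (h : {rmorphism monalg.malg cm int -> R})
    (G Q : R -> Prop) : G 1 ->
  (forall i x, G x -> G (h (monalg.mkmalgU (monalg.ucm i) 1) * x)) ->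
  (forall x, G x -> Q x) -> (forall x y, Q x -> Q y -> Q (x - y)) -> forall z, Q (h z).
Proof.
move=> G1 GM GQ QB z.
have Q0 : Q 0 by rewrite -(subrr 1); apply: QB; exact: GQ.
have QD x y : Q x -> Q y -> Q (x + y).
  by move=> Qx Qy; rewrite -[y]opprK; apply: (QB) => //; rewrite -sub0r; exact: QB.
have Gm m : G (h (monalg.mkmalgU m 1)).
  elim/cmonom_ind: m => [|i m IH].
    by rewrite -[monalg.mkmalgU _ 1]/(1 : monalg.malg cm int) rmorph1.
  have -> : monalg.mkmalgU (monalg.mmul (monalg.ucm i) m) 1 =
      monalg.mkmalgU (monalg.ucm i) 1 * monalg.mkmalgU m 1 :> monalg.malg cm int.
    by rewrite monalg.malgM_def monalg.fgmulUU mulr1.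
  by rewrite rmorphM; exact: GM.
have Qn m (n : nat) : Q (h (monalg.mkmalgU m n%:Z)).
  have -> : n%:Z = 1 *+ n by rewrite -mulr_natr mul1r natz.
  rewrite monalg.monalgUMn rmorphMn; elim: n => [|n IH]; first by rewrite mulr0n.
  by rewrite mulrS; apply: QD => //; exact: GQ.
rewrite [z]monalg.monalgE rmorph_sum; apply: big_ind => // m _.
case: (monalg.mcoeff m z) => n; first exact: Qn.
by rewrite NegzE monalg.monalgUN rmorphN -sub0r; apply: QB.
Qed.

End FreeMonomials.

Section TensorLift.
Context {k B C : comPzRingType}.
Variables (f : {rmorphism k -> B}) (g : {rmorphism k -> C}).

Lemma tensor_free_lift (K : comNzRingType) (phi : B -> C -> K) : 
  exists h : {rmorphism tensor_free (B := B) (C := C) -> K},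
    forall b c, h (tensor_gen b c) = phi b c.
Proof.
have [h hE] := malg_lift (fun bc : B * C => phi bc.1 bc.2).
by exists h => b c; apply: etrans (hE (b, c)) _.
Qed.

(* Stated for an abstract ring since unfolding the free ring makes unification of
   its ring structures diverge. *)
Lemma tensor_relations_vanish (R K : comPzRingType) (gen : B -> C -> R)
    (h : {rmorphism R -> K}) (hB : {rmorphism B -> K}) (hC : {rmorphism C -> K}) :
  (forall a, hB (f a) = hC (g a)) -> (forall b c, h (gen b c) = hB b * hC c) ->
  [/\ forall b b' c, h (gen (b + b') c - (gen b c + gen b' c)) = 0,
      forall b c c', h (gen b (c + c') - (gen b c + gen b c')) = 0,
      forall a b c, h (gen (f a * b) c - gen b (g a * c)) = 0,
      forall b b' c c', h (gen (b * b') (c * c') - gen b c * gen b' c') = 0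
    & h (gen 1 1 - 1) = 0].
Proof.
move=> hfg hg; split=> [b b' c|b c c'|a b c|b b' c c'|].
- by rewrite rmorphB rmorphD !hg (rmorphD hB) mulrDl subrr.
- by rewrite rmorphB rmorphD !hg (rmorphD hC) mulrDr subrr.
- by rewrite rmorphB !hg (rmorphM hB) (rmorphM hC) hfg mulrCA mulrA subrr.
- by rewrite rmorphB rmorphM !hg (rmorphM hB) (rmorphM hC) mulrACA subrr.
- by rewrite rmorphB hg (rmorph1 hB) (rmorph1 hC) rmorph1 mulr1 subrr.
Qed.

Lemma tensor_lift (K : comNzRingType) (hB : {rmorphism B -> K}) (hC : {rmorphism C -> K}) :
  (forall a, hB (f a) = hC (g a)) ->
  exists chi : {rmorphism tensor_product f g -> K},
    forall b c, chi (pure f g b c) = hB b * hC c.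
Proof.
move=> hfg; have [h hg] := tensor_free_lift (fun b c => hB b * hC c).
have [h1 h2 h3 h4 h5] := tensor_relations_vanish hfg hg.
have [|h' h'E] := @ring_quot_lift (tensor_free (B := B) (C := C)) K (tensor_rel f g) h.
  move=> _ [b b' c|b c c'|a b c|b b' c c'|].
  - exact: h1.
  - exact: h2.
  - exact: h3.
  - exact: h4.
  - exact: h5.
exists h' => b c; apply: etrans (hg b c); exact: h'E.
Qed.

Let P := pure f g.

Lemma tensor_rel_proj x : tensor_rel f g x -> ring_proj (tensor_rel f g) x = 0.
Proof.
move=> rx; rewrite -(rmorph0 (ring_proj (tensor_rel f g))); apply/ring_projP.
by apply/asboolP => I [_ sub]; rewrite subr0; exact: sub.
Qed.

Lemma proj_relations (R R' : pzRingType) (gen : B -> C -> R) (h : {rmorphism R -> R'}) :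
  [/\ forall b b' c, h (gen (b + b') c - (gen b c + gen b' c)) = 0 ->
        h (gen (b + b') c) = h (gen b c) + h (gen b' c),
      forall b c c', h (gen b (c + c') - (gen b c + gen b c')) = 0 ->
        h (gen b (c + c')) = h (gen b c) + h (gen b c'),
      forall a b c, h (gen (f a * b) c - gen b (g a * c)) = 0 ->
        h (gen (f a * b) c) = h (gen b (g a * c)),
      forall b b' c c', h (gen (b * b') (c * c') - gen b c * gen b' c') = 0 ->
        h (gen (b * b') (c * c')) = h (gen b c) * h (gen b' c')
    & h (gen 1 1 - 1) = 0 -> h (gen 1 1) = 1].
Proof.
by split=> *; apply/eqP; rewrite -?rmorphD -?rmorphM -?(rmorph1 h) -subr_eq0 -rmorphB; apply/eqP.
Qed.

Lemma pure_facts :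
  [/\ forall b b' c, P (b + b') c = P b c + P b' c,
      forall b c c', P b (c + c') = P b c + P b c',
      forall a b c, P (f a * b) c = P b (g a * c),
      forall b b' c c', P (b * b') (c * c') = P b c * P b' c'
    & P 1 1 = 1].
Proof.
have [h1 h2 h3 h4 h5] := proj_relations (@tensor_gen B C) (ring_proj (tensor_rel f g)).
split=> [b b' c|b c c'|a b c|b b' c c'|].
- exact (h1 _ _ _ (tensor_rel_proj (TensorDl f g b b' c))).
- exact (h2 _ _ _ (tensor_rel_proj (TensorDr f g b c c'))).
- exact (h3 _ _ _ (tensor_rel_proj (TensorZ f g a b c))).
- exact (h4 _ _ _ _ (tensor_rel_proj (TensorM f g b b' c c'))).
- exact (h5 (tensor_rel_proj (Tensor1 f g))).
Qed.

(** Products of pure tensors are pure, so the monomials in the generators are already pure and only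
    differences remain. *)
Lemma tensor_ind (Q : tensor_product f g -> Prop) :
  (forall b c, Q (P b c)) -> (forall x y, Q x -> Q y -> Q (x - y)) -> forall z, Q z.
Proof.
move=> QP QB z; have [_ _ _ PM P1] := pure_facts.
have GQ : forall z, (exists b c, z = P b c) -> Q z by move=> _ [b [c ->]].
have G1 : exists b c, 1 = P b c by exists 1, 1; exact: esym P1.
have GM (bc : B * C) x : (exists b c, x = P b c) ->
    exists b c, P bc.1 bc.2 * x = P b c.
  by move=> [b [c ->]]; exists (bc.1 * b), (bc.2 * c); exact: esym (PM _ _ _ _).
have GM' (bc : B * C) x : (exists b c, x = P b c) ->
    exists b c, ring_proj (tensor_rel f g) (tensor_gen bc.1 bc.2) * x = P b c.
  exact: GM.
rewrite -[z]ring_proj_repr.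
refine (@malg_morph_ind (B * C)%type (tensor_product f g) (ring_proj (tensor_rel f g))
  (fun x => exists b c, x = P b c) Q G1 _ GQ QB _) => [[b c]].
exact: (GM' (b, c)).
Qed.

End TensorLift.

(** * Sums of homogeneous components *)

Section Decomposition.
Context {R : zmodType} (G : nat -> set R).
Hypotheses (G0 : forall d, G d 0) (GB : forall d x y, G d x -> G d y -> G d (x - y)).

Definition decomposable (z : R) : Prop :=
  exists n (x : 'I_n -> R), (forall i : 'I_n, G i (x i)) /\ z = \sum_i x i.

Lemma decomposableB y z : decomposable y -> decomposable z -> decomposable (y - z).
Proof.
have pad n (x : 'I_n -> R) m : (forall i : 'I_n, G i (x i)) -> (n <= m)%N ->
    exists2 x' : 'I_m -> R, (forall i : 'I_m, G i (x' i)) & \sum_i x i = \sum_i x' i.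
  move=> Gx nm; exists (fun i : 'I_m => if insub (val i) is Some l then x l else 0).
    move=> i; case: insubP => [l _ <-|_]; [exact: Gx | exact: G0].
  pose w (i : nat) := if insub i is Some l then x l else 0.
  have -> : \sum_i x i = \sum_(i < n) w i by apply: eq_bigr => i _; rewrite /w valK.
  rewrite (big_ord_widen m w nm) big_mkcond; apply: eq_bigr => i _ /=; rewrite /w.
  by case: insubP => [l -> _|/negbTE ->].
move=> [n [x [Gx ->]]] [m [x' [Gx' ->]]].
have [u Gu ->] := pad n x (maxn n m) Gx (leq_maxl _ _).
have [u' Gu' ->] := pad m x' (maxn n m) Gx' (leq_maxr _ _).
by exists (maxn n m), (fun i => u i - u' i); rewrite sumrB; split=> // i; exact: GB.
Qed.

Lemma decomposable_sum (I : Type) (s : seq I) (x : I -> R) :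
  (forall i, decomposable (x i)) -> decomposable (\sum_(i <- s) x i).
Proof.
have d0 : decomposable 0 by exists 0%N, (fun=> 0); rewrite big_ord0; split=> // -[].
have dD y z : decomposable y -> decomposable z -> decomposable (y + z).
  by move=> dy dz; rewrite -[z]opprK -[- z]sub0r; do 2?[apply: decomposableB => //].
by move=> dx; apply: big_ind.
Qed.

Lemma decomposable_homog d x : G d x -> decomposable x.
Proof.
move=> Gx; exists d.+1, (fun i : 'I_d.+1 => if val i == d then x else 0); split.
  by move=> i; case: eqP => [->|].
by rewrite (bigD1 ord_max) //= eqxx big1 ?addr0 // => i; rewrite -val_eqE /= => /negbTE ->.
Qed.

End Decomposition.

Lemma inv_mulE (K : fieldType) (x y : K) : x != 0 -> y != 0 -> x + y != 0 ->
  x^-1 * y^-1 = (x + y)^-1 * (x^-1 + y^-1).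
Proof. by move=> x0 y0 xy0; field; rewrite x0 y0 xy0. Qed.

Lemma tofrac_invM (R : idomainType) (x y : R) : x != 0 -> y != 0 -> x + y != 0 ->
  (FracField.tofrac x)^-1 * (FracField.tofrac y)^-1 =
  (FracField.tofrac (x + y))^-1 * ((FracField.tofrac x)^-1 + (FracField.tofrac y)^-1).
Proof.
rewrite -!(tofrac_eq0 (R := R)) rmorphD /=; move: (FracField.tofrac x) (FracField.tofrac y).
exact: inv_mulE.
Qed.

(** * Relations, grading and evaluations of R_V *)

Section ReciprocalAlgebra.
Context (Fq : finFieldType) (W : lmodType Fq) (V : set W).
Hypotheses (subV : is_submodule V) (finV : finite_set V).
Local Notation RVV := (RV V).

Lemma to_Sym_lin a u v : V u -> V v -> to_Sym V (a *: u + v) = a *: to_Sym V u + to_Sym V v.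
Proof.
move=> Vu Vv.
have E : coords V (a *: u + v) = a *: coords V u + coords V v.
  apply: coords_uniq => //; rewrite {1}(coordsP subV finV Vu) {1}(coordsP subV finV Vv).
  rewrite /lincomb scaler_sumr -big_split; apply: eq_bigr => i _ /=.
  by rewrite !mxE scalerDl scalerA.
rewrite /to_Sym E scaler_sumr -big_split; apply: eq_bigr => i _ /=.
by rewrite !mxE scalerDl scalerA.
Qed.

Lemma to_Sym0 : to_Sym V 0 = 0.
Proof.
have := to_Sym_lin 1 (submod0 subV) (submod0 subV); rewrite !scale1r addr0.
by move/eqP; rewrite -subr_eq0 opprD addNKr oppr_eq0 => /eqP.
Qed.

Lemma to_Sym_neq0 v : V v -> v != 0 -> to_Sym V v != 0.
Proof.
move=> Vv; apply: contra_neq => v0; rewrite (coordsP subV finV Vv) /lincomb big1 // => i _.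
have : mpoly.mcoeff (mpoly.mnm1 i) (to_Sym V v) = 0 by rewrite v0 mpoly.mcoeff0.
rewrite /to_Sym raddf_sum (bigD1 i) //= mpoly.mcoeffZ mpoly.mcoeffX eqxx mulr1.
rewrite big1 ?addr0 => [->|l li]; first by rewrite scale0r.
rewrite mpoly.mcoeffZ mpoly.mcoeffX (_ : _ == _ = false) ?mulr0 //.
by apply/negbTE; apply: contra_neq li => /mpoly.mnmP/(_ l); rewrite !mpoly.mnm1E eqxx; case: eqP.
Qed.

Lemma RV_invE v : V v -> v != 0 -> RV_val (RV_inv V v) = KV_inv V v.
Proof.
move=> Vv v0; rewrite /RV_inv insubdK //; apply/asboolP => B [_]; apply.
by exists v.
Qed.

Lemma RV_inv0 : RV_inv V 0 = 0.
Proof.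
apply: val_inj; have E : KV_inv V 0 = 0 by rewrite /KV_inv to_Sym0 rmorph0 invr0.
by rewrite /RV_inv E insubdK //; exact: rpred0.
Qed.

Lemma RV_invZ a v : a != 0 -> V v -> RV_inv V (a *: v) = RV_scalar V a^-1 * RV_inv V v.
Proof.
move=> a0 Vv; have [->|v0] := eqVneq v 0; first by rewrite scaler0 RV_inv0 mulr0.
apply: val_inj; rewrite /= !RV_invE ?scaler_eq0 ?negb_or ?a0 //; last exact: (submodZ subV).
have := to_Sym_lin a Vv (submod0 subV); rewrite !addr0 to_Sym0 addr0 /KV_inv => ->.
by rewrite -mpoly.mul_mpolyC rmorphM invfM; congr (_ * _); exact: esym (fmorphV (KV_const V) a).
Qed.

Lemma RV_invM u v : V u -> V v -> u != 0 -> v != 0 -> u + v != 0 ->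
  RV_inv V u * RV_inv V v = RV_inv V (u + v) * (RV_inv V u + RV_inv V v).
Proof.
move=> Vu Vv u0 v0 uv0; have Vuv := submodD subV Vu Vv.
apply: val_inj; rewrite /= !RV_invE //.
have E := to_Sym_lin 1 Vu Vv; rewrite !scale1r in E; rewrite /KV_inv E.
apply: tofrac_invM; rewrite -?E; exact: to_Sym_neq0.
Qed.

Lemma RV_ind (P : RVV -> Prop) : (forall a, P (RV_scalar V a)) ->
  (forall v, V v -> v != 0 -> P (RV_inv V v)) -> (forall x y, P x -> P y -> P (x - y)) ->
  (forall x y, P x -> P y -> P (x * y)) -> forall x, P x.
Proof.
move=> Pc Pi PB PM x; have /asboolP := valP x.
move=> /(_ [set y | exists2 u : RVV, P u & RV_val u = y]).
case=> [|u Pu E]; last by have <- : u = x by exact: val_inj.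
split; first split.
- by move=> a; exists (RV_scalar V a).
- by move=> _ _ [u Pu <-] [v Pv <-]; exists (u - v) => //; exact: PB.
- by move=> _ _ [u Pu <-] [v Pv <-]; exists (u * v) => //; exact: PM.
by move=> _ [v [Vv v0] <-]; exists (RV_inv V v); [exact: Pi | exact: RV_invE].
Qed.

Lemma sub_RV_gr n : is_RV_subspace (RV_gr (V := V) n).
Proof.
split=> [G [[G0 _] _] //|a x y Gx Gy G HG].
by have [[_ G2] _] := HG; apply: G2; [exact: Gx | exact: Gy].
Qed.

Lemma RV_grB n x y : RV_gr n x -> RV_gr n y -> RV_gr (V := V) n (x - y).
Proof.
move=> Gx Gy; rewrite addrC -mulN1r -(rmorph1 (RV_scalar V)) -rmorphN.
by have [_] := sub_RV_gr n; apply.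
Qed.

Lemma RV_grM m n x y : RV_gr m x -> RV_gr n y -> RV_gr (V := V) (m + n) (x * y).
Proof.
move=> Gx Gy; have [g0 g2] := sub_RV_gr (m + n).
apply: (Gx [set x | RV_gr (V := V) (m + n) (x * y)]); split=> [|{Gx}{}x [s [ms Ss ->]]] /=.
  split=> /= [|a x1 x2 h1 h2]; first by rewrite mul0r.
  by rewrite mulrDl -mulrA; exact: g2.
apply: (Gy [set y | RV_gr (V := V) (m + n) (_ * y)]); split=> [|{Gy}{}y [t [nt St ->]]] /=.
  split=> /= [|a x1 x2 h1 h2]; first by rewrite mulr0.
  by rewrite mulrDr mulrCA; exact: g2.
move=> G [_]; apply; exists (s ++ t); rewrite size_cat ms nt big_cat; split=> // z.
by rewrite mem_cat => /orP[/Ss|/St].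
Qed.

Lemma RV_decomposable (x : RVV) : decomposable (fun d => RV_gr (V := V) d) x.
Proof.
have g0 d := proj1 (sub_RV_gr d).
elim/RV_ind: x => [a|v Vv v0|x y|_ _ [n [x [Gx ->]]] [m [y [Gy ->]]]].
- apply: (decomposable_homog g0 (d := 0%N)).
  rewrite -[RV_scalar V a]mulr1 -[_ * 1]addr0; have [_ g2] := sub_RV_gr 0.
  by apply: g2 => // G [_]; apply; exists [::]; rewrite big_nil.
- apply: (decomposable_homog g0 (d := 1%N)) => G [_]; apply; exists [:: RV_inv V v].
  by rewrite big_seq1; split=> // y; rewrite inE => /eqP ->; exists v.
- exact: (decomposableB g0 RV_grB).
rewrite big_distrlr /=; apply: (decomposable_sum g0 RV_grB) => i.
apply: (decomposable_sum g0 RV_grB) => l.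
by apply: (decomposable_homog g0 (d := (i + l)%N)); exact: RV_grM.
Qed.

Section Evaluation.
Context (K : fieldType) (kap : {rmorphism Fq -> K}) (om : W -> K).
Hypothesis om_lin : forall a u v, V u -> V v -> om (a *: u + v) = kap a * om u + om v.
Hypothesis om_neq0 : forall v, V v -> v != 0 -> om v != 0.

Let ev : {rmorphism Sym V -> K} := mpoly.mmap kap (fun i => om (basis V)`_i).

Lemma om0 : om 0 = 0.
Proof.
have := om_lin 1 (submod0 subV) (submod0 subV); rewrite scale1r rmorph1 mul1r addr0.
by move/eqP; rewrite -subr_eq0 opprD addNKr oppr_eq0 => /eqP.
Qed.

Lemma ev_to_Sym v : V v -> ev (to_Sym V v) = om v.
Proof.
move=> Vv; rewrite {2}(coordsP subV finV Vv) /lincomb /to_Sym rmorph_sum.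
have bV (i : 'I_(size (basis V))) : V (basis V)`_i.
  have [bV _] := basisP subV finV.
  have := bV (delta_mx 0 i); rewrite /lincomb (bigD1 i) //= mxE !eqxx scale1r.
  by rewrite big1 ?addr0 // => l li; rewrite mxE (negbTE li) andbF scale0r.
suff [_ ->] : V (\sum_(i < vdim V) coords V v 0 i *: (basis V)`_i) /\
    om (\sum_(i < vdim V) coords V v 0 i *: (basis V)`_i) =
    \sum_(i < vdim V) kap (coords V v 0 i) * om (basis V)`_i.
  apply: eq_bigr => i _; rewrite /ev /= mpoly.mmapZ mpoly.mmapX mpoly.mmap1U //.
elim/big_ind2: _ => [|u x u' x' [Vu <-] [Vu' <-]|i _].
- by rewrite om0; split=> //; exact: (submod0 subV).
- split; first exact: (submodD subV).
  by have := om_lin 1 Vu Vu'; rewrite scale1r rmorph1 mul1r.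
split; first exact: (submodZ subV).
by have := om_lin (coords V v 0 i) (bV i) (submod0 subV); rewrite !addr0 om0 addr0.
Qed.

(** The evaluation [ev] of the symmetric algebra may have a kernel and so need not extend to [KV].
    It extends to the fractions whose denominator has non-zero image (the functional relation [E]),
    and these include all [1/v] because [om v <> 0]. *)
Lemma RV_eval : exists h : {rmorphism RVV -> K},
  (forall v, V v -> v != 0 -> h (RV_inv V v) = (om v)^-1) /\
  (forall a, h (RV_scalar V a) = kap a).
Proof.
pose E (x : KV V) (y : K) := exists p m : Sym V,
  [/\ ev m != 0, x = FracField.tofrac p / FracField.tofrac m & y = ev p / ev m].
have ev_n0 m : ev m != 0 -> FracField.tofrac m != 0.
  by move=> m0; rewrite tofrac_eq0; apply: contra_neq m0 => ->; rewrite rmorph0.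
have Efun x y y' : E x y -> E x y' -> y = y'.
  move=> [p [m [m0 -> ->]]] [p' [m' [m'0 E' ->]]]; apply/eqP.
  move/eqP: E'; rewrite !eqr_div ?ev_n0 // -!rmorphM tofrac_eq => /eqP ->.
  by rewrite rmorphM.
have E0 a : E (KV_const V a) (kap a).
  exists (mpoly.mpolyC (vdim V) a), 1; rewrite !rmorph1 oner_neq0 !divr1; split=> //.
  by rewrite /ev /= mpoly.mmapC.
have EB x y x' y' : E x y -> E x' y' -> E (x - x') (y - y').
  move=> [p [m [m0 -> ->]]] [p' [m' [m'0 -> ->]]]; exists (p * m' - p' * m), (m * m').
  rewrite rmorphM mulf_neq0 //; split=> //.
    by rewrite -mulNr addf_div ?ev_n0 // mulNr -!rmorphM -rmorphB.
  by rewrite -mulNr addf_div // mulNr -!rmorphM -rmorphB rmorphM.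
have EM x y x' y' : E x y -> E x' y' -> E (x * x') (y * y').
  move=> [p [m [m0 -> ->]]] [p' [m' [m'0 -> ->]]]; exists (p * p'), (m * m').
  by rewrite rmorphM mulf_neq0 // !mulf_div -!rmorphM.
have Ei v : V v -> v != 0 -> E (KV_inv V v) (om v)^-1.
  move=> Vv v0; exists 1, (to_Sym V v); rewrite !rmorph1 !mul1r ev_to_Sym //.
  by rewrite om_neq0.
have /choice[h hE] : forall x : RVV, exists y, E (RV_val x) y.
  elim/RV_ind => [a|v Vv v0|x x' [y Ey] [y' Ey']|x x' [y Ey] [y' Ey']].
  - by exists (kap a); exact: E0.
  - by exists (om v)^-1; rewrite RV_invE //; exact: Ei.
  - by exists (y - y'); exact: EB.
  - by exists (y * y'); exact: EM.
have zm : zmod_morphism h by move=> x y; apply: (Efun _ _ _ (hE _)); apply: EB; exact: hE.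
have h1 : forall a, h (RV_scalar V a) = kap a by move=> a; apply: (Efun _ _ _ (hE _)); exact: E0.
have mm : monoid_morphism h.
  split=> [|x y]; last by apply: (Efun _ _ _ (hE _)); apply: EM; exact: hE.
  by rewrite -(rmorph1 (RV_scalar V)) h1 rmorph1.
pose H : {rmorphism RVV -> K} := HB.pack h
  (GRing.isZmodMorphism.Build _ _ h zm) (GRing.isMonoidMorphism.Build _ _ h mm).
exists H; split=> // v Vv v0; apply: (Efun _ _ _ (hE _)).
by rewrite RV_invE //; exact: Ei.
Qed.

End Evaluation.
End ReciprocalAlgebra.

(** * Residue field of a prime ideal *)

Lemma field_of_inverses (T : comPzRingType) : (1 : T) <> 0 ->
  (forall x : T, x <> 0 -> exists y, y * x = 1) ->
  exists (L : fieldType) (h : {rmorphism T -> L}), forall x, h x = 0 -> x = 0.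
Proof.
move=> n10 inv; have /choice[i iE] :
    forall x : T, exists y, (x <> 0 -> y * x = 1) /\ (x = 0 -> y = 0).
  move=> x; case: (pselect (x = 0)) => [->|x0]; first by exists 0.
  by have [y yx] := inv _ x0; exists y.
have n10' : (1 : T) != 0 by apply/eqP.
pose N : comNzRingType := HB.pack (T : Type) (GRing.ComPzRing.on T)
  (GRing.PzSemiRing_isNonZero.Build T n10').
have mulVx (x : N) : x != 0 -> i x * x = 1 by move=> /eqP x0; case: (iE x) => /(_ x0).
have inv0 : i (0 : N) = 0 :> N by case: (iE 0) => _; apply.
pose L : fieldType := HB.pack (T : Type) (GRing.ComNzRing.on N)
  (GRing.ComNzRing_isField.Build N mulVx inv0).
have zm : zmod_morphism (id : T -> L) by [].
have mm : monoid_morphism (id : T -> L) by [].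
pose H : {rmorphism T -> L} := HB.pack (id : T -> L)
  (GRing.isZmodMorphism.Build _ _ (id : T -> L) zm)
  (GRing.isMonoidMorphism.Build _ _ (id : T -> L) mm).
by exists L, H.
Qed.

(** [L] is the fraction field of [R/p], obtained by inverting all non-zero classes. *)
Lemma prime_ideal_field (R : comPzRingType) (p : set R) : is_prime_ideal p ->
  exists (L : fieldType) (h : {rmorphism R -> L}), forall x, h x = 0 <-> p x.
Proof.
move=> [idp p1 pM]; have [p0 pD] := idp.
have projP x : ring_proj p x = 0 <-> p x.
  rewrite -(rmorph0 (ring_proj p)); split=> [/ring_projP|px].
    by rewrite subr0 => /asboolP h; exact: (h p (conj idp (fun _ k => k))).
  by apply/ring_projP; apply/asboolP => I [_]; rewrite subr0; apply.
pose D : comPzRingType := ring_quot p; pose S : set D := [set x | x <> 0].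
have n10 : (1 : D) <> 0 by rewrite -(rmorph1 (ring_proj p)) => /projP.
have intD (x y : D) : x * y = 0 -> x = 0 \/ y = 0.
  rewrite -[x]ring_proj_repr -[y]ring_proj_repr -rmorphM => /projP/pM[h|h]; [left|right];
  exact/projP.
have denomS (s : denom S) : sval s <> 0.
  apply: (_ : [set x : D | x <> 0] (sval s)); apply: (denomP s).
  split=> //; split=> // x y /= x0 y0 /intD[].
    exact: x0.
  exact: y0.
have frac0 x (s : denom S) : loc_frac x s = 0 <-> x = 0.
  split=> [/loc_fracP[u]|->].
    by rewrite /= mul0r mulr0 mulr1 => /intD[/denomS|].
  by apply/loc_fracP; exists (denom1 S); rewrite /= !mul0r.
have [|u u0|L [h hP]] := @field_of_inverses (loc S).
- by move=> /frac0.
- elim/(@loc_ind D S): u u0 => x s x0.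
  have {}x0 : x <> 0 by move=> x00; apply: x0; apply/frac0.
  have Sx : denom_set S x by move=> M [_]; apply.
  exists (loc_frac (sval s) (mk_denom Sx)).
  change (loc_mul (loc_frac (sval s) (mk_denom Sx)) (loc_frac x s) = loc_frac 1 (denom1 S)).
  by rewrite loc_mulE; apply/loc_fracP; exists (denom1 S); rewrite /= !mul1r mulr1 mulrC.
exists L, (h \o (to_loc S \o ring_proj p))%FUN => x /=; split=> [/hP/frac0/projP//|/projP ->].
by rewrite !rmorph0.
Qed.

(** * The deformed point *)

Section LimitIdeal.
Context {R : comPzRingType} {L : fieldType} (U : set_system nat) (FU : UltraFilter U).
Variable chi : nat -> {rmorphism R -> {fraction {poly {poly L}}}}.
Hypothesis chi_vge0 : forall n z, vge 0 (chi n z).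

Definition limit_ideal : set R := [set z | forall M, U [set n | vge M (chi n z)]].

Lemma is_ideal_limit_ideal : is_ideal limit_ideal.
Proof.
split=> [M|a x y hx hy M].
  by apply: filterS filterT => n _ /=; rewrite rmorph0; exact: vge0.
apply: filterS (filterI (hx M) (hy M)) => n [/= h1 h2]; rewrite rmorphD rmorphM.
by apply: vgeD => //; rewrite -[M]add0n; apply: vgeM.
Qed.

Lemma limit_ideal_notin M z : (forall n, ~ vge M (chi n z)) -> ~ limit_ideal z.
Proof.
move=> nz /(_ M) UM; apply: (@filter_not_empty _ U); apply: filterS UM => n; exact: nz.
Qed.

(** If [x] fails the bound [M0] almost everywhere, then for almost all [n] the bound [M0 + M] on the
    product leaves the bound [M] to [y]. The ultrafilter turns failure to hold almost everywhere
    into failure almost everywhere. *)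
Lemma limit_ideal_mul x y : limit_ideal (x * y) -> limit_ideal x \/ limit_ideal y.
Proof.
move=> hxy; case: (pselect (limit_ideal x)) => [|/existsNP[M0 nx]]; [by left | right=> M].
have [//|Ux] := in_ultra_setVsetC [set n | vge M0 (chi n x)] FU.
apply: filterS (filterI Ux (hxy (M0 + M)%N)) => n [/= h].
by rewrite rmorphM => /vge_prime[].
Qed.

End LimitIdeal.

Lemma rmorphB_fsbig (R R' : pzRingType) (h : {rmorphism R -> R'}) (T : choiceType)
    (X : set T) x (f : T -> R) : finite_set X ->
  h (x - \sum_(i \in X) f i) = h x - \sum_(i \in X) h (f i).
Proof. by move=> fX; rewrite !fsbig_finite // rmorphB rmorph_sum. Qed.

(** * The reciprocal map of a point of Q *)

Section Points.
Context (Fq : finFieldType) (F : fieldType) (iota : {rmorphism Fq -> F}).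
Context (infty : set F).
Hypothesis hF : is_global_function_field iota.
Local Notation A := (Areg iota infty).
Variables (g : F) (N : set F) (r : nat).
Hypotheses (Ag : A g) (g0 : g != 0) (NE : N = principal iota infty g).
Hypothesis gnu : ~ A g^-1.
Hypothesis level : level_assumption iota infty N.
Local Notation Div := (Div iota infty N).
Local Notation tor := (torsion iota infty r).
Local Notation act := (@torsion_mul Fq F iota infty r).
Local Notation VN := (@VN Fq F iota infty N r).
Local Notation Va := (@Va Fq F iota infty r).
Local Notation RVN := (RV VN).
Local Notation tens := (RV_tensor iota infty N r).
Local Notation pureT := (@RV_pure Fq F iota infty N r).
Local Notation RAN := (RA iota infty N r).
Local Notation cls := (@RA_class Fq F iota infty N r).
Let subVN := sub_VN g0 r NE.
Let finVN := finite_VN hF Ag g0 r NE.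

Lemma pure_facts_RV :
  [/\ forall b b' c, pureT (b + b') c = pureT b c + pureT b' c,
      forall b c c', pureT b (c + c') = pureT b c + pureT b c',
      forall a b c, pureT (RV_scalar VN a * b) c = pureT b (iota a * c),
      forall b b' c c', pureT (b * b') (c * c') = pureT b c * pureT b' c'
    & pureT 1 1 = 1].
Proof. exact: pure_facts. Qed.

Lemma pure0l c : pureT 0 c = 0.
Proof. by have [D _ _ _ _] := pure_facts_RV; apply: (addIr (pureT 0 c)); rewrite -D !add0r. Qed.

Lemma pureB b b' c : pureT (b - b') c = pureT b c - pureT b' c.
Proof.
have [D _ _ _ _] := pure_facts_RV; apply/eqP; rewrite eq_sym subr_eq; apply/eqP.
by rewrite -D subrK.
Qed.

Lemma pure_mul1 b b' : pureT (b * b') 1 = pureT b 1 * pureT b' 1.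
Proof. by have [_ _ _ M _] := pure_facts_RV; rewrite -M mulr1. Qed.

Lemma pure_suml (I : Type) (s : seq I) (b : I -> RVN) c :
  pureT (\sum_(i <- s) b i) c = \sum_(i <- s) pureT (b i) c.
Proof.
have [D _ _ _ _] := pure_facts_RV.
by apply: (big_morph (fun b => pureT b c)) => [x y|]; [exact: D | exact: pure0l].
Qed.

Lemma RA_class_eq0 z :
  level_relations (iota := iota) (infty := infty) (N := N) (r := r) z -> cls z = 0.
Proof.
move=> rz; rewrite -(rmorph0 (ring_proj (level_relations (N := N) (r := r)))); apply/ring_projP.
by apply/asboolP => I [_ sub]; rewrite subr0; exact: sub.
Qed.

Section PointField.
Variables (L : fieldType) (h : {rmorphism tens -> L}).
Hypothesis h_level : forall z, level_relations z -> h z = 0.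

Definition point_coef (c : F) : L := h (pureT 1 c).

Fact point_coef_zmod : zmod_morphism point_coef.
Proof.
move=> x y; have [_ D _ _ _] := pure_facts_RV; apply/eqP; rewrite eq_sym subr_eq /point_coef.
by rewrite -rmorphD -D subrK.
Qed.
Fact point_coef_monoid : monoid_morphism point_coef.
Proof.
have [_ _ _ M P1] := pure_facts_RV; split=> [|x y]; first by rewrite /point_coef P1 rmorph1.
by rewrite /point_coef -rmorphM -M mulr1.
Qed.
HB.instance Definition _ := GRing.isZmodMorphism.Build F L point_coef point_coef_zmod.
HB.instance Definition _ := GRing.isMonoidMorphism.Build F L point_coef point_coef_monoid.

Definition point_rho (v : tor) : L := h (pureT (RV_inv VN v) 1).

Lemma h_pure b c : h (pureT b c) = h (pureT b 1) * point_coef c.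
Proof. by have [_ _ _ M _] := pure_facts_RV; rewrite /point_coef -rmorphM -M mulr1 mul1r. Qed.

Lemma h_scalar a : h (pureT (RV_scalar VN a) 1) = point_coef (iota a).
Proof. by have [_ _ Z _ _] := pure_facts_RV; rewrite -[RV_scalar VN a]mulr1 Z mulr1. Qed.

Lemma point_rho0 : point_rho 0 = 0.
Proof. by rewrite /point_rho (RV_inv0 subVN finVN) pure0l rmorph0. Qed.

Lemma point_rhoZ a v : a != 0 -> VN v ->
  point_rho (a *: v) = (point_coef (iota a))^-1 * point_rho v.
Proof.
move=> a0 Vv; have [_ _ _ M _] := pure_facts_RV.
rewrite /point_rho (RV_invZ subVN finVN a0 Vv).
have -> : pureT (RV_scalar VN a^-1 * RV_inv VN v) 1 =
    pureT (RV_scalar VN a^-1) 1 * pureT (RV_inv VN v) 1 by rewrite -M mulr1.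
rewrite rmorphM; congr (_ * _); apply: etrans (h_scalar _) _; rewrite (fmorphV iota).
exact: (fmorphV point_coef).
Qed.

Lemma point_rhoM u v : VN u -> VN v -> u != 0 -> v != 0 -> u + v != 0 ->
  point_rho u * point_rho v = point_rho (u + v) * (point_rho u + point_rho v).
Proof.
move=> Vu Vv u0 v0 uv0; have [D _ _ M _] := pure_facts_RV.
have M1 b b' : pureT (b * b') 1 = pureT b 1 * pureT b' 1 by rewrite -M mulr1.
have D1 b b' : pureT (b + b') 1 = pureT b 1 + pureT b' 1 by rewrite D.
transitivity (h (pureT (RV_inv VN u * RV_inv VN v) 1)); first by rewrite M1 rmorphM.
apply: etrans (congr1 (fun b => h (pureT b 1)) (RV_invM subVN finVN Vu Vv u0 v0 uv0)) _.
by rewrite M1 D1 rmorphM rmorphD.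
Qed.

Lemma point_rho_level a v : Div a -> VN v -> ~ Va a v ->
  point_coef a * point_rho (act a v) = \sum_(v' \in Va a) point_rho (v - v').
Proof.
move=> Da Vv nVv; have VaS : Va a `<=` VN := @Va_sub _ _ _ _ _ g0 r N NE a Da.
have fVa : finite_set (Va a) by exact: sub_finite_set finVN.
have H := h_level (ex_intro _ a (ex_intro _ v (And4 Da Vv nVv erefl))).
apply/eqP; rewrite -subr_eq0; apply/eqP; apply: etrans H.
apply: esym; apply: etrans (rmorphB_fsbig h _ _ fVa) _.
by congr (_ - _); apply: etrans (h_pure _ _) (mulrC _ _).
Qed.

End PointField.
End Points.

(** * Approximate solutions specializing to a given point *)

Section Deformation.
Context (Fq : finFieldType) (F : fieldType) (iota : {rmorphism Fq -> F}).
Context (infty : set F).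
Hypothesis hF : is_global_function_field iota.
Local Notation A := (Areg iota infty).
Variables (g : F) (N : set F) (r : nat).
Hypotheses (Ag : A g) (g0 : g != 0) (NE : N = principal iota infty g).
Hypothesis gnu : ~ A g^-1.
Hypothesis level : level_assumption iota infty N.
Local Notation Div := (Div iota infty N).
Local Notation tor := (torsion iota infty r).
Local Notation act := (@torsion_mul Fq F iota infty r).
Local Notation VN := (@VN Fq F iota infty N r).
Local Notation Va := (@Va Fq F iota infty r).
Local Notation RVN := (RV VN).
Local Notation tens := (RV_tensor iota infty N r).
Local Notation pureT := (@RV_pure Fq F iota infty N r).
Let subVN := sub_VN g0 r NE.
Let finVN := finite_VN hF Ag g0 r NE.

Section Family.
Variables (L : fieldType) (j : {rmorphism F -> L}) (rho : tor -> L).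
Hypothesis rho0 : rho 0 = 0.
Hypothesis rhoZ : forall a v, a != 0 -> VN v -> rho (a *: v) = (j (iota a))^-1 * rho v.
Hypothesis rhoM : forall u v, VN u -> VN v -> u != 0 -> v != 0 -> u + v != 0 ->
  rho u * rho v = rho (u + v) * (rho u + rho v).
Hypothesis rho_level : forall a v, Div a -> VN v -> ~ Va a v ->
  j a * rho (act a v) = \sum_(v' \in Va a) rho (v - v').
Hypothesis rho_neq0 : exists2 v, VN v & rho v != 0.
Local Notation K := {fraction {poly {poly L}}}.
Local Notation fr := (@frL L).
Let kap : {rmorphism Fq -> L} := (j \o iota)%FUN.
Let kapK : {rmorphism Fq -> K} := (fr \o (polyC \o kap))%FUN.

Lemma reciprocal_family : exists lam : nat -> tor -> K,
  [/\ forall n a u v, VN u -> VN v -> lam n (a *: u + v) = kapK a * lam n u + lam n v,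
      forall n v, VN v -> v != 0 -> [/\ lam n v != 0, homog 1 (lam n v)^-1
        & residue (lam n v)^-1 (rho v)],
      forall v, VN v -> v != 0 -> exists M, forall n, ~ vge M (lam n v)^-1
    & forall a v M, Div a -> VN v -> act a v != 0 -> exists n1, forall n, (n1 <= n)%N ->
        vge M (fr (j a)%:P * (lam n (act a v))^-1 -
               \sum_(v' \in Va a) (lam n (v - v'))^-1)].
Proof.
have [D [DDiv D_approx D_mul D_gen _]] := level.
have [phi [[phi_lin phiD phiM phi_w phi_psi] phi_const]] :=
  exists_drinfeld hF Ag g0 NE rho0 rhoZ rhoM rho_level DDiv D_approx D_mul D_gen gnu.
pose S := rsupp N rho; pose w := rinv rho.
have subS : is_submodule S := sub_rsupp g0 NE rho0 rhoZ rhoM.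
have S_VN : S `<=` VN by move=> v [].
have S_act a v : A a -> S v -> S (act a v) by move=> Aa /(phi_w _ _ Aa)[].
have wD u v : S u -> S v -> w (u + v) = w u + w v := rinvD g0 NE rho0 rhoZ rhoM (u := u) (v := v).
have wZ a v : S v -> w (a *: v) = (j \o iota) a * w v.
  by move=> [Vv _]; exact: (rinvZ rho0 rhoZ).
have w_eq0 v : S v -> w v = 0 -> v = 0 := @rinv_eq0 _ _ _ _ _ _ _ _ v.
have lin a : A a -> is_linearized Fq (phi a) by move=> /phi_lin[].
have coef1 a : A a -> (phi a)`_1 = j a by move=> /phi_lin[].
have phi_wS a v : A a -> S v -> (phi a).[w v] = w (act a v).
  by move=> Aa /(phi_w _ _ Aa)[].
have phi_prod a : Div a -> exists2 k, k != 0 &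
  phi a = k *: \prod_(u <- [seq w v | v <- enumset [set v | S v /\ act a v = 0]]) ('X - u%:P).
  by move=> Da; rewrite phi_psi //; exact: (psi_prod hF Ag g0 NE rho0 rhoZ rhoM Da).
have S_neq0 : exists2 v, S v & v != 0.
  have [v Vv rv] := rho_neq0; exists v; first by split=> //; right.
  by apply: contra_neq rv => ->.
have [k [vs [ind full]]] := exists_complement hF Ag g0 NE gnu subS S_VN S_act wD wZ w_eq0
  lin coef1 phiD phiM phi_const phi_wS phi_prod.
have [lam [l1 l2 l3 l4]] := lattice_family hF Ag g0 NE subS S_VN S_act S_neq0 wD wZ w_eq0
  lin coef1 phiD phiM phi_const phi_wS phi_prod ind full.
exists lam; split=> // n v Vv v0; have [h1 h2 h3] := l2 n v Vv v0; split=> //.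
have -> // : rho v = if `[< S v >] then (w v)^-1 else 0.
case: asboolP => Sv; first by rewrite /w /rinv invrK.
by apply/eqP; rewrite -[_ == _]negbK; apply/negP => rv; apply: Sv; split=> //; right.
Qed.
End Family.

Section Lift.
Variables (L : fieldType) (h : {rmorphism tens -> L}).
Hypothesis h_level : forall z, level_relations z -> h z = 0.
Hypothesis h_neq0 : exists2 v, VN v & h (pureT (RV_inv VN v) 1) != 0.
Local Notation K := {fraction {poly {poly L}}}.

(** The maps start from the tensor product instead of [RA], because each [chi n] respects the level
    relations only up to a finite order, which grows with [n]. *)
Lemma exists_deformation : exists chi : nat -> {rmorphism tens -> K},
  [/\ forall n z, residue (chi n z) (h z),
      forall v, VN v -> v != 0 -> exists M, forall n, ~ vge M (chi n (pureT (RV_inv VN v) 1)),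
      forall z, level_relations z -> forall M, exists n1, forall n, (n1 <= n)%N -> vge M (chi n z)
    & forall n d b c, RV_gr d b -> homog d (chi n (pureT b c))].
Proof.
pose j : {rmorphism F -> L} := point_coef h.
have [|lam [l1 l2 l3 l4]] := @reciprocal_family L j (point_rho h) (point_rho0 hF Ag g0 NE h)
  (@point_rhoZ _ _ _ _ hF _ _ _ Ag g0 NE _ h) (@point_rhoM _ _ _ _ hF _ _ _ Ag g0 NE _ h)
  (@point_rho_level _ _ _ _ hF _ _ _ Ag g0 NE _ h h_level).
  exact: h_neq0.
pose kapK : {rmorphism Fq -> K} := (@frL L \o (polyC \o (j \o iota)))%FUN.
have /choice[hB hBP] : forall n, exists hB : {rmorphism RVN -> K},
    (forall v, VN v -> v != 0 -> hB (RV_inv VN v) = (lam n v)^-1) /\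
    (forall a, hB (RV_scalar VN a) = kapK a).
  move=> n; apply: (RV_eval subVN finVN (kap := kapK)); first exact: l1.
  by move=> v Vv v0; case: (l2 n v Vv v0).
pose hC : {rmorphism F -> K} := (@frL L \o (polyC \o j))%FUN.
have /choice[chi chiP] : forall n, exists chi : {rmorphism tens -> K},
    forall b c, chi (pureT b c) = hB n b * hC c.
  by move=> n; apply: tensor_lift => a; exact: (hBP n).2.
have hB_inv n v : VN v -> v != 0 -> hB n (RV_inv VN v) = (lam n v)^-1 := (hBP n).1 v.
have chi_inv n v : VN v -> v != 0 -> chi n (pureT (RV_inv VN v) 1) = (lam n v)^-1.
  by move=> Vv v0; rewrite chiP hB_inv // rmorph1 mulr1.
exists chi; split.
- move=> n; pose Q z := residue (chi n z) (h z).
  apply: (@tensor_ind _ _ _ (RV_scalar VN) iota Q) => [b c|x y hx hy]; last first.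
    by rewrite /Q !rmorphB; apply: residueD => //; exact: residueN.
  have -> : Q (pure (RV_scalar VN) iota b c) = residue (hB n b * hC c) (h (pureT b 1) * j c).
    by congr residue; [exact: chiP | exact: (h_pure h)].
  apply: residueM; last exact: residue_const.
  pose Q' b := residue (hB n b) (h (pureT b 1)).
  apply: (@RV_ind _ _ _ Q') => {}b.
  + rewrite /Q' (hBP n).2; have -> := h_scalar h b; exact: residue_const.
  + by move=> Vb b0; rewrite /Q' hB_inv //; case: (l2 n b Vb b0).
  + move=> b' Qb Qb'; rewrite /Q' rmorphB pureB rmorphB.
    exact: (residueD Qb (residueN Qb')).
  + by move=> b' Qb Qb'; rewrite /Q' rmorphM pure_mul1 rmorphM; exact: (residueM Qb Qb').
- move=> v Vv v0; have [M MP] := l3 v Vv v0; exists M => n; rewrite chi_inv //.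
- move=> _ [a [v [Da Vv nVv ->]]] M.
  have [Aa _] := Da; have a0 := Div_neq0 g0 NE Da.
  have av0 : act a v != 0.
    by apply/eqP => av; apply: nVv; apply/(VaE v Aa a0).
  have [n1 n1P] := l4 a v M Da Vv av0; exists n1 => n nn1.
  have VaS : Va a `<=` VN := @Va_sub _ _ _ _ _ g0 r N NE a Da.
  have fVa : finite_set (Va a) by exact: sub_finite_set finVN.
  apply: (eq_ind_r (vge M) (n1P n nn1)); apply: etrans (rmorphB_fsbig (chi n) _ _ fVa) _.
  have Vav : VN (act a v) by exact: (VN_act g0 NE).
  congr (_ - _); first by apply: etrans (chiP _ _ _) _; rewrite hB_inv // mulrC.
  apply: eq_fsbigr => v' /set_mem Vv'.
  apply: chi_inv; first by apply: (submodB subVN) => //; exact: VaS.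
  apply: contra_neq av0 => vv; have /(VaE v' Aa a0) := Vv'.
  by have -> : v = v' by apply/eqP; rewrite -subr_eq0 vv.
- move=> n d b c Gb; rewrite chiP -[d]addn0; apply: homogM; last exact: homog_frL.
  apply: (Gb [set b | homog d (hB n b)]); split=> [|{Gb}{}b [s [<- Ss ->]]] /=.
    split=> [|a x y hx hy] /=; first by rewrite rmorph0; exact: homog0.
    rewrite rmorphD rmorphM (hBP n).2; apply: homogD => //; rewrite -[d]add0n.
    by apply: homogM => //; exact: homog_frL.
  elim: s Ss => [|y s IH] Ss.
    by rewrite big_nil rmorph1; rewrite -(rmorph1 (@frL L)); exact: homog_frL.
  rewrite big_cons rmorphM /= -add1n; apply: homogM; last first.
    by apply: IH => x xs; apply: Ss; rewrite inE xs orbT.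
  have [v [Vv v0] <-] := Ss y (mem_head _ _); rewrite hB_inv //.
  by case: (l2 n v Vv v0).
Qed.
End Lift.
End Deformation.

(** * Points of Omega near a given point *)

Section Density.
Context (Fq : finFieldType) (F : fieldType) (iota : {rmorphism Fq -> F}).
Context (infty : set F).
Hypothesis hF : is_global_function_field iota.
Local Notation A := (Areg iota infty).
Variables (g : F) (N : set F) (r : nat).
Hypotheses (Ag : A g) (g0 : g != 0) (NE : N = principal iota infty g).
Hypothesis gnu : ~ A g^-1.
Hypothesis level : level_assumption iota infty N.
Local Notation tor := (torsion iota infty r).
Local Notation VN := (@VN Fq F iota infty N r).
Local Notation RVN := (RV VN).
Local Notation tens := (RV_tensor iota infty N r).
Local Notation pureT := (@RV_pure Fq F iota infty N r).
Local Notation RAN := (RA iota infty N r).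
Local Notation cls := (@RA_class Fq F iota infty N r).
Local Notation RAgr := (@RA_gr Fq F iota infty N r).
Let subVN := sub_VN g0 r NE.
Let finVN := finite_VN hF Ag g0 r NE.

Lemma RA_gr0 (d : nat) : RAgr d 0.
Proof. by move=> G [[G0 _] _]. Qed.

Lemma RA_grB (d : nat) x y : RAgr d x -> RAgr d y -> RAgr d (x - y).
Proof. by move=> hx hy G HG; have [[_ GB] _] := HG; apply: GB; [exact: hx | exact: hy]. Qed.

(** One decomposition is homogeneous both for [RA_gr] and for the degree in [T] under all the
    [chi n], so that membership in the limit ideal can be tested on components. *)
Lemma decomposable_tens (L : fieldType)
    (chi : nat -> {rmorphism tens -> {fraction {poly {poly L}}}}) z :
  (forall n d b c, RV_gr d b -> homog d (chi n (pureT b c))) ->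
  decomposable (fun d : nat => [set z | RAgr d (cls z) /\ forall n, homog d (chi n z)]) z.
Proof.
move=> chi_homog; set G := fun d : nat => _.
have G0 d : G d 0.
  split=> [|n]; last by rewrite rmorph0; exact: homog0.
  rewrite /RA_class rmorph0; exact: RA_gr0.
have GB d x y : G d x -> G d y -> G d (x - y).
  move=> [x1 x2] [y1 y2]; split=> [|n].
    rewrite /RA_class rmorphB; exact: RA_grB.
  by rewrite rmorphB; apply: homogD => //; apply: homogN.
apply: (@tensor_ind _ _ _ (RV_scalar VN) iota (decomposable G)) => [b c|x y hx hy]; last first.
  exact: decomposableB.
have [n [x [Gx ->]]] := RV_decomposable b.
have -> : pure (RV_scalar VN) iota (\sum_i x i) c = \sum_i pureT (x i) c := pure_suml _ _ c.
apply: (decomposable_sum G0 GB) => i; apply: (decomposable_homog G0 (d := i)).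
split=> [|m]; last exact: chi_homog.
by move=> H [_]; apply; exists (x i) => //; exists c.
Qed.

Lemma RV_gr_vanish (L : fieldType) (h : {rmorphism tens -> L}) n b :
  (forall v, VN v -> h (pureT (RV_inv VN v) 1) = 0) -> RV_gr n.+1 b -> h (pureT b 1) = 0.
Proof.
move=> inv0 Gb; have [D _ _ _ _] := @pure_facts_RV Fq F iota infty N r.
apply: (Gb [set b | h (pureT b 1) = 0]); split=> [|{Gb}{}b [s [sz Ss ->]]] /=.
  split=> /= [|a x y hx hy]; first by rewrite pure0l rmorph0.
  have {}hx : h (pureT x 1) = 0 := hx; have {}hy : h (pureT y 1) = 0 := hy.
  apply: etrans (congr1 h (D _ _ _)) _.
  apply: etrans (rmorphD h _ _) _.
  rewrite [X in _ + X]hy addr0.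
  apply: etrans (congr1 h (pure_mul1 _ _)) _; apply: etrans (rmorphM h _ _) _.
  by rewrite [X in _ * X]hx mulr0.
case: s sz Ss => // y s _ Ss; rewrite big_cons.
apply: etrans (congr1 h (pure_mul1 _ _)) _; apply: etrans (rmorphM h _ _) _.
by have [v [Vv v0] <-] := Ss y (mem_head _ _); rewrite [X in X * _](inv0 v Vv) mul0r.
Qed.

(** Parts of positive degree are spanned by products with at least one factor [1/v], so a morphism
    that kills every [1/v] kills them. Relevance of a point thus provides a non-zero value of
    [rho]. *)
Lemma relevant_RV_inv (L : fieldType) (h : {rmorphism RAN -> L}) (d : int) f :
  0 < d -> RAgr d f -> h f != 0 -> exists2 v, VN v & h (RA_inv N v) != 0.
Proof.
case: d => // -[//|n] _ Gf hf; apply: contrapT => no; move/eqP: hf; apply.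
pose hT : {rmorphism tens -> L} := (h \o ring_proj (level_relations (N := N) (r := r)))%FUN.
have inv0 v : VN v -> hT (pureT (RV_inv VN v) 1) = 0.
  move=> Vv; apply/eqP; rewrite -[_ == _]negbK; apply/negP => nz; apply: no.
  by exists v.
apply: (Gf [set f | h f = 0]); split=> [|_ [b Gb [c _ <-]]].
  split=> /= [|x y hx hy]; first by rewrite rmorph0.
  by rewrite rmorphB hx hy subrr.
apply: etrans (h_pure hT b c) _.
by rewrite (RV_gr_vanish inv0 Gb) mul0r.
Qed.

Lemma exists_point_Omega (p : Proj RAgr) f : ~ point_ideal p f ->
  exists2 p' : Proj RAgr, Omega iota infty N r p' & ~ point_ideal p' f.
Proof.
move=> pf; have [L [h hP]] := prime_ideal_field (point_prime p).
pose hT : {rmorphism tens -> L} := (h \o ring_proj (level_relations (N := N) (r := r)))%FUN.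
have h_level z : level_relations z -> hT z = 0.
  by move=> /RA_class_eq0 z0; apply: etrans (congr1 h z0) (rmorph0 h).
have [d [f' [d0 df' pf']]] := point_relevant p.
have hf' : h f' != 0 by apply/eqP => /hP.
have h_neq0 := relevant_RV_inv d0 df' hf'.
have [chi [chi_res chi_inv chi_level chi_homog]] :=
  exists_deformation hF Ag g0 NE gnu level h_level h_neq0.
(* An ultrafilter containing all cofinite sets: what holds to each order for all large [n], such as
   a level relation, falls into [I]. *)
have [U [FU Uoo]] := ultraFilterLemma (eventually_filter : ProperFilter \oo).
have chi0 n z : vge 0 (chi n z) := residue_vge0 (chi_res n z).
pose I : set tens := limit_ideal U chi.
have [I0 ID] := is_ideal_limit_ideal FU chi0.
have IB x y : I x -> I y -> I (x - y).
  by move=> Ix Iy; rewrite addrC -mulN1r; exact: ID.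
have I_level z : level_relations z -> I z.
  move=> lz M; apply: Uoo; have [n1 n1P] := chi_level z lz M.
  by exists n1 => // n; exact: n1P.
(* A non-zero residue excludes order 1 for every [n]; this keeps [1] and, at the end, [f] out of the
   ideal. *)
have In z : hT z != 0 -> ~ I z.
  move=> hz; apply: (limit_ideal_notin FU (M := 1)) => n.
  exact: residue_nvge (chi_res n z) hz.
pose P : set RAN := [set x | I (repr x)].
have PE z : P (cls z) <-> I z.
  have Ipred y : y \in ideal_pred (level_relations (N := N) (r := r)) -> I y.
    by move=> /asboolP h'; apply: (h' I); split.
  have h1 : I (repr (cls z) - z).
    by apply: Ipred; apply/ring_projP; exact: ring_proj_repr.
  split=> [Pz|Iz].
    by have -> : z = repr (cls z) - (repr (cls z) - z) by [rewrite subKr]; exact: IB.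
  rewrite /P /=; have -> : repr (cls z) = (repr (cls z) - z) - (0 - z).
    by rewrite sub0r opprK subrK.
  exact: (IB _ _ h1 (IB _ _ I0 Iz)).
have clsK x : cls (repr x) = x := ring_proj_repr x.
have clsD y z : cls (y + z) = cls y + cls z := ring_projD (level_relations (N := N) (r := r)) y z.
have clsM y z : cls (y * z) = cls y * cls z := ring_projM (level_relations (N := N) (r := r)) y z.
have P_prime : is_prime_ideal P.
  split; first split.
  - by rewrite -(rmorph0 (ring_proj (level_relations (N := N) (r := r)))); apply/PE.
  - move=> a x y; rewrite -[a]clsK -[x]clsK -[y]clsK -clsM -clsD => /PE Px /PE Py.
    by apply/PE; exact: ID.
  - rewrite -(rmorph1 (ring_proj (level_relations (N := N) (r := r)))) => /PE.
    by apply: In; rewrite rmorph1 oner_neq0.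
  - move=> x y; rewrite -[x]clsK -[y]clsK -clsM => /PE/(limit_ideal_mul FU)[h'|h']; [left|right];
    exact/PE.
have P_homog : is_homogeneous RAgr P.
  move=> x; rewrite -[x]clsK => /PE Ix.
  pose G (d : nat) : set tens := [set z | RAgr d (cls z) /\ forall n, homog d (chi n z)].
  have : decomposable G (repr x) by apply: decomposable_tens; exact: chi_homog.
  move=> [n [z [Gz xE]]]; exists n, (fun i => Posz (i : 'I_n)), (fun i => cls (z i)); split.
    move=> i; split; first exact: (Gz i).1.
    apply/PE => M; apply: filterS (Ix M) => m /=; rewrite xE rmorph_sum => vm.
    by apply: (homog_sum_vge _ vm) => l; exact: (Gz l).2.
  by rewrite xE; exact: (rmorph_sum (ring_proj (level_relations (N := N) (r := r)))).
have P_inv v : VN v -> v != 0 -> ~ P (RA_inv N v).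
  move=> Vv v0 /PE; have [M MP] := chi_inv v Vv v0; exact: (limit_ideal_notin FU MP).
have P_relevant : is_relevant RAgr P.
  have [v Vv hv] := h_neq0; exists 1, (RA_inv N v).
  have v0 : v != 0.
    apply: contra_neq hv => ->; apply: etrans (rmorph0 h); congr (h _).
    rewrite /RA_inv (RV_inv0 subVN finVN) pure0l.
    exact: (rmorph0 (ring_proj (level_relations (N := N) (r := r)))).
  split=> //; last exact: P_inv.
  move=> G [_]; apply; exists (RV_inv VN v); last by exists 1.
  move=> H [_]; apply; exists [:: RV_inv VN v]; rewrite big_seq1; split=> // y.
  by rewrite inE => /eqP ->; exists v.
exists (ProjPoint P_prime P_homog P_relevant); first by rewrite OmegaE => v Vv v0; exact: P_inv.
rewrite -[f]clsK => /PE; apply: In; apply/eqP => /=.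
by rewrite [ring_proj _ _]clsK => /hP.
Qed.

End Density.

Theorem theorem2p7p6 (Fq : finFieldType) (F : fieldType)
    (iota : {rmorphism Fq -> F}) (infty N : set F) (r : nat)
    (hF : is_global_function_field iota)
    (hinfty : is_place iota infty)
    (hr : (1 <= r)%N)
    (hN : is_A_ideal iota infty N)
    (hN0 : N <> [set 0])
    (hNA : N <> Areg iota infty)
    (hlevel : level_assumption iota infty N) :
  dense (Omega iota infty N r).
Proof.
have [D [_ _ _ _ [g Ag NE]]] := hlevel.
have g0 : g != 0.
  apply/eqP => g0; apply: hN0; rewrite NE g0; apply/seteqP; split=> [_ [y _ <-]|_ ->].
    by rewrite /= mul0r.
  by exists 0; [exact: Areg0 | rewrite mulr0].
have gnu : ~ Areg iota infty g^-1.
  move=> Ag'; apply: hNA; rewrite NE; apply/seteqP; split=> [_ [y Ay <-]|y Ay].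
    exact: AregM.
  by exists (g^-1 * y); [exact: AregM | rewrite mulVKf].
(* The open set is given by [E], and [p] omits some [f] of [E]; every point that omits this [f] lies
   in it. *)
move=> O [p Op] [E OE]; move: Op; rewrite OE => /existsNP[f /not_implyP[Ef pf]].
have [p' Op' p'f] := exists_point_Omega hF Ag g0 NE gnu hlevel pf.
by exists p'; split=> // /(_ f Ef).
Qed.
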